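(* Let $(R,\mathfrak m)$ be a commutative Noetherian local ring, $M$ a finitely generated $R$-module of dimension $d$, and $\underline x=(x_1,\ldots,x_d)$ a system of parameters of $M$. Then $\underline x$ is a dd-sequence of $M$ if and only if $$\chi_1(x_1^{n_1},\ldots,x_d^{n_d};M)=\sum_{i=0}^{p_1(M)}n_1\cdots n_i\,e\bigl(x_1,\ldots,x_i;(0:x_{i+1})_{M/(x_{i+2},\ldots,x_d)M}\bigr)$$ for all positive integers $n_1,\ldots,n_d$.
   Context: $\ell(N)$ is the length of an $R$-module $N$, and $(0:x)_N=\{a\in N: xa=0\}$. $H_i(\underline y;M)$ denotes Koszul homology, and for a system of parameters $\underline x$ of $M$, $\chi_k(\underline x;M)=\sum_{i\ge k}(-1)^{i-k}\ell(H_i(\underline x;M))$; thus $\chi_0(\underline x;M)=e(\underline x;M)$ is the Serre multiplicity and $\chi_1(\underline x;M)=\ell(M/\underline xM)-e(\underline x;M)$. For a finitely generated module $N$ and a sequence $\underline y$ in $\mathfrak m$ with $\ell(N/\underline yN)<\infty$, $e(\underline y;N)=\sum_i(-1)^i\ell(H_i(\underline y;N))$ is the Serre multiplicity; for the empty sequence $e(\emptyset;N)=\ell(N)$, so for $i=0$ the term in the sum is $\ell\bigl(((x_2,\ldots,x_d)M:x_1)/(x_2,\ldots,x_d)M\bigr)$, with empty product $n_1\cdots n_i=1$. Invariant $p_k(M)$: for a system of parameters $\underline x$ of $M$, consider $\chi_k(x_1^{n_1},\ldots,x_d^{n_d};M)$ as a function of positive integers $n_1,\ldots,n_d$; $p_k(M)$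 is the least degree of all polynomials in $n_1,\ldots,n_d$ bounding this function from above. It is known to be independent of the choice of $\underline x$. The zero polynomial has degree $-\infty$, and a sum from $0$ to $-\infty$ is empty. A sequence $x_1,\ldots,x_s$ in $\mathfrak m$ is a d-sequence of a module $N$ if $(x_1,\ldots,x_{i-1})N:x_j=(x_1,\ldots,x_{i-1})N:x_ix_j$ for all $1\le i\le j\le s$. It is a dd-sequence of $M$ if for all $i\in\{1,\ldots,s\}$ and all positive integers $n_1,\ldots,n_s$, the sequence $x_1^{n_1},\ldots,x_i^{n_i}$ is a d-sequence of $M/(x_{i+1}^{n_{i+1}},\ldots,x_s^{n_s})M$. *)

(* Defs.v *)
From HB Require Import structures.
From mathcomp Require Import all_boot all_order all_algebra.
From mathcomp Require Import boolp.
From mathcomp Require Import mpoly.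

Set Implicit Arguments.
Unset Strict Implicit.
Unset Printing Implicit Defensive.

Import Order.TTheory GRing.Theory Num.Theory.
Local Open Scope ring_scope.
Local Open Scope quotient_scope.

(* Submodules are the predicates [S : submodClosed M] of MathComp; an ideal of
   R is a [submodClosed R^o], a proper one an [idealr R]. *)

Section SubQuotient.
Variables (R : pzRingType) (M : lmodType R) (S : submodClosed M).

Record submod := Submod { submod_val : M; _ : submod_val \in S }.

HB.instance Definition _ := [isSub for submod_val].
HB.instance Definition _ := [Choice of submod by <:].
HB.instance Definition _ := [SubChoice_isSubLmodule of submod by <:].

Definition submod_pred : {pred M} := S.

HB.instance Definition _ :=
  GRing.isZmodClosed.Build M submod_pred
    (GRing.submod_closedB (submodClosedP S)).

Definition quotmod := Quotient.quot submod_pred.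

HB.instance Definition _ := Choice.on quotmod.
HB.instance Definition _ := GRing.Zmodule.on quotmod.
HB.instance Definition _ := EqQuotient.on quotmod.

Definition quotmod_scale (a : R) (v : quotmod) : quotmod :=
  \pi_quotmod (a *: repr v).

Lemma pi_quotmod_scale a (v : M) :
  quotmod_scale a (\pi_quotmod v) = \pi_quotmod (a *: v).
Proof.
apply/eqP; rewrite /quotmod_scale -Quotient.idealrBE -scalerBr.
rewrite /submod_pred; apply: rpredZ; have /eqP := reprK (\pi_quotmod v).
by rewrite -Quotient.idealrBE.
Qed.

Lemma pi_quotmodD (u v : M) :
  \pi_quotmod (u + v) = \pi_quotmod u + \pi_quotmod v.
Proof. exact: (@Quotient.pi_add M submod_pred). Qed.

Fact quotmod_scaleA a b v :
  quotmod_scale a (quotmod_scale b v) = quotmod_scale (a * b) v.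
Proof. by rewrite -[v]reprK (pi_quotmod_scale b) !pi_quotmod_scale scalerA ?reprK. Qed.

Fact quotmod_scale1 : left_id 1 quotmod_scale.
Proof. by move=> v; rewrite -[v]reprK pi_quotmod_scale scale1r. Qed.

Fact quotmod_scaleDr : right_distributive quotmod_scale +%R.
Proof.
move=> a u v; rewrite -[u]reprK -[v]reprK -pi_quotmodD !pi_quotmod_scale.
by rewrite scalerDr pi_quotmodD.
Qed.

Fact quotmod_scaleDl v : {morph quotmod_scale^~ v : a b / a + b}.
Proof.
move=> a b; rewrite -[v]reprK !pi_quotmod_scale scalerDl.
exact: pi_quotmodD.
Qed.

HB.instance Definition _ := GRing.Zmodule_isLmodule.Build R quotmod
  quotmod_scaleA quotmod_scale1 quotmod_scaleDr quotmod_scaleDl.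

End SubQuotient.

Section Span.
Variables (R : comNzRingType) (M : lmodType R).
Implicit Types (y : seq R) (a : R).

Definition smul y : {pred M} :=
  fun v => `[< exists c : 'I_(size y) -> M, v = \sum_(i < size y) y`_i *: c i >].

Fact smul_submod y : submod_closed (smul y).
Proof.
split.
  by apply/asboolP; exists (fun=> 0); rewrite big1 // => i _; rewrite scaler0.
move=> a u v /asboolP[c ->] /asboolP[e ->].
apply/asboolP; exists (fun i => a *: c i + e i).
rewrite scaler_sumr -big_split; apply: eq_bigr => i _ /=.
by rewrite scalerDr !scalerA mulrC.
Qed.

HB.instance Definition _ y :=
  GRing.isSubmodClosed.Build R M (smul y) (smul_submod y).

Definition colon (S : submodClosed M) a : {pred M} := fun v => a *: v \in S.

Definition ann_by a : {pred M} := fun v => a *: v == 0.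

Fact ann_by_submod a : submod_closed (ann_by a).
Proof.
split; first by rewrite unfold_in scaler0.
move=> b u v; rewrite !unfold_in => /eqP au /eqP av.
by rewrite scalerDr av addr0 scalerA mulrC -scalerA au scaler0.
Qed.

HB.instance Definition _ a :=
  GRing.isSubmodClosed.Build R M (ann_by a) (ann_by_submod a).

Definition fin_gen (S : {pred M}) : Prop :=
  exists g : seq M, forall v, v \in S <->
    exists c : 'I_(size g) -> R, v = \sum_(i < size g) c i *: g`_i.

End Span.

Arguments smul {R} M y _.
Arguments ann_by {R} M a _.

(* M / (y_1, ..., y_s)M and (0 : a)_N *)
Definition modmul (R : comNzRingType) (M : lmodType R) (y : seq R)
  : lmodType R := quotmod (smul M y).
Definition kerby (R : comNzRingType) (N : lmodType R) (a : R)
  : lmodType R := submod (ann_by N a).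

Definition psubset T (A B : {pred T}) : Prop :=
  {subset A <= B} /\ ~ {subset B <= A}.

Definition submod_chain (R : pzRingType) (N : lmodType R) (n : nat) : Prop :=
  exists C : 'I_n.+1 -> submodClosed N,
    forall i j : 'I_n.+1, (i < j)%N -> psubset (C i) (C j).

Definition has_length (R : pzRingType) (N : lmodType R) (l : nat) : Prop :=
  forall n, submod_chain N n <-> (n <= l)%N.

Definition finite_length (R : pzRingType) (N : lmodType R) : Prop :=
  exists l, has_length N l.

(* Junk value 0 if no n satisfies P. *)
Definition nat_such (P : nat -> Prop) : nat :=
  if pselect (exists n, P n) is left h then projT1 (cid h) else 0%N.

(* Junk value 0 when N does not have finite length. *)
Definition length (R : pzRingType) (N : lmodType R) : nat :=
  nat_such (has_length N).

Definition noetherian (R : comNzRingType) : Prop :=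
  forall I : submodClosed R^o, fin_gen I.

Definition local (R : comNzRingType) (m : idealr R) : Prop :=
  forall I : idealr R, {subset I <= m}.

Definition prime_chain (R : comNzRingType) (M : lmodType R) (n : nat) : Prop :=
  exists P : 'I_n.+1 -> prime_idealr R,
    (forall i (a : R), (forall v : M, a *: v = 0) -> a \in P i) /\
    (forall i j : 'I_n.+1, (i < j)%N -> psubset (P i) (P j)).

(* dim M = dim R / Ann M = d; the zero module has no dimension in nat. *)
Definition has_dim (R : comNzRingType) (M : lmodType R) (d : nat) : Prop :=
  forall n, prime_chain M n <-> (n <= d)%N.

Definition sop (R : comNzRingType) (m : idealr R) (M : lmodType R) (d : nat)
    (x : d.-tuple R) : Prop :=
  [/\ has_dim M d, {subset x <= m} & finite_length (modmul M x)].

Section Koszul.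
Variables (R : comNzRingType) (N : lmodType R) (y : seq R).

(* The Koszul complex K(y; N): the coordinate [c B] of a chain c belongs to the
   basis vector e_{b_1} /\ ... /\ e_{b_p}, where B = {b_1 < ... < b_p}. *)
Definition kchain := {ffun {set 'I_(size y)} -> N}.

(* d (e_{b_1} /\ ... /\ e_{b_p})
     = \sum_r (-1)^(r-1) y_{b_r} e_{b_1} /\ .. (omit b_r) .. /\ e_{b_p} *)
Definition kdiff (c : kchain) : kchain :=
  [ffun B : {set 'I_(size y)} => \sum_(j | j \notin B)
     ((-1) ^+ #|[set k in B | (k < j)%N]| * y`_j) *: c (j |: B)].

Fact kdiff_is_linear : linear kdiff.
Proof.
move=> a u v; apply/ffunP => B; rewrite !ffunE scaler_sumr -big_split.
by apply: eq_bigr => j _; rewrite !ffunE scalerDr !scalerA [a * _]mulrC.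
Qed.

HB.instance Definition _ :=
  GRing.isLinear.Build R kchain kchain _ kdiff kdiff_is_linear.

Definition kdeg (p : nat) : {pred kchain} :=
  fun c => [forall B : {set 'I_(size y)}, (#|B| != p) ==> (c B == 0)].

Fact kdeg_submod p : submod_closed (kdeg p).
Proof.
split; first by apply/forallP => B; rewrite ffunE eqxx implybT.
move=> a u v /forallP up /forallP vp; apply/forallP => B; apply/implyP => Bp.
rewrite !ffunE (eqP (implyP (up B) Bp)) (eqP (implyP (vp B) Bp)).
by rewrite scaler0 addr0.
Qed.

HB.instance Definition _ p :=
  GRing.isSubmodClosed.Build R kchain (kdeg p) (kdeg_submod p).

Definition kcycle (p : nat) : {pred kchain} :=
  fun c => (c \in kdeg p) && (kdiff c == 0).

Fact kcycle_submod p : submod_closed (kcycle p).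
Proof.
split; first by rewrite unfold_in rpred0 linear0 eqxx.
move=> a u v /andP[up /eqP du] /andP[vp /eqP dv].
by rewrite unfold_in rpredD ?rpredZ // linearP /= du dv scaler0 addr0 eqxx.
Qed.

HB.instance Definition _ p :=
  GRing.isSubmodClosed.Build R kchain (kcycle p) (kcycle_submod p).

Definition kboundary (p : nat) : {pred submod (kcycle p)} :=
  fun z => `[< exists2 b, b \in kdeg p.+1 & \val z = kdiff b >].

Fact kboundary_submod p : submod_closed (@kboundary p).
Proof.
split; first by apply/asboolP; exists 0; rewrite ?rpred0 ?linear0.
move=> a u v /asboolP[b bp ub] /asboolP[c cp vc].
apply/asboolP; exists (a *: b + c); first by rewrite rpredD ?rpredZ.
by rewrite !linearP /= ub vc.
Qed.

HB.instance Definition _ p :=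
  GRing.isSubmodClosed.Build R (submod (kcycle p)) (@kboundary p)
    (kboundary_submod p).

Definition koszul_homology (p : nat) : lmodType R := quotmod (@kboundary p).

Definition chi (k : nat) : int :=
  \sum_(k <= i < (size y).+1)
     (-1) ^+ (i - k) * (length (koszul_homology i))%:Z.

Definition serre_mult : int := chi 0.

End Koszul.

Section Powers.
Variables (R : comNzRingType) (M : lmodType R) (d : nat).

Definition pw (x : d.-tuple R) (n : 'I_d -> nat) : d.-tuple R :=
  [tuple tnth x i ^+ n i | i < d].

Definition bound_size (k : nat) (x : d.-tuple R) (s : nat) : Prop :=
  exists f : {mpoly rat[d]}, msize f = s /\
    forall n : 'I_d -> nat, (forall i, (0 < n i)%N) ->
      (chi M (pw x n) k)%:~R <= f.@[fun i => (n i)%:R].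

(* [nat_such] picks the least size, in the convention [msize f = 1 + deg f],
   [msize 0 = 0], of the polynomials
   bounding chi_k from above: this is 1 + p_k(M), or 0 if
   p_k(M) = -oo.  It is computed from the given system of parameters x, of
   which p_k(M) is known to be independent. *)
Definition p_size (k : nat) (x : d.-tuple R) : nat :=
  nat_such (fun s =>
    bound_size k x s /\ forall t, bound_size k x t -> (s <= t)%N).

End Powers.

Definition d_sequence (R : comNzRingType) (N : lmodType R) (y : seq R)
    : Prop :=
  forall i j, (i <= j)%N -> (j < size y)%N ->
    colon (smul N (take i y)) y`_j =i colon (smul N (take i y)) (y`_i * y`_j).

Definition dd_sequence (R : comNzRingType) (M : lmodType R) (s : nat)
    (x : s.-tuple R) : Prop :=
  forall i, (0 < i <= s)%N ->
  forall n : 'I_s -> nat, (forall j, (0 < n j)%N) ->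
    d_sequence (modmul M (drop i (pw x n))) (take i (pw x n)).

(* Main.v *)
(* Write l(n) for the length of M / (x_1^n_1, ..., x_d^n_d)M and
   E_i(n) = e(x_1, ..., x_i; (0 : x_(i+1)^n_(i+1))) on M / (x_j^n_j, j > i + 1)M.
   Peeling off x_d, ..., x_1 in turn with e(y, z; N) = e(y; N/zN) - e(y; (0 : z)_N)
   gives l(n) = sum_(i <= d) n_1 ... n_i E_i(n), where E_d = e(x; M).  As E_i(n)
   depends only on n_(i+1), ..., n_d and is eventually constant in n_(i+1), an
   identity l(n) = sum_(i <= d) n_1 ... n_i c_i with constants c_i forces E_i(n) = c_i.
   So the theorem reduces to: x is a dd-sequence if and only if l has this nested
   form.

   If x is a dd-sequence, (B : y) = (B : y^2) makes l affine in each variable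
   separately, and the constant coefficient in n_k is bounded as a function of
   n_(k+1), which excludes the unwanted monomials.  Conversely, adding powers of the
   remaining elements to B and using Krull's intersection theorem, the inclusion
   (B : x_i x_j) <= (B : x_j) only has to be checked when all other elements lie in B:
   there l is a + b n_i + c n_i n_j, and comparing lengths suffices. *)
Require Import Defs.
From HB Require Import structures.
From mathcomp Require Import all_boot all_order all_algebra.
From mathcomp Require Import boolp mpoly zify ring.
Import Order.TTheory GRing.Theory Num.Theory.
Local Open Scope ring_scope.

Set Implicit Arguments.
Unset Strict Implicit.
Unset Printing Implicit Defensive.

(** * Submodules and lengths of subquotients *)

(** The recursion for e passes from M to submodules of its quotients, where finiteness of the
    lengths is no longer given. Everything therefore takes place among the subquotients of one fixed
    Noetherian module, and a weak form of Artin-Rees, obtained from a maximal submodule, shows that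
    a multiplicity system stays one on every subquotient. Krull's theorem comes from the same
    source. Koszul homology is linked with the recursion only once, through the long exact sequence
    of a mapping cone; additivity, the rule for powers and nonnegativity of e are proved from the
    recursion alone. Nonnegativity is what brings in p_1: the E_i cannot cancel, so on the diagonal
    n_1 = ... = n_d = t a polynomial above chi_1 has degree at least i as soon as E_i is nonzero,
    and the sum may stop at p_1. What matters in a + b n_i + c n_i n_j is the absent monomial n_j:
    the constant coefficient in n_i is then bounded in n_j, which controls (B : x_i) modulo (x_i,
    x_j^t, B) uniformly in t. *)

Section Smod.
Variables (R : comNzRingType) (V : lmodType R).

(* Bundled and Prop-valued, so that submodules with the same elements are equal.
   A subquotient A / B of V is handled as the pair of submodules B <= A. *)
Record smod := Smod {
  smem :> V -> Prop;
  smem0 : smem 0;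
  smemL : forall a u v, smem u -> smem v -> smem (a *: u + v) }.

Implicit Types (A B C D : smod) (a b : R) (u v w : V).

Lemma smemD A u v : A u -> A v -> A (u + v).
Proof. by move=> Au Av; rewrite -[u]scale1r; apply: smemL. Qed.

Lemma smemZ A a u : A u -> A (a *: u).
Proof. by move=> Au; rewrite -[_ *: _]addr0; apply: smemL => //; apply: smem0. Qed.

Lemma smemN A u : A u -> A (- u).
Proof. by move=> Au; rewrite -scaleN1r; apply: smemZ. Qed.

Lemma smemB A u v : A u -> A v -> A (u - v).
Proof. by move=> Au Av; apply: smemD => //; apply: smemN. Qed.

Lemma smemDr A u v : A v -> A (u + v) -> A u.
Proof. by move=> Av /smemB /(_ Av); rewrite addrK. Qed.

Lemma smemBr A u v : A v -> A (u - v) -> A u.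
Proof. by move=> Av /smemD /(_ Av); rewrite subrK. Qed.

Definition sle A B := forall u, A u -> B u.

Lemma smod_ext A B : (forall u, A u <-> B u) -> A = B.
Proof.
case: A B => [A A0 AL] [B B0 BL] /= AB.
have eAB : A = B by apply: funext => u; apply: propext.
by case: _ / eAB in B0 BL AB *; congr Smod; apply: Prop_irrelevance.
Qed.

Lemma sle_anti A B : sle A B -> sle B A -> A = B.
Proof. by move=> AB BA; apply: smod_ext => u; split; [apply: AB|apply: BA]. Qed.

Lemma sle_trans B A C : sle A B -> sle B C -> sle A C.
Proof. by move=> AB BC u /AB /BC. Qed.

Lemma sle_refl A : sle A A. Proof. by []. Qed.

Definition sbot : smod.
Proof.
by exists (fun u => u = 0) => // a u v -> ->; rewrite scaler0 addr0.
Defined.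

Definition stop : smod. Proof. by exists (fun=> True). Defined.

Definition scap A B : smod.
Proof.
exists (fun u => A u /\ B u); first by split; apply: smem0.
by move=> a u v [Au Bu] [Av Bv]; split; apply: smemL.
Defined.

Definition sadd A B : smod.
Proof.
exists (fun w => exists2 u, A u & B (w - u)).
  by exists 0; [|rewrite subr0]; apply: smem0.
move=> a w w' [u Au Bu] [u' Au' Bu']; exists (a *: u + u'); first exact: smemL.
by rewrite opprD addrACA -scalerBr; apply: smemL.
Defined.

Definition scol B a : smod.
Proof.
exists (fun u => B (a *: u)); first by rewrite scaler0; apply: smem0.
move=> c u v Bu Bv; rewrite scalerDr scalerA mulrC -scalerA.
exact: smemL.
Defined.

Definition scal a A : smod.
Proof.
exists (fun w => exists2 u, A u & w = a *: u).
  by exists 0; [apply: smem0|rewrite scaler0].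
move=> c w w' [u Au ->] [u' Au' ->]; exists (c *: u + u'); first exact: smemL.
by rewrite scalerDr !scalerA mulrC.
Defined.

End Smod.

Arguments sbot {R V}.
Arguments stop {R V}.

Declare Scope smod_scope.
Delimit Scope smod_scope with S.
Arguments sle {R V} (A B)%_S.
Arguments sadd {R V} (A B)%_S.
Arguments scap {R V} (A B)%_S.
Arguments scal {R V} a%_R A%_S.
Arguments scol {R V} B%_S a%_R.
Notation "A <= B" := (sle A B) : smod_scope.
Notation "A + B" := (sadd A B) : smod_scope.
Notation "A :&: B" := (scap A B) : smod_scope.
Notation "a *: A" := (scal a A) : smod_scope.
Notation "B :/ a" := (scol B a) (at level 40, left associativity) : smod_scope.
Bind Scope smod_scope with smod.
Local Open Scope smod_scope.
Local Open Scope quotient_scope.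

Section SmodTheory.
Variables (R : comNzRingType) (V : lmodType R).
Implicit Types (A B C D : smod V) (a b : R) (u v w : V).

Lemma saddl A B : A <= A + B.
Proof. by move=> u Au; exists u; rewrite ?subrr //; apply: smem0. Qed.

Lemma saddr A B : B <= A + B.
Proof. by move=> u Bu; exists 0; rewrite ?subr0 //; apply: smem0. Qed.

Lemma sadd_le A B C : A <= C -> B <= C -> A + B <= C.
Proof. by move=> AC BC w [u /AC Cu /BC]; apply: smemBr. Qed.

Lemma saddS A B A' B' : A <= A' -> B <= B' -> A + B <= A' + B'.
Proof. by move=> AA BB w [u /AA Au /BB Bu]; exists u. Qed.

Lemma saddC : commutative (@sadd R V).
Proof.
by move=> A B; apply: sle_anti; apply: sadd_le;
  do ?[apply: saddl|apply: saddr].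
Qed.

Lemma saddA : associative (@sadd R V).
Proof.
move=> A B C; apply: sle_anti; do ?apply: sadd_le.
- by apply: sle_trans (@saddl _ _); apply: saddl.
- by apply: sle_trans (@saddl _ _); apply: saddr.
- exact: saddr.
- exact: saddl.
- by apply: sle_trans (@saddr _ _); apply: saddl.
- by apply: sle_trans (@saddr _ _); apply: saddr.
Qed.

Lemma sadd0 : left_id (@sbot R V) (@sadd R V).
Proof.
move=> A; apply: sle_anti; last exact: saddr.
by apply: sadd_le => // u ->; apply: smem0.
Qed.

HB.instance Definition _ :=
  Monoid.isComLaw.Build (smod V) sbot (@sadd R V) saddA saddC sadd0.

Lemma sadd_idr A B : B <= A -> A + B = A.
Proof. by move=> BA; apply: sle_anti; [apply: sadd_le|apply: saddl]. Qed.

Lemma sadd_idl A B : A <= B -> A + B = B.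
Proof. by move=> AB; rewrite saddC; apply: sadd_idr. Qed.

Lemma sle_top A : A <= stop. Proof. by []. Qed.
Lemma sle_bot A : sbot <= A. Proof. by move=> u ->; apply: smem0. Qed.

Lemma scapl A B : A :&: B <= A. Proof. by move=> u []. Qed.
Lemma scapr A B : A :&: B <= B. Proof. by move=> u []. Qed.

Lemma scal_addP a A B w :
  (a *: A + B)%S w <-> exists2 u, A u & B (w - a *: u)%R.
Proof.
split=> [[_ [u Au ->]]|[u Au Bu]]; first by exists u.
by exists (a *: u)%R => //; exists u.
Qed.

Lemma scal_sub a A : a *: A <= A.
Proof. by move=> _ [u Au ->]; apply: smemZ. Qed.

Lemma scalS a A B : A <= B -> a *: A <= a *: B.
Proof. by move=> AB _ [u Au ->]; exists u => //; apply: AB. Qed.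

Lemma scal_le a A B : a *: A <= B <-> A <= B :/ a.
Proof.
split=> [h u Au|h _ [u Au ->]]; last exact: h.
by apply: h; exists u.
Qed.

Lemma scalM a b A : (a * b)%R *: A = a *: (b *: A).
Proof.
apply: smod_ext => w; split=> [[u Au ->]|[_ [u Au ->] ->]].
  by exists (b *: u)%R; rewrite ?scalerA //; exists u.
by exists u; rewrite ?scalerA.
Qed.

Lemma scal1 A : 1 *: A = A.
Proof.
apply: smod_ext => w; split=> [[u Au ->]|Aw]; first by rewrite scale1r.
by exists w; rewrite ?scale1r.
Qed.

Lemma scol_le a B : B <= B :/ a.
Proof. by move=> u Bu; apply: smemZ. Qed.

Lemma scolS a A B : A <= B -> A :/ a <= B :/ a.
Proof. by move=> AB u; apply: AB. Qed.

Lemma scolM a b B : B :/ (a * b)%R = B :/ a :/ b.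
Proof. by apply: smod_ext => u /=; rewrite scalerA. Qed.

Lemma scolMS a b B : B :/ a <= B :/ (a * b)%R.
Proof. by rewrite mulrC scolM => u /=; apply: smemZ. Qed.

(** The last member of the chain only has to contain B, which makes [ch] monotone in A and lets
    chains be concatenated. *)
Fixpoint ch A B n : Prop :=
  if n is n'.+1 then exists C, [/\ C <= A, ~ A <= C & ch C B n'] else B <= A.

Lemma ch_ge A B n : ch A B n -> B <= A.
Proof. by elim: n A => //= n IH A [C [CA _ /IH BC]]; apply: sle_trans CA. Qed.

Lemma ch_mono A A' B n : A <= A' -> ch A B n -> ch A' B n.
Proof.
case: n => /= [AA|n AA [C [CA nAC chC]]]; first by move/sle_trans; apply.
exists C; split=> //; first exact: sle_trans AA.
by move=> A'C; apply: nAC; apply: sle_trans A'C.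
Qed.

Lemma ch_down A B m n : (m <= n)%N -> ch A B n -> ch A B m.
Proof.
elim: n m A => [|n IH] [|m] A //; first by move=> _ /ch_ge.
by move=> mn /= [C [CA nAC /(IH _ _ mn) chC]]; exists C.
Qed.

Lemma ch_cat A C B m n : ch A C m -> ch C B n -> ch A B (m + n).
Proof.
elim: m A => [|m IH] A /=; first exact: ch_mono.
by move=> [D [DA nAD /IH chD]] /chD ?; exists D.
Qed.

(** Ensures that a strict step of a chain stays strict in the sum with C or in the intersection with
    C. *)
Lemma modular A D C : D <= A -> A <= D + C -> A :&: C <= D -> A <= D.
Proof.
move=> DA AD AC u Au; have [v Dv Cuv] := AD u Au.
by apply: (smemBr Dv); apply: AC; split=> //; apply: smemB => //; apply: DA.
Qed.

Lemma ch_split A C B n : B <= C -> ch A B n ->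
  exists p q, [/\ (n <= p + q)%N, ch (A + C) C p & ch (A :&: C) B q].
Proof.
move=> BC; elim: n A => [|n IH] A /=.
  by move=> BA; exists 0, 0; split=> //=; [apply: saddr|move=> u Bu; split; auto].
move=> [D [DA nAD /IH [p [q [npq chp chq]]]]].
have DCA : D + C <= A + C by apply: saddS.
have DcA : D :&: C <= A :&: C by move=> u [/DA].
have [ADC|nADC] := EM (A + C <= D + C).
  exists p, q.+1; split; first by rewrite addnS ltnS.
    exact: ch_mono chp.
  exists (D :&: C); split=> // ACD; apply: nAD; apply: (modular DA).
    by apply: sle_trans ADC; apply: saddl.
  by apply: sle_trans ACD _; apply: scapl.
exists p.+1, q; split; first by rewrite addSn ltnS.
  by exists (D + C); split.
exact: ch_mono chq.
Qed.

Definition has_len A B l := forall n, ch A B n <-> (n <= l)%N.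
Definition flen A B := exists l, has_len A B l.
Definition len A B : nat := nat_such (has_len A B).

Arguments len (A B)%_S.
Arguments flen (A B)%_S.
Arguments has_len (A B)%_S l%_N.

Lemma nat_suchP (P : nat -> Prop) : (exists n, P n) -> P (nat_such P).
Proof.
by rewrite /nat_such; case: pselect => // h _; apply: (projT2 (cid h)).
Qed.

Lemma has_len_uniq A B l l' : has_len A B l -> has_len A B l' -> l = l'.
Proof.
move=> h h'; apply/eqP; rewrite eqn_leq; apply/andP; split.
  by apply/(h' l)/(h l).
by apply/(h l')/(h' l').
Qed.

Lemma lenE A B l : has_len A B l -> len A B = l.
Proof. by move=> h; apply: has_len_uniq (h); apply: nat_suchP; exists l. Qed.

Lemma lenP A B : flen A B -> has_len A B (len A B).
Proof. exact: nat_suchP. Qed.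

Lemma flen_ge A B : flen A B -> B <= A.
Proof. by case=> l /(_ 0) [_ /(_ isT)]. Qed.

Lemma flen_bound A B l : B <= A -> (forall n, ch A B n -> (n <= l)%N) -> flen A B.
Proof.
move=> BA bl; suff [k [chk maxk]] : exists k, ch A B k /\ forall n, ch A B n -> (n <= k)%N.
  by exists k => n; split=> [/maxk//|/ch_down]; apply.
have [//||k /asboolP chk maxk] := @ex_maxnP (fun n => `[< ch A B n >]) l.
- by exists 0%N; apply/asboolP.
- by move=> n /asboolP/bl.
by exists k; split=> // n chn; apply: maxk; apply/asboolP.
Qed.

Lemma flen_refl A : flen A A.
Proof.
apply: (@flen_bound _ _ 0) => // -[//|n] /= [C [CA nAC /ch_ge]].
by move/nAC.
Qed.

Lemma len_refl A : len A A = 0%N.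
Proof.
apply/eqP; rewrite -leqn0; have /(_ (len A A)) [_ /(_ (leqnn _))] := lenP (flen_refl A).
by case: (len A A) => // n /= [C [CA nAC /ch_ge /nAC]].
Qed.

Lemma has_len_cat A C B p q : has_len A C p -> has_len C B q ->
  has_len A B (p + q).
Proof.
move=> hp hq n; have BC : B <= C by apply: flen_ge; exists q.
have CA : C <= A by apply: flen_ge; exists p.
split=> [chn|/ch_down]; last by apply; apply: ch_cat; [apply/hp|apply/hq].
have [p' [q' [npq chp chq]]] := ch_split BC chn.
apply: leq_trans npq _; apply: leq_add; first by apply/hp; rewrite sadd_idr in chp.
by apply/hq; apply: ch_mono chq; apply: scapr.
Qed.

Lemma flen_cat A C B : flen A C -> flen C B -> flen A B.
Proof. by move=> [p hp] [q hq]; exists (p + q)%N; apply: has_len_cat hp hq. Qed.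

Lemma len_cat A C B : flen A C -> flen C B -> len A B = (len A C + len C B)%N.
Proof. by move=> /lenP hp /lenP hq; apply: lenE; apply: has_len_cat. Qed.

Lemma flen_up A C B : flen A B -> B <= C -> C <= A -> flen A C.
Proof.
move=> [l hl] BC CA; apply: (@flen_bound _ _ l) => // n chn; apply/hl.
by have := @ch_cat _ _ B _ 0 chn BC; rewrite addn0.
Qed.

Lemma flen_down A C B : flen A B -> B <= C -> C <= A -> flen C B.
Proof.
by move=> [l hl] BC CA; apply: (@flen_bound _ _ l) => // n chn; apply/hl/ch_mono/chn.
Qed.

Lemma len_split A C B : flen A B -> B <= C -> C <= A ->
  len A B = (len A C + len C B)%N.
Proof. by move=> f BC CA; apply: len_cat; [apply: (flen_up f)|apply: (flen_down f)]. Qed.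

Lemma len_eq0 A B : flen A B -> len A B = 0%N -> A = B.
Proof.
move=> f e0; apply: contrapT => nAB.
have [h _] := lenP f 1; rewrite e0 in h; suff: (1 <= 0)%N by []; apply: h => /=.
exists B; split=> //=; first exact: flen_ge.
by move=> AB; apply: nAB; apply: sle_anti => //; apply: flen_ge.
Qed.

Lemma len_sub A B A' B' : flen A B -> B <= B' -> B' <= A' -> A' <= A ->
  (len A' B' <= len A B)%N.
Proof.
move=> f BB BA AA; have BA' : B' <= A by apply: sle_trans AA.
rewrite (len_split f BB BA') (@len_split A A' B') //; first by lia.
exact: (flen_up f).
Qed.

End SmodTheory.

Arguments ch {R V} (A B)%_S n%_N.
Arguments len {R V} (A B)%_S.
Arguments flen {R V} (A B)%_S.
Arguments has_len {R V} (A B)%_S l%_N.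

(** * Isomorphic subquotients have equal length *)

Section Map.
Variables (R : comNzRingType) (V W : lmodType R) (f : V -> W).
Hypothesis lf : linear f.
Variables (A A0 : smod V) (D D0 : smod W).
Hypotheses (AA0 : A0 <= A) (DD0 : D0 <= D).
Hypothesis fA : forall u, A u -> D (f u).
Hypothesis fD : forall w, D w -> exists2 u, A u & D0 (w - f u)%R.
Hypothesis fA0 : forall u, A u -> D0 (f u) <-> A0 u.

Let fB u v : f (u - v) = (f u - f v)%R.
Proof. by rewrite addrC -scaleN1r lf scaleN1r addrC. Qed.

Let f0 : f 0 = 0%R.
Proof. by rewrite -{1}(subrr (0%R : V)) fB subrr. Qed.

Definition spre (C : smod W) : smod V.
Proof.
exists (fun u => C (f u)).
  by rewrite f0; apply: smem0.
by move=> a u v Cu Cv; rewrite lf; apply: smemL.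
Defined.

(** The image is enlarged by D0 so that it lies above D0; for D0 = [sbot] it is the plain image. *)
Definition simg (C : smod V) : smod W.
Proof.
exists (fun w => exists2 u, C u & D0 (w - f u)%R).
  exists 0%R; first exact: smem0.
  by rewrite f0 subrr; apply: smem0.
move=> a w w' [u Cu Du] [v Cv Dv]; exists (a *: u + v)%R; first exact: smemL.
by rewrite lf opprD addrACA -scalerBr; apply: smemL.
Defined.

Lemma ch_img C n : C <= A -> ch C A0 n -> ch (simg C) D0 n.
Proof.
elim: n C => [|n IH] C CA /=.
  move=> _ w Dw; exists 0%R; first exact: smem0.
  by rewrite f0 subr0.
move=> [C' [C'C nCC chC]]; have C'A : C' <= A by apply: sle_trans CA.
exists (simg C'); split; last exact: IH.
  by move=> w [u /C'C Cu Dw]; exists u.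
move=> sCC; apply: nCC => u Cu.
have [|v C'v] := sCC (f u); first by exists u => //; rewrite subrr; apply: smem0.
rewrite -fB fA0; last by apply: smemB; [apply: CA|apply: C'A].
by move/(ch_ge chC); apply: smemBr.
Qed.

Lemma ch_pre C n : C <= D -> ch C D0 n -> ch (spre C :&: A) A0 n.
Proof.
elim: n C => [|n IH] C CD /=.
  by move=> DC u A0u; have Au := AA0 A0u; split=> //; apply: DC; apply/fA0.
move=> [C' [C'C nCC chC]]; have C'D : C' <= D by apply: sle_trans CD.
exists (spre C' :&: A); split; last exact: IH.
  by move=> u [/= /C'C].
move=> sCC; apply: nCC => w Cw.
have [u Au Du] := fD (CD _ Cw).
have Cu : C (f u).
  rewrite -[f u](subKr w); apply: smemB => //; apply: C'C.
  exact: (ch_ge chC).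
have [//|/= C'u _] := sCC u.
by apply: smemBr C'u _; apply: (ch_ge chC).
Qed.

Lemma ch_map n : ch A A0 n <-> ch D D0 n.
Proof.
split=> [/ch_img|/ch_pre]; [move=> /(_ (@sle_refl _ _ _))|move=> /(_ (@sle_refl _ _ _))].
  by apply: ch_mono => w [u /fA Du /DD0]; apply: smemBr.
by apply: ch_mono => u [].
Qed.

Lemma has_len_map l : has_len A A0 l <-> has_len D D0 l.
Proof. by split=> h n; rewrite -h ch_map. Qed.

Lemma flen_map : flen A A0 <-> flen D D0.
Proof. by split=> -[l /has_len_map]; exists l. Qed.

Lemma len_map : len A A0 = len D D0.
Proof.
by congr nat_such; apply: funext => l; apply: propext; apply: has_len_map.
Qed.

End Map.

Section Iso.
Variables (R : comNzRingType) (V : lmodType R).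
Implicit Types (A B C D P : smod V) (a : R).

Lemma scale_linear a : linear ( *:%R a : V -> V).
Proof. by move=> c u v; rewrite scalerDr !scalerA mulrC. Qed.

(** Multiplication by a maps A onto (aA + P)/P with kernel A :&: (P : a). *)
Lemma iso_scal a A P : (flen (a *: A + P) P <-> flen A (A :&: (P :/ a))) /\
  len (a *: A + P) P = len A (A :&: (P :/ a)).
Proof.
have hA0 : A :&: (P :/ a) <= A by apply: scapl.
have hD : P <= a *: A + P by apply: saddr.
have h1 u : A u -> (a *: A + P)%S (a *: u)%R by move=> Au; apply: saddl; exists u.
have h2 w : (a *: A + P)%S w -> exists2 u, A u & P (w - a *: u)%R by move/scal_addP.
have h3 u : A u -> P (a *: u)%R <-> (A :&: (P :/ a))%S u by move=> Au; split=> [|[]].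
split; first by apply: iff_sym; apply: (flen_map (scale_linear a) hA0 hD).
by apply: esym; apply: (len_map (scale_linear a) hA0 hD).
Qed.

Lemma flen_scal a A P : flen (a *: A + P) P <-> flen A (A :&: (P :/ a)).
Proof. by have [] := iso_scal a A P. Qed.

Lemma len_scal a A P : len (a *: A + P) P = len A (A :&: (P :/ a)).
Proof. by have [] := iso_scal a A P. Qed.

Lemma flen_iso2 A P : flen (A + P) P <-> flen A (A :&: P).
Proof.
have := flen_scal 1 A P; rewrite scal1; suff -> : P :/ 1 = P by [].
by apply: smod_ext => u /=; rewrite scale1r.
Qed.

Lemma len_iso2 A P : len (A + P) P = len A (A :&: P).
Proof.
have := len_scal 1 A P; rewrite scal1; suff -> : P :/ 1 = P by [].
by apply: smod_ext => u /=; rewrite scale1r.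
Qed.

Lemma eq_len A B C : flen A B -> B <= C -> C <= A -> len A B = len A C -> C = B.
Proof.
move=> f BC CA e; apply: len_eq0; first exact: flen_down f BC CA.
by have := len_split f BC CA; lia.
Qed.

End Iso.

(** * Noetherian modules *)

Section Noeth.
Variables (R : comNzRingType) (V : lmodType R).
Implicit Types (A B C D : smod V) (a b : R) (u v w : V).

(** The maximal condition, because [artin_rees] and [nakayama] both argue with a maximal
    submodule. *)
Definition noeth := forall P : smod V -> Prop, (exists A, P A) ->
  exists2 A, P A & forall A', P A' -> A <= A' -> A' <= A.

Definition cyc u : smod V.
Proof.
exists (fun w => exists a, w = (a *: u)%R); first by exists 0%R; rewrite scale0r.
by move=> c _ _ [a ->] [b ->]; exists (c * a + b)%R; rewrite scalerDl scalerA.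
Defined.

Lemma cyc_mem u : cyc u u. Proof. by exists 1%R; rewrite scale1r. Qed.

Lemma cyc_le u A : A u -> cyc u <= A.
Proof. by move=> Au _ [a ->]; apply: smemZ. Qed.

Definition gen (g : seq V) : smod V := \big[@sadd R V/sbot]_(u <- g) cyc u.

Lemma gen_le g A : (forall u, u \in g -> A u) -> gen g <= A.
Proof.
rewrite /gen; elim: g => [|u g IH] gA; first by rewrite big_nil; apply: sle_bot.
rewrite big_cons; apply: sadd_le.
  by apply: cyc_le; apply: gA; rewrite mem_head.
by apply: IH => v vg; apply: gA; rewrite in_cons vg orbT.
Qed.

Lemma gen_cat g h : gen (g ++ h) = gen g + gen h.
Proof. exact: big_cat. Qed.

Lemma gen_mem g u : u \in g -> gen g u.
Proof.
rewrite /gen; elim: g => // v g IH; rewrite in_cons big_cons => /orP[/eqP->|/IH gu].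
  by apply: saddl; apply: cyc_mem.
exact: saddr.
Qed.

Definition fg A := exists g, A = gen g.

Definition sunion (f : nat -> smod V)
  (fm : forall i j, (i <= j)%N -> f i <= f j) : smod V.
Proof.
exists (fun u => exists n, f n u); first by exists 0%N; apply: smem0.
move=> c u v [i iu] [j jv]; exists (maxn i j); apply: smemL.
  exact: fm (leq_maxl _ _) _ iu.
exact: fm (leq_maxr _ _) _ jv.
Defined.

(** Without a maximal member, choice yields a strictly ascending chain; finitely many generators of
    its union already lie in one term. *)
Lemma fg_noeth : (forall A, fg A) -> noeth.
Proof.
move=> fgV P exP; apply: contrapT => nomax.
have step A : exists A', P A -> [/\ P A', A <= A' & ~ A' <= A].
  have [PA|nPA] := EM (P A); last by exists A.
  apply: contrapT => nA; apply: nomax; exists A => // A' PA' AA'.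
  by apply: contrapT => nA'A; apply: nA; exists A'.
have [next nextP] := choice step.
have [A0 PA0] := exP; pose f n := iter n next A0.
have Pf n : P (f n) by elim: n => //= n /nextP[].
have fD n k : f n <= f (n + k)%N.
  elim: k => [|k IH]; rewrite ?addn0 ?addnS //; apply: sle_trans IH _.
  by have [] := nextP _ (Pf (n + k)%N).
have fm i j : (i <= j)%N -> f i <= f j by move/subnKC <-; apply: fD.
have [g eg] := fgV (sunion fm).
have [k gk] : exists k, gen g <= f k.
  have : forall u, u \in g -> sunion fm u by move=> u /gen_mem; rewrite eg.
  rewrite /gen; elim: g {eg} => [|u g IH] gf.
    by exists 0%N; rewrite big_nil; apply: sle_bot.
  have [|i gi] := IH; first by move=> v vg; apply: gf; rewrite in_cons vg orbT.
  have [j uj] := gf u (mem_head _ _).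
  exists (maxn i j); rewrite big_cons; apply: sadd_le.
    by apply: sle_trans (fm _ _ (leq_maxr _ _)); apply: cyc_le.
  by apply: sle_trans (fm _ _ (leq_maxl _ _)).
have [_ _] := nextP _ (Pf k); apply; apply: sle_trans gk; rewrite -eg => u fu.
by exists k.+1.
Qed.

Lemma noeth_chain (f : nat -> smod V) : noeth ->
    (forall n, f n <= f n.+1) -> exists k, forall j, (k <= j)%N -> f j = f k.
Proof.
move=> nV fS.
have fm i j : (i <= j)%N -> f i <= f j.
  move/subnKC <-; elim: (j - i)%N => [|n IH]; rewrite ?addn0 ?addnS //.
  exact: sle_trans (fS _).
have [|A [k ->] maxk] := nV (fun A => exists n, A = f n); first by exists (f 0%N), 0%N.
exists k => j kj; apply: sle_anti; last exact: fm.
by apply: maxk; [exists j|apply: fm].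
Qed.

Lemma noeth_scol B a : noeth ->
  exists k, forall j, (k <= j)%N -> B :/ (a ^+ j)%R = B :/ (a ^+ k)%R.
Proof.
move=> nV; apply: (@noeth_chain (fun n => B :/ (a ^+ n)%R)) => // n.
by rewrite exprSr; apply: scolMS.
Qed.

Definition isum (y : seq R) A : smod V := \big[@sadd R V/sbot]_(a <- y) (a *: A).

Lemma isum_nil A : isum [::] A = sbot. Proof. exact: big_nil. Qed.
Lemma isum_cons a y A : isum (a :: y) A = a *: A + isum y A.
Proof. exact: big_cons. Qed.

Lemma isum_le y A B : (forall a, a \in y -> a *: A <= B) -> isum y A <= B.
Proof.
elim: y => [|a y IH] yA; first by rewrite isum_nil; apply: sle_bot.
rewrite isum_cons; apply: sadd_le; first by apply: yA; rewrite mem_head.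
by apply: IH => b yb; apply: yA; rewrite in_cons yb orbT.
Qed.

Lemma isum_ge y A a : a \in y -> a *: A <= isum y A.
Proof.
elim: y => // b y IH; rewrite in_cons isum_cons => /orP[/eqP->|/IH ay].
  exact: saddl.
by apply: sle_trans ay _; apply: saddr.
Qed.

Lemma isum_sub y A : isum y A <= A.
Proof. by apply: isum_le => a _; apply: scal_sub. Qed.

Lemma isumS y A B : A <= B -> isum y A <= isum y B.
Proof. by move=> AB; apply: isum_le => a /(@isum_ge _ B); apply: sle_trans; apply: scalS. Qed.

(* Weak Artin-Rees: a submodule D maximal with D :&: A <= Q absorbs a power of
   every a with aA <= Q. *)
Lemma artin_rees y A Q : noeth -> Q <= A -> (forall a, a \in y -> a *: A <= Q) ->
  exists2 k, (0 < k)%N & A :&: (isum [seq a ^+ k | a <- y]%R stop + Q) <= Q.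
Proof.
move=> nV QA yAQ.
have [|D [QD DAQ] maxD] := nV (fun D => Q <= D /\ D :&: A <= Q).
  by exists Q; split=> // u [].
suff [k k0 yD] : exists2 k, (0 < k)%N & forall a, a \in y -> ((a ^+ k)%R *: stop <= D).
  exists k => // u [Au Du]; apply: DAQ; split=> //; move: u Du {Au}.
  by apply: sadd_le => //; apply: isum_le => _ /mapP[a ya ->]; apply: yD.
have powD a k j : (k <= j)%N -> (a ^+ k)%R *: (@stop R V) <= D -> (a ^+ j)%R *: stop <= D.
  move=> /subnKC <- kD; rewrite exprD mulrC scalM.
  by apply: sle_trans (@scal_sub _ _ (a ^+ (j - k))%R _) _.
have one a : a \in y -> exists k, (a ^+ k)%R *: stop <= D.
  (* Once the colons D : a^k are stable, D + a^k V still meets A inside Q: if u = d + a^k w is in A,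
     then au is in Q, so a^(k+1) w and hence a^k w are in D. Maximality of D gives a^k V <= D. *)
  move=> /yAQ aAQ; have [k kD] := noeth_scol D a nV.
  exists k; apply: sle_trans (@saddr _ _ D _) _; apply: maxD; last exact: saddl.
  split; first by apply: sle_trans QD _; apply: saddl.
  move=> u [[d Dd [w _ ew]] Au]; have : D (a *: u)%R by apply/QD/aAQ; exists u.
  have -> : u = (d + a ^+ k *: w)%R by rewrite -ew addrC subrK.
  rewrite scalerDr addrC => /(smemDr (smemZ a Dd)).
  rewrite scalerA -exprS => Dw; apply: DAQ; split; last by rewrite -ew addrC subrK.
  apply: smemD => //; have /= := kD k.+1 (leqnSn k).
  by move/(congr1 (fun S => smem S w)) => /= <-.
elim: y {yAQ} one => [|a y IH] one; first by exists 1%N.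
have [|k k0 kD] := IH; first by move=> b yb; apply: one; rewrite in_cons yb orbT.
have [j jD] := one a (mem_head _ _).
exists (maxn k j) => [|b]; first by rewrite leq_max k0.
rewrite in_cons => /orP[/eqP->|/kD]; first by apply: (powD _ _ _ _ jD); rewrite leq_maxr.
by apply: powD; rewrite leq_maxl.
Qed.

(** Membership in the Jacobson radical, the form in which locality of R enters. *)
Definition jacobson a := forall b, exists c, (c * (1 - b * a))%R = 1.

Lemma jacobsonX a k : (0 < k)%N -> jacobson a -> jacobson (a ^+ k).
Proof. by case: k => // k _ ja b; rewrite exprSr mulrA; apply: ja. Qed.

(** With D maximal among the proper submodules of C above B, the quotient C/D is simple, and the
    Jacobson radical kills a simple module. *)
Lemma nakayama y B C : noeth -> {in y, forall a, jacobson a} ->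
  B <= C -> C <= isum y C + B -> C <= B.
Proof.
move=> nV jy BC CyC; apply: contrapT => nCB.
have [|D [BD DC nCD] maxD] := nV (fun D => [/\ B <= D, D <= C & ~ C <= D]).
  by exists B; split.
apply: nCD; apply: sle_trans CyC _; apply: sadd_le => //.
apply: isum_le => a /jy ja _ [v Cv ->]; apply: contrapT => nDav.
have /(_ v Cv) : C <= D + cyc (a *: v)%R.
  apply: contrapT => nC; apply: nDav.
  apply: (maxD (D + cyc (a *: v)%R)); [split=> //|exact: saddl|].
  - by apply: sle_trans BD _; apply: saddl.
  - by apply: sadd_le => //; apply: cyc_le; apply: smemZ.
  by apply: saddr; apply: cyc_mem.
move=> [d Dd [r erv]]; have [c ec] := ja r.
apply: nDav; apply: smemZ; rewrite -[v]scale1r -ec -scalerA; apply: smemZ.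
rewrite scalerBl scale1r -scalerA -erv opprB addrC subrK //.
Qed.

Definition sbigcap (F : nat -> smod V) : smod V.
Proof.
exists (fun u => forall k, F k u) => [k|a u v Fu Fv k]; first exact: smem0.
exact: smemL.
Defined.

(** Artin-Rees applied to the intersection C gives C <= yC + B, and Nakayama concludes. *)
Lemma krull y B u : noeth -> {in y, forall a, jacobson a} ->
  (forall k, (0 < k)%N -> (isum [seq a ^+ k | a <- y]%R stop + B)%S u) -> B u.
Proof.
move=> nV jy ku; pose C := sbigcap (fun k => isum [seq a ^+ k.+1 | a <- y]%R stop + B).
have BC : B <= C by move=> v Bv k; apply: saddr.
apply: (@nakayama y B C) => //; last by move=> k; apply: ku.
have [|a ya|[//|k] _ kC] := @artin_rees y C (isum y C + B) nV.
- by apply: sadd_le => //; apply: isum_sub.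
- by apply: sle_trans (@isum_ge _ C _ ya) _; apply: saddl.
move=> v Cv; apply: kC; split=> //; have := Cv k.
by apply: saddS => //; apply: saddr.
Qed.

(** y is a multiplicity system on A/B, the condition under which e(y; A/B) is meaningful. *)
Definition msys y A B := flen A (isum y A + B).

Lemma msys_ge y A B : msys y A B -> B <= A.
Proof. by move/flen_ge; apply: sle_trans; apply: saddr. Qed.

Lemma flen_img a A C D : flen A C -> C <= A -> C <= D :/ a ->
  flen (a *: A + D) D.
Proof.
move=> fAC CA aC; apply/flen_scal; apply: flen_up fAC _ _; last exact: scapl.
by move=> u Cu; split; auto.
Qed.

(** Multiplication by a^k makes A/(aA + D) surject onto (a^k A + D)/(a^(k+1) A + D). *)
Lemma flen_pow1 a k A D : flen A (a *: A + D) -> flen A ((a ^+ k)%R *: A + D).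
Proof.
move=> f1; have DA : D <= A by apply: sle_trans (flen_ge f1); apply: saddr.
elim: k => [|k IH]; first by rewrite expr0 scal1 sadd_idr //; apply: flen_refl.
apply: flen_cat IH _.
have -> : (a ^+ k)%R *: A + D = (a ^+ k)%R *: A + ((a ^+ k.+1)%R *: A + D).
  rewrite saddA [_ *: A + _ *: A]sadd_idr // exprSr scalM.
  by apply: scalS; apply: scal_sub.
apply: (flen_img f1); first exact: flen_ge.
move=> u /scal_addP[v Av Du]; apply/scal_addP; exists v => //.
by rewrite exprSr -scalerA -scalerBr; apply: smemZ.
Qed.

Lemma msys_pow (I : Type) (x : I -> R) (n : I -> nat) s A B :
  msys [seq x i | i <- s] A B -> msys [seq x i ^+ n i | i <- s]%R A B.
Proof.
rewrite /msys; elim: s B => //= i s IH B.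
rewrite !isum_cons -saddA => /(@flen_pow1 (x i) (n i)).
by rewrite saddA (saddC (_ *: _)) -saddA => /IH; rewrite saddA (saddC (isum _ _)).
Qed.

(** Let P be the sum of all a^k A with a in y and of Q = yA' + B'. Artin-Rees gives A' :&: P <= Q
    for some k, and A'/(A' :&: P) embeds in A/P, which has finite length. *)
Lemma msys_sub y A B A' B' : noeth -> msys y A B -> B <= B' -> B' <= A' -> A' <= A ->
  msys y A' B'.
Proof.
move=> nV msy BB BA AA; pose Q := isum y A' + B'.
have [||k k0 kQ] := @artin_rees y A' Q nV.
- by apply: sadd_le => //; apply: isum_sub.
- by move=> a ya; apply: sle_trans (@isum_ge _ A' _ ya) _; apply: saddl.
pose P := isum [seq a ^+ k | a <- y]%R A + Q.
have PA : P <= A.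
  apply: sadd_le; first exact: isum_sub.
  by apply: sle_trans AA; apply: sadd_le => //; apply: isum_sub.
have fAP : flen A P.
  have msP : msys y A B'.
    apply: flen_up msy _ _; first exact: saddS.
    by apply: sadd_le; [apply: isum_sub|apply: sle_trans AA].
  rewrite -[y]map_id in msP.
  apply: flen_up (msys_pow (fun=> k) msP) _ PA.
  by apply: saddS => //; apply: saddr.
have fA'P : flen (A' + P) P.
  by apply: flen_down fAP _ _; [apply: saddr|apply: sadd_le].
have := fA'P; rewrite flen_iso2 => /flen_up; apply.
  by move=> u [A'u Pu]; apply: kQ; split=> //; move: u Pu {A'u}; apply: saddS => //; apply: isumS.
by apply: sadd_le => //; apply: isum_sub.
Qed.

End Noeth.

(** * Multiplicities *)

Section Mult.
Variables (R : comNzRingType).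
Implicit Types (V W : lmodType R) (z w : R) (y : seq R).

(* e(y; A / B), through e(y, z; N) = e(y; N / zN) - e(y; (0 : z)_N).  The element
   removed first is the head of the list, so that the Serre multiplicity of y is
   [emult (rev y)]. *)
Fixpoint emult V y (A B : smod V) : int :=
  if y is z :: y' then (emult y' A (z *: A + B)%S - emult y' (A :&: (B :/ z))%S B)%R
  else (len A B)%:Z.

Arguments emult {V} y (A B)%_S.

(* f induces an isomorphism from A / A0 onto D / D0. *)
Definition siso V W (f : V -> W) (A A0 : smod V) (D D0 : smod W) :=
  [/\ A0 <= A, D0 <= D, forall u, A u -> D (f u),
      forall w : W, D w -> exists2 u, A u & D0 (w - f u)%R
    & forall u, A u -> D0 (f u) <-> A0 u].

Lemma siso_scal V W (f : V -> W) z A A0 D D0 : linear f -> siso f A A0 D D0 ->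
  siso f A (z *: A + A0) D (z *: D + D0).
Proof.
move=> lf [AA DD fA fD fA0].
have fB u v : f (u - v) = (f u - f v)%R.
  by rewrite addrC -scaleN1r lf scaleN1r addrC.
have f0 : f 0 = 0%R by rewrite -{1}(subrr (0%R : V)) fB subrr.
have fZ a u : f (a *: u)%R = (a *: f u)%R by rewrite -[(a *: u)%R]addr0 lf f0 addr0.
split=> //.
- by apply: sadd_le => //; apply: scal_sub.
- by apply: sadd_le => //; apply: scal_sub.
- by move=> w /fD[u Au Du]; exists u => //; apply: saddr.
- move=> u Au; split=> /scal_addP[].
    move=> w /fD[a Aa Dwa] Duw; apply/scal_addP; exists a => //.
    apply/fA0; first by apply: smemB => //; apply: smemZ.
    rewrite fB fZ -[(f u - _)%R](subrKA (z *: w)) -scalerBr; apply: smemD => //.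
    exact: smemZ.
  move=> a Aa A0ua; apply/scal_addP; exists (f a); first exact: fA.
  by rewrite -fZ -fB; apply/fA0 => //; apply: AA.
Qed.

Lemma siso_col V W (f : V -> W) z A A0 D D0 : linear f -> siso f A A0 D D0 ->
  siso f (A :&: (A0 :/ z)) A0 (D :&: (D0 :/ z)) D0.
Proof.
move=> lf [AA DD fA fD fA0].
have fB u v : f (u - v) = (f u - f v)%R.
  by rewrite addrC -scaleN1r lf scaleN1r addrC.
have f0 : f 0 = 0%R by rewrite -{1}(subrr (0%R : V)) fB subrr.
have fZ a u : f (a *: u)%R = (a *: f u)%R by rewrite -[(a *: u)%R]addr0 lf f0 addr0.
split.
- by move=> u A0u; split; [apply: AA|apply: smemZ].
- by move=> u A0u; split; [apply: DD|apply: smemZ].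
- move=> u [Au A0u]; split; first exact: fA.
  by rewrite /= -fZ; apply/fA0 => //; apply: AA.
- move=> w [/fD[u Au Du] Dw]; exists u => //; split=> //.
  rewrite /= -fA0; last exact: smemZ.
  rewrite fZ -[f u](subKr w) scalerBr; apply: smemB => //; exact: smemZ.
- by move=> u [Au _]; apply: fA0.
Qed.

Lemma emult_map V W (f : V -> W) y A A0 D D0 : linear f -> siso f A A0 D D0 ->
  emult y A A0 = emult y D D0.
Proof.
move=> lf; elim: y A A0 D D0 => [|z y IH] A A0 D D0 fAD /=.
  by have [AA DD fA fD fA0] := fAD; rewrite (len_map lf AA DD fA fD fA0).
by congr (_ - _)%R; apply: IH; [apply: siso_scal|apply: siso_col].
Qed.

Lemma msys_map V W (f : V -> W) y A A0 D D0 : linear f -> siso f A A0 D D0 ->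
  msys y A A0 <-> msys y D D0.
Proof.
move=> lf; elim: y A A0 D D0 => [|z y IH] A A0 D D0 fAD.
  rewrite /msys !isum_nil !sadd0.
  by have [AA DD fA fD fA0] := fAD; apply: (flen_map lf AA DD fA fD fA0).
have msE V' (C C0 : smod V') : msys (z :: y) C C0 <-> msys y C (z *: C + C0).
  by rewrite /msys isum_cons -saddA saddA (saddC (_ *: _)) -saddA.
by rewrite !msE; apply: IH; apply: siso_scal.
Qed.

Section Fixed.
Variables (V : lmodType R).
Hypothesis nV : noeth V.
Implicit Types (A B C D : smod V).

Lemma emult_iso2 y A P : emult y (A + P) P = emult y A (A :&: P).
Proof.
apply/esym/(@emult_map _ _ (fun u => u)) => //; split=> //.
- exact: scapl.
- exact: saddr.
- exact: saddl.
by move=> u Au; split=> [|[]].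
Qed.

Lemma emult_scal z y A P : emult y (z *: A + P) P = emult y A (A :&: (P :/ z)).
Proof.
apply/esym/(emult_map _ (scale_linear z)); split=> //.
- exact: scapl.
- exact: saddr.
- by move=> u Au; apply: saddl; exists u.
- by move=> w /scal_addP.
by move=> u Au; split=> [|[]].
Qed.

Lemma msys_cons1 z y A B : msys (z :: y) A B -> msys y A (z *: A + B).
Proof. by rewrite /msys isum_cons -saddA saddA (saddC (_ *: _)) -saddA. Qed.

Lemma msys_cons_nil z y A B : z *: A <= B -> msys (z :: y) A B -> msys y A B.
Proof. by move=> zAB /msys_cons1; rewrite sadd_idl. Qed.

Lemma msys_cons2 z y A B : msys (z :: y) A B -> msys y (A :&: (B :/ z)) B.
Proof.
move=> h; have BA := msys_ge h; apply: (@msys_cons_nil z); first by move=> _ [u [_ Bu] ->].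
apply: msys_sub h _ _ _ => //; last exact: scapl.
by move=> u Bu; split; [apply: BA|apply: smemZ].
Qed.

(** Snake lemma for multiplication by z on 0 -> C/B -> A/B -> A/C -> 0, read on multiplicities by
    induction on the sequence. K/B is the kernel of z on A/B, and L the kernel of C -> A/(zA +
    B). *)
Lemma emult_add y A C B : msys y A B -> B <= C -> C <= A ->
  emult y A B = (emult y A C + emult y C B)%R.
Proof.
elim: y A C B => [|z y IH] A C B.
  rewrite /msys isum_nil sadd0 => f BC CA /=.
  by rewrite (len_split f BC CA) PoszD.
move=> h BC CA /=; have BA := msys_ge h.
have hC : msys (z :: y) A C by apply: msys_sub h _ _ _.
have hCB : msys (z :: y) C B by apply: msys_sub h _ _ _.
have zAA : z *: A <= A by apply: scal_sub.
have zCA : z *: C <= z *: A by apply: scalS.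
set K := A :&: (B :/ z); set L := C :&: (z *: A + B).
have e1 : emult y A (z *: A + B) = (emult y A (z *: A + C) + emult y C L)%R.
  rewrite (@IH A (z *: A + C)); first last.
  - exact: sadd_le.
  - exact: saddS.
  - exact: msys_cons1.
  rewrite -emult_iso2; congr (_ + emult y _ _)%R; rewrite saddA (saddC C) -saddA.
  by rewrite [C + B]sadd_idr.
have zCL : z *: C + B <= L.
  move=> u zu; split; last by move: u zu; apply: saddS.
  by move: u zu; apply: sadd_le => //; apply: scal_sub.
have e2 : emult y C (z *: C + B) = (emult y C L + emult y L (z *: C + B))%R.
  by apply: IH => //; [apply: msys_cons1|apply: scapl].
have e3 : emult y K B = (emult y K (C :&: (B :/ z)) + emult y (C :&: (B :/ z)) B)%R.
  apply: IH; first exact: msys_cons2.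
    by move=> u Bu; split; [apply: BC|apply: smemZ].
  by move=> u [Cu Bu]; split; [apply: CA|].
have e4 : emult y (A :&: (C :/ z)) C =
          (emult y (A :&: (C :/ z)) (K + C) + emult y K (C :&: (B :/ z)))%R.
  rewrite (@IH _ (K + C)); first last.
  - apply: sadd_le; first by move=> u [Au Bu]; split=> //; apply: BC.
    by move=> u Cu; split; [apply: CA|apply: smemZ].
  - exact: saddr.
  - exact: msys_cons2.
  rewrite emult_iso2; congr (_ + emult y _ _)%R; apply: smod_ext => u.
  by split=> [[[Au Bu] Cu]|[Cu Bu]]; do 2?split; auto.
(* The connecting map of the snake lemma: z carries the cokernel of K -> (0 : z) in A/C onto the
   kernel of C/(zC + B) -> A/(zA + B). *)
have e5 : emult y (A :&: (C :/ z)) (K + C) = emult y L (z *: C + B).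
  apply: (emult_map _ (scale_linear z)); split=> //.
  - apply: sadd_le; first by move=> u [Au Bu]; split=> //; apply: BC.
    by move=> u Cu; split; [apply: CA|apply: smemZ].
  - by move=> u [Au Cu]; split=> //; apply: saddl; exists u.
  - move=> w [Cw /scal_addP[u Au Bu]]; exists u; last exact: saddr.
    split=> //=; rewrite -[(z *: u)%R](subKr w); apply: smemB => //; exact: BC.
  - move=> u [Au Cu]; split.
      move=> /scal_addP[c Cc]; rewrite -scalerBr => Buc; rewrite saddC.
      by exists c => //; split=> //; apply: smemB => //; apply: CA.
    rewrite saddC => -[c Cc [_ Buc]]; apply/scal_addP; exists c => //.
    by rewrite -scalerBr.
rewrite e1 e2 e3 e4 e5; ring.
Qed.

Lemma emult_refl y A : emult y A A = 0.
Proof.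
have msA : msys y A A by rewrite /msys sadd_idl; [apply: flen_refl|apply: isum_sub].
by have := emult_add msA (@sle_refl _ _ A) (@sle_refl _ _ A); lia.
Qed.

Lemma msys_mull z w y A B : msys ((z * w)%R :: y) A B -> msys (w :: y) A B.
Proof.
move=> h; have BA := msys_ge h; move: h; rewrite /msys !isum_cons => /flen_up; apply.
  do 2!apply: saddS => //; rewrite scalM; exact: scal_sub.
by rewrite -isum_cons; apply: sadd_le => //; apply: isum_sub.
Qed.

(** Filter the cokernel of zw by wA + B and its kernel by Kz: w identifies the extra cokernel with
    A/(zA + Kw), and z the extra kernel with L/B. In e(z) + e(w) the contribution of Kw/L cancels,
    which leaves the same four terms. *)
Lemma emult_mul z w y A B : msys ((z * w)%R :: y) A B ->
  emult ((z * w)%R :: y) A B = (emult (z :: y) A B + emult (w :: y) A B)%R.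
Proof.
move=> h /=; have BA := msys_ge h; have hw := msys_mull h.
have hz : msys (z :: y) A B by apply: (@msys_mull w); rewrite mulrC.
have zAA a : a *: A <= A by apply: scal_sub.
set Kw := A :&: (B :/ w); set Kz := A :&: (B :/ z).
set L := Kw :&: (z *: A + B).
have LE : Kw :&: (z *: A + B) = L by [].
have BK a : B <= A :&: (B :/ a) by move=> u Bu; split; [apply: BA|apply: smemZ].
have e1 : emult y A ((z * w)%R *: A + B) = (emult y A (w *: A + B) + emult y A (z *: A + Kw))%R.
  rewrite (@emult_add y A (w *: A + B)); first last.
  - exact: sadd_le.
  - by apply: saddS => //; rewrite scalM; apply: scal_sub.
  - exact: msys_cons1.
  congr (_ + _)%R; apply/esym/(emult_map _ (scale_linear w)); split.
  - by apply: sadd_le => //; apply: scapl.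
  - by apply: saddS => //; rewrite scalM; apply: scal_sub.
  - by move=> u Au; apply: saddl; exists u.
  - by move=> u /scal_addP[v Av Bv]; exists v => //; apply: saddr.
  move=> u Au; split=> /scal_addP[a Aa].
    move=> Bua; apply/scal_addP; exists a => //; split.
      by apply: smemB => //; apply: smemZ.
    by rewrite /= scalerBr scalerA mulrC.
  by move=> [_ /= Bua]; apply/scal_addP; exists a => //; rewrite mulrC -scalerA -scalerBr.
have e2 : emult y A (z *: A + B) = (emult y A (z *: A + Kw) + emult y Kw L)%R.
  rewrite (@emult_add y A (z *: A + Kw)); first last.
  - by apply: sadd_le => //; apply: scapl.
  - by apply: saddS => //; apply: BK.
  - exact: msys_cons1.
  congr (_ + _)%R; rewrite -emult_iso2 saddA (saddC Kw) -saddA [Kw + B]sadd_idr //.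
  exact: BK.
have e3 : emult y (A :&: (B :/ (z * w)%R)) B = (emult y L B + emult y Kz B)%R.
  rewrite (@emult_add y _ Kz); first last.
  - by move=> u [Au Bu]; split=> //; apply: scolMS.
  - exact: BK.
  - exact: msys_cons2.
  congr (_ + _)%R; apply: (emult_map _ (scale_linear z)); split.
  - by move=> u [Au Bu]; split=> //; apply: scolMS.
  - by move=> u Bu; split; [apply: BK|apply: saddr].
  - move=> u [Au Bu]; split; last by apply: saddl; exists u.
    by split; [apply: smemZ|rewrite /= scalerA mulrC].
  - move=> v [[Av Bv] /scal_addP[u Au Bu]]; exists u => //; split=> //=.
    rewrite mulrC -scalerA -[(z *: u)%R](subKr v) scalerBr; apply: smemB => //.
    exact: smemZ.
  by move=> u [Au Bu]; split=> [|[]].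
have e4 : emult y Kw B = (emult y Kw L + emult y L B)%R.
  apply: emult_add; [exact: msys_cons2| |exact: scapl].
  by move=> u Bu; split; [apply: BK|apply: saddr].
rewrite e1 e2 e3 e4; ring.
Qed.

Lemma msys_pow1 z n y A B : msys (z :: y) A B -> msys ((z ^+ n)%R :: y) A B.
Proof.
rewrite /msys !isum_cons -!saddA; exact: flen_pow1.
Qed.

Lemma emult_pow1 z n y A B : msys (z :: y) A B -> (0 < n)%N ->
  emult ((z ^+ n)%R :: y) A B = (n%:Z * emult (z :: y) A B)%R.
Proof.
move=> h; elim: n => // -[_ _|n IH _]; first by rewrite expr1 mul1r.
rewrite exprS emult_mul; last by rewrite -exprS; apply: msys_pow1.
by rewrite IH // -[n.+2]addn1 PoszD; ring.
Qed.

Lemma emult_pow (I : Type) (s : seq I) (x : I -> R) (n : I -> nat) A B :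
  msys [seq x i | i <- s] A B -> (forall i, (0 < n i)%N) ->
  emult [seq x i ^+ n i | i <- s]%R A B =
  ((\prod_(i <- s) n i)%N%:Z * emult [seq x i | i <- s] A B)%R.
Proof.
move=> h n0; elim: s A B h => [|i s IH] A B h; first by rewrite big_nil mul1r.
rewrite big_cons map_cons emult_pow1 //; last first.
  move: h; rewrite /msys !isum_cons !(saddC (x i *: A)) -!saddA.
  exact: msys_pow.
rewrite PoszM -mulrA; congr (_ * _)%R; rewrite /= !IH ?mulrBr //.
  exact: msys_cons2 h.
exact: msys_cons1 h.
Qed.

(** With K = (0 : z^k) stable, z is injective on A/K, where e reduces to a shorter sequence on A/(zA
    + K); on K/B z is nilpotent and e vanishes. *)
Lemma emult_ge0 y A B : msys y A B -> (0 <= emult y A B)%R.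
Proof.
elim: y A B => [//|z y IH] A B h; have BA := msys_ge h.
have [k kB] := noeth_scol B z nV; set K := A :&: (B :/ (z ^+ k)%R).
have BK : B <= K by move=> u Bu; split; [apply: BA|apply: smemZ].
have KA : K <= A by apply: scapl.
have hK : msys (z :: y) K B by apply: msys_sub h _ _ _.
rewrite (emult_add h BK KA) addr_ge0 //.
  have -> /= : emult (z :: y) A K = emult y A (z *: A + K).
    rewrite /= (_ : A :&: (K :/ z) = K) ?emult_refl ?subr0 //.
    apply: sle_anti => [u [Au [_ Bu]]|u Ku]; last by split; [apply: KA|apply: smemZ].
    split=> //; have /(congr1 (fun S => smem S u)) /= <- := kB k.+1 (leqnSn k).
    by rewrite exprSr -scalerA.
  by apply/IH/msys_cons1; apply: msys_sub h _ _ _.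
rewrite le_eqVlt; apply/orP; left; apply/eqP.
have msK : msys y K B.
  apply: (@msys_cons_nil (z ^+ k)%R); first by move=> _ [u [_ Bu] ->].
  exact: msys_pow1.
have BKz : B <= K :&: (B :/ z) by move=> u Bu; split; [apply: BK|apply: smemZ].
have zKK : z *: K + B <= K by apply: sadd_le => //; apply: scal_sub.
(* Modulo B, both e(y; K/zK) and e(y; (0 : z)) equal e(y; K) - e(y; zK), since z maps K/(0 : z)
   isomorphically onto zK. *)
have := emult_add msK (@saddr _ _ (z *: K) B) zKK.
have := emult_add msK BKz (@scapl _ _ K (B :/ z)).
by rewrite emult_scal /=; lia.
Qed.

End Fixed.
End Mult.

Arguments emult {R V} y (A B)%_S.

(** * Koszul homology *)

Section KoszulLength.
Variables (R : comNzRingType) (V : lmodType R) (y : seq R).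
Implicit Types (n e p : nat) (A B : smod V).

Local Notation X n := {ffun {set 'I_n} -> V}.

Definition kd n (c : X n) : X n :=
  [ffun S : {set 'I_n} => \sum_(j | j \notin S)
     ((-1) ^+ #|[set k in S | (k < j)%N]| * y`_j)%R *: c (j |: S)]%R.

Definition wl n : 'I_n -> 'I_n.+1 := widen_ord (leqnSn n).

(* A chain of n.+1 elements is a pair (r0, r1) of chains of the first n elements,
   r1 being the coefficient of the last basis vector. *)
Definition r0 n (c : X n.+1) : X n := [ffun S : {set 'I_n} => c ((@wl n) @: S)].
Definition r1 n (c : X n.+1) : X n := [ffun S : {set 'I_n} => c (ord_max |: (@wl n) @: S)].
Definition jn n (a b : X n) : X n.+1 :=
  [ffun S : {set 'I_n.+1} => if ord_max \in S then b ((@wl n) @^-1: S)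
                             else a ((@wl n) @^-1: S)].
(** The last index exceeds every element of S, so omitting it costs the sign (-1)^|S|, which is
    recorded here. *)
Definition sg n (c : X n) : X n := [ffun S : {set 'I_n} => ((-1) ^+ #|S| *: c S)%R].

Lemma wl_inj n : injective (@wl n).
Proof. by move=> i j /(congr1 val) /= /val_inj. Qed.

Lemma wl_max n (S : {set 'I_n}) : ord_max \in (@wl n) @: S = false.
Proof.
apply/negbTE/imsetP => -[j _ /(congr1 val) /= ej].
by have := ltn_ord j; rewrite -ej ltnn.
Qed.

Lemma wlK n (S : {set 'I_n}) : (@wl n) @^-1: ((@wl n) @: S) = S.
Proof. by apply/setP => j; rewrite inE mem_imset //; apply: wl_inj. Qed.

Lemma ord_maxP n (j : 'I_n.+1) : j != ord_max -> exists i, j = wl i.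
Proof.
move=> jm; have jn : (j < n)%N.
  by rewrite ltn_neqAle -ltnS ltn_ord andbT; apply: contra jm => /eqP e; apply/eqP/val_inj.
by exists (Ordinal jn); apply: val_inj.
Qed.

Lemma set_ordS n (S : {set 'I_n.+1}) :
  S = if ord_max \in S then ord_max |: (@wl n) @: ((@wl n) @^-1: S)
      else (@wl n) @: ((@wl n) @^-1: S).
Proof.
apply/setP => j; have [->|/ord_maxP[i ->]] := eqVneq j ord_max.
  by case: ifP => Sm; rewrite ?in_setU1 ?eqxx ?wl_max //.
have Hi : (wl i \in (@wl n) @: ((@wl n) @^-1: S)) = (wl i \in S).
  by rewrite mem_imset ?inE //; apply: wl_inj.
case: ifP => _; rewrite ?in_setU1 Hi //.
suff -> : (wl i == ord_max) = false by [].
by apply/negbTE/eqP => /(congr1 val) /= ei; have := ltn_ord i; rewrite ei ltnn.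
Qed.

Lemma r0_jn n (a b : X n) : r0 (jn a b) = a.
Proof. by apply/ffunP => S; rewrite !ffunE wl_max wlK. Qed.

Lemma r1_jn n (a b : X n) : r1 (jn a b) = b.
Proof.
apply/ffunP => S; rewrite !ffunE in_setU1 eqxx /=; congr (b _).
apply/setP => j; rewrite !inE mem_imset; last exact: wl_inj.
suff -> : (wl j == ord_max) = false by [].
by apply/negbTE/eqP => /(congr1 val) /= ei; have := ltn_ord j; rewrite ei ltnn.
Qed.

Lemma r01_inj n (c c' : X n.+1) : r0 c = r0 c' -> r1 c = r1 c' -> c = c'.
Proof.
move=> /ffunP e0 /ffunP e1; apply/ffunP => S.
have := e1 ((@wl n) @^-1: S); have := e0 ((@wl n) @^-1: S).
by rewrite !ffunE [in c S](set_ordS S) [in c' S](set_ordS S); case: ifP.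
Qed.

Lemma kd_linear n : linear (@kd n).
Proof.
move=> a u v; apply/ffunP => B; rewrite !ffunE scaler_sumr -big_split.
by apply: eq_bigr => j _; rewrite !ffunE scalerDr !scalerA [(a * _)%R]mulrC.
Qed.

HB.instance Definition _ n := GRing.isLinear.Build R (X n) (X n) _ (@kd n) (@kd_linear n).

Lemma r0_linear n : linear (@r0 n).
Proof. by move=> a u v; apply/ffunP => B; rewrite !ffunE. Qed.
HB.instance Definition _ n := GRing.isLinear.Build R (X n.+1) (X n) _ (@r0 n) (@r0_linear n).

Lemma r1_linear n : linear (@r1 n).
Proof. by move=> a u v; apply/ffunP => B; rewrite !ffunE. Qed.
HB.instance Definition _ n := GRing.isLinear.Build R (X n.+1) (X n) _ (@r1 n) (@r1_linear n).

Lemma sg_linear n : linear (@sg n).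
Proof.
by move=> a u v; apply/ffunP => B; rewrite !ffunE scalerDr !scalerA [(a * _)%R]mulrC.
Qed.
HB.instance Definition _ n := GRing.isLinear.Build R (X n) (X n) _ (@sg n) (@sg_linear n).

Lemma sgK n : involutive (@sg n).
Proof. by move=> c; apply/ffunP => S; rewrite !ffunE scalerA -expr2 sqrr_sign scale1r. Qed.

Lemma r0B n (c c' : X n.+1) : r0 (c - c') = (r0 c - r0 c')%R.
Proof. exact: linearB. Qed.

Lemma r1B n (c c' : X n.+1) : r1 (c - c') = (r1 c - r1 c')%R.
Proof. exact: linearB. Qed.

Lemma sgN n (c : X n) : sg (- c) = (- sg c)%R.
Proof. exact: linearN. Qed.

Lemma sgB n (c c' : X n) : sg (c - c') = (sg c - sg c')%R.
Proof. exact: linearB. Qed.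

Lemma kdB n (c c' : X n) : kd (c - c') = (kd c - kd c')%R.
Proof. exact: linearB. Qed.

Lemma kd_sg n (c : X n) : kd (sg c) = (- sg (kd c))%R.
Proof.
apply/ffunP => S; rewrite !ffunE scaler_sumr -sumrN; apply: eq_bigr => j jS.
by rewrite ffunE !scalerA cardsU1 jS /= add1n exprS mulN1r mulrN scaleNr [in RHS]mulrC.
Qed.

(** Together with [r1_kd] this exhibits the Koszul complex on n + 1 elements as the mapping cone of
    multiplication by the last one, up to the sign [sg]. *)
Lemma r0_kd n (c : X n.+1) : r0 (kd c) = (kd (r0 c) + y`_n *: sg (r1 c))%R.
Proof.
apply/ffunP => S; rewrite !ffunE big_mkcond big_ord_recr /= wl_max /=.
congr (_ + _)%R.
  rewrite [RHS]big_mkcond; apply: eq_bigr => j _.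
  rewrite -/(wl j) mem_imset; last exact: wl_inj.
  case: ifP => // jS; rewrite ffunE imsetU1; congr (((-1) ^+ _ * _) *: _)%R.
  rewrite -(card_imset _ (@wl_inj n)); apply: eq_card => k; apply/idP/idP.
    rewrite inE => /andP[/imsetP[i iS ->] ij]; apply/imsetP.
    by exists i => //; rewrite inE iS.
  move=> /imsetP[i]; rewrite !inE => /andP[iS ij] ->.
  by rewrite mem_imset ?iS //; apply: wl_inj.
rewrite scalerA; congr (_ *: _)%R; rewrite mulrC; congr (_ * (-1) ^+ _)%R.
rewrite -(card_imset _ (@wl_inj n)); apply: eq_card => k; rewrite inE.
apply/andb_idr => /imsetP[i _ ->] /=; exact: ltn_ord.
Qed.

Lemma r1_kd n (c : X n.+1) : r1 (kd c) = kd (r1 c).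
Proof.
apply/ffunP => S; rewrite !ffunE big_mkcond big_ord_recr /= in_setU1 eqxx /= addr0.
rewrite [RHS]big_mkcond; apply: eq_bigr => j _.
have jm : (wl j == ord_max) = false.
  by apply/negbTE/eqP => /(congr1 val) /= ei; have := ltn_ord j; rewrite ei ltnn.
rewrite -/(wl j) in_setU1 jm /= mem_imset; last exact: wl_inj.
case: ifP => // jS; rewrite ffunE imsetU1 setUCA; congr (((-1) ^+ _ * _) *: _)%R.
rewrite -(card_imset _ (@wl_inj n)); apply: eq_card => k; apply/idP/idP.
  rewrite !inE => /andP[/orP[/eqP->/=|/imsetP[i iS ->] ij]]; first by rewrite ltnNge ltnW.
  by apply/imsetP; exists i => //; rewrite inE iS.
move=> /imsetP[i]; rewrite !inE => /andP[iS ij] ->.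
by rewrite mem_imset ?iS ?orbT //; apply: wl_inj.
Qed.

(** Induction along the mapping cone: the cross terms cancel because [sg] anticommutes with [kd]. *)
Lemma kdK n (c : X n) : kd (kd c) = 0%R.
Proof.
elim: n c => [|n IH] c; first by apply/ffunP => S; rewrite !ffunE big1 // => -[].
apply: r01_inj; last by rewrite !r1_kd IH linear0.
rewrite !r0_kd r1_kd linearD /= IH add0r linearZ /= kd_sg scalerN addNr.
by rewrite linear0.
Qed.

Definition vl n B : smod (X n).
Proof.
exists (fun c : X n => forall S, B (c S)) => [S|a u v Bu Bv S].
  by rewrite ffunE; apply: smem0.
by rewrite !ffunE; apply: smemL.
Defined.

Definition dg n e p : smod (X n).
Proof.
exists (fun c : X n => forall S : {set 'I_n}, (#|S| + e != p)%N -> c S = 0%R)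
  => [S _|a u v Bu Bv S Sp].
  by rewrite ffunE.
by rewrite !ffunE Bu // Bv // scaler0 addr0.
Defined.

(* Chains of degree p - e; the shift e replaces truncated subtractions. *)
Definition kc n e p A : smod (X n) := dg n e p :&: vl n A.

(** [kZ] / [kB] is H_(p - e) of the first n elements of y on A/B, realized as a subquotient of the
    chains with values in V. *)
Definition kZ n e p A B : smod (X n) := kc n e p A :&: spre (@kd_linear n) (vl n B).
Definition kB n e p A B : smod (X n) :=
  simg (@kd_linear n) (kc n e p B) (kc n e p.+1 A).

Lemma kZP n e p A B c : kZ n e p A B c <-> kc n e p A c /\ vl n B (kd c).
Proof. by []. Qed.

Lemma kc_kd n e p A c : kc n e p A c -> kc n e.+1 p A (kd c).
Proof.
move=> [dc Ac]; split=> [S Sp|S]; rewrite ffunE.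
  apply: big1 => j jS; rewrite dc ?scaler0 //.
  by rewrite cardsU1 jS add1n addSnnS.
elim/big_rec: _ => [|j u _ Au]; first exact: smem0.
by apply: smemD => //; apply: smemZ; apply: Ac.
Qed.

Lemma vl_kd n B c : vl n B c -> vl n B (kd c).
Proof.
move=> Bc S; rewrite ffunE; elim/big_rec: _ => [|j u _ Au]; first exact: smem0.
by apply: smemD => //; apply: smemZ; apply: Bc.
Qed.

Lemma vl_sg n B c : vl n B (sg c) <-> vl n B c.
Proof.
suff imp c' : vl n B c' -> vl n B (sg c') by split=> [/imp|/imp//]; rewrite sgK.
by move=> Bc S; rewrite ffunE; apply: smemZ.
Qed.

Lemma dg_sg n e p c : dg n e p (sg c) <-> dg n e p c.
Proof.
suff imp c' : dg n e p c' -> dg n e p (sg c') by split=> [/imp|/imp//]; rewrite sgK.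
by move=> Bc S Sp; rewrite ffunE Bc ?scaler0.
Qed.

Lemma kc_sg n e p A c : kc n e p A (sg c) <-> kc n e p A c.
Proof. by split=> -[/dg_sg ? /vl_sg ?]; split. Qed.

Lemma dgS n e p : dg n e.+1 p.+1 = dg n e p.
Proof. by apply: smod_ext => c /=; split=> h S; have := h S; rewrite addnS eqSS. Qed.

Lemma kcS n e p A : kc n e.+1 p.+1 A = kc n e p A.
Proof. by rewrite /kc dgS. Qed.

Lemma kZS n e p A B : kZ n e.+1 p.+1 A B = kZ n e p A B.
Proof. by rewrite /kZ kcS. Qed.

Lemma kBS n e p A B : kB n e.+1 p.+1 A B = kB n e p A B.
Proof. by rewrite /kB !kcS. Qed.

Lemma vlS n A B : A <= B -> vl n A <= vl n B.
Proof. by move=> AB c Ac S; apply: AB. Qed.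

Lemma kcSS n e p A B : A <= B -> kc n e p A <= kc n e p B.
Proof. by move=> AB c [dc Ac]; split=> //; apply: vlS Ac. Qed.

Lemma kB_le n e p A B : B <= A -> kB n e p A B <= kZ n e p A B.
Proof.
move=> BA c [b Ab Bc]; have kb : kc n e p A (kd b) by have := kc_kd Ab; rewrite kcS.
split; first by apply: (smemBr kb); apply: kcSS Bc.
by rewrite /= -[kd c]subr0 -(kdK b) -linearB; apply: vl_kd; case: Bc.
Qed.

Lemma jnE n e p A a b :
  kc n.+1 e p A (jn a b) <-> kc n e p A a /\ kc n e.+1 p A b.
Proof.
have card1 (S : {set 'I_n.+1}) :
    #|S| = (#|(@wl n) @^-1: S| + (ord_max \in S))%N.
  rewrite {1}(set_ordS S); case: ifP => Sm; last by rewrite card_imset ?addn0 //; apply: wl_inj.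
  by rewrite cardsU1 wl_max /= card_imset ?addn1 //; apply: wl_inj.
split=> [[dj Aj]|[[da Aa] [db Ab]]].
  split; split=> S.
  - move=> Sp; have := dj ((@wl n) @: S); rewrite ffunE wl_max wlK; apply.
    by rewrite card_imset //; apply: wl_inj.
  - by have := Aj ((@wl n) @: S); rewrite ffunE wl_max wlK.
  - move=> Sp; have <- := r1_jn a b; rewrite ffunE; apply: dj.
    by rewrite cardsU1 wl_max /= card_imset ?add1n ?addSnnS //; apply: wl_inj.
  by have <- := r1_jn a b; rewrite ffunE; apply: Aj.
split=> S; last by rewrite ffunE; case: ifP.
rewrite card1 ffunE; case: ifP => Sm Sp; last by apply: da; rewrite addn0 in Sp.
by apply: db; rewrite addn1 addSnnS in Sp.
Qed.

Lemma jn_r n (c : X n.+1) : jn (r0 c) (r1 c) = c.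
Proof. by apply: r01_inj; rewrite ?r0_jn ?r1_jn. Qed.

Lemma kcE n e p A c :
  kc n.+1 e p A c <-> kc n e p A (r0 c) /\ kc n e.+1 p A (r1 c).
Proof. by rewrite -jnE jn_r. Qed.

Lemma vlE n B c : vl n.+1 B c <-> vl n B (r0 c) /\ vl n B (r1 c).
Proof.
split=> [Bc|[B0 B1] S]; first by split=> S; rewrite ffunE.
by rewrite -(jn_r c) ffunE; case: ifP.
Qed.

End KoszulLength.

(** * The long exact sequence of Koszul homology *)

Section KoszulSequence.
Variables (R : comNzRingType) (V : lmodType R) (y : seq R).
Implicit Types (n e p : nat).
Local Notation X n := {ffun {set 'I_n} -> V}.
Local Notation kd := (@kd R V y _).

(** Division by z modulo B, coefficient by coefficient; choosing 0 outside the right degree keeps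
    the result homogeneous. *)
Lemma pick_vl n e p (A B : smod V) z c : B <= A ->
  kc n e p (z *: A + B) c -> exists2 a : X n, kc n e p A a & kc n e p B (c - z *: a)%R.
Proof.
move=> BA [dc Qc].
have /choice[g gP] : forall S : {set 'I_n}, exists u, [/\ A u, B (c S - z *: u)%R
    & ((#|S| + e != p)%N -> u = 0%R)].
  move=> S; have /scal_addP[u Au Bu] := Qc S.
  have [Sp|Sp] := eqVneq (#|S| + e)%N p; first by exists u; split.
  exists 0%R; rewrite dc // scaler0 subr0; split=> //; apply: smem0.
exists [ffun S => g S]; split=> S; rewrite ?ffunE.
- by have [_ _ h] := gP S => /h.
- by have [] := gP S.
- move=> Sp; have [_ _ /(_ Sp) ->] := gP S.
  by rewrite dc // scaler0 subr0.
by have [] := gP S.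
Qed.

Definition kfl n e (A B : smod V) := forall p, flen (kZ y n e p A B) (kB y n e p A B).
Definition hl n e p (A B : smod V) := len (kZ y n e p A B) (kB y n e p A B).

Lemma kZ_big e p n (A B : smod V) : (n + e < p)%N -> kZ y n e p A B = sbot.
Proof.
move=> np; apply: sle_anti; last exact: sle_bot.
move=> c [[dc _] _]; apply/ffunP => S; rewrite ffunE; apply: dc.
have := max_card (mem S); rewrite card_ord => Sn; apply/eqP => eSp.
by move: np; rewrite -eSp ltn_add2r ltnNge Sn.
Qed.

Lemma kZ_small e p n (A B : smod V) : (p < e)%N -> kZ y n e p A B = sbot.
Proof.
move=> pe; apply: sle_anti; last exact: sle_bot.
move=> c [[dc _] _]; apply/ffunP => S; rewrite ffunE; apply: dc.
by apply/eqP => eSp; move: pe; rewrite -eSp ltnNge leq_addl.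
Qed.

Lemma len_bot (V' : lmodType R) (C : smod V') : C <= sbot ->
  flen sbot C /\ len sbot C = 0%N.
Proof.
move=> C0; rewrite (_ : C = sbot); first by rewrite len_refl; split=> //; apply: flen_refl.
by apply: sle_anti => //; apply: sle_bot.
Qed.

Variables (n : nat) (A B : smod V).
Hypothesis BA : B <= A.
Local Notation z := (y`_n).
Local Notation K := (A :&: (B :/ z)).
Local Notation Q := (z *: A + B).

Let QA : Q <= A.
Proof. by apply: sadd_le => //; apply: scal_sub. Qed.

Let BK : B <= K.
Proof. by move=> u Bu; split; [apply: BA|apply: smemZ]. Qed.

Local Notation QB e p := (kB y n e p A Q).
Local Notation KB e p := (kB y n e p K B).

Lemma jn0_linear : linear (fun k : X n => jn 0%R k).
Proof.
move=> a u v; apply/ffunP => S; rewrite !ffunE; case: ifP => // _.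
by rewrite scaler0 addr0.
Qed.

Lemma kdr1_linear : linear (fun c : X n.+1 => kd (r1 c)).
Proof. by move=> a u v; rewrite !linearP. Qed.

(* The long exact sequence
     H_(p+1)(Q) -> H_(p-1)(K) -> H_p -> H_p(Q) -> H_(p-2)(K)
   with K = (0 : z)_(A/B) and Q = A / (zA + B): H_p -> H_p(Q) takes c to [r0 c] and
   has image [kJ]; H_(p-1)(K) -> H_p takes k to [jn 0 k] and has kernel [kI]; the
   connecting map is the relation [r0 c] ~ [kd (r1 c)] for c in [kP]. *)
Definition kJ e p : smod (X n) :=
  simg (@r0_linear R V n) sbot (kZ y n.+1 e p A B).

Definition kI e p : smod (X n) :=
  kZ y n e.+1 p K B :&: spre jn0_linear (kB y n.+1 e p A B).

(** Kernel of H_p -> H_p(Q), by exactness the image of H_(p-1)(K). *)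
Definition kG e p : smod (X n.+1) :=
  kZ y n.+1 e p A B :&: spre (@r0_linear R V n) (QB e p).

Definition kP e p : smod (X n.+1) :=
  kc n.+1 e p A :&: spre (fun a u v => linearP (@r0 R V n \o kd) a u v) (vl n B).

Lemma kZE e p c : kZ y n.+1 e p A B c <->
  [/\ kc n e p A (r0 c), kc n e.+1 p A (r1 c),
      vl n B (kd (r0 c) + z *: sg (r1 c))%R & vl n B (kd (r1 c))].
Proof.
split=> [[/kcE[c0 c1] /vlE[]]|[c0 c1 d0 d1]].
  by rewrite r0_kd r1_kd.
by split; [apply/kcE|apply/vlE; rewrite r0_kd r1_kd].
Qed.

Lemma kBE e p c : kB y n.+1 e p A B c <-> exists a b : X n,
  [/\ kc n e p.+1 A a, kc n e.+1 p.+1 A b,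
      kc n e p B (r0 c - (kd a + z *: sg b))%R & kc n e.+1 p B (r1 c - kd b)%R].
Proof.
split=> [[d /kcE[d0 d1] /kcE[]]|[a [b [Aa Ab Bc0 Bc1]]]].
  rewrite !linearB /= r0_kd r1_kd => Bc0 Bc1.
  by exists (r0 d), (r1 d); split.
exists (jn a b); first by apply/jnE.
by apply/kcE; rewrite !linearB /= r0_kd r1_kd r0_jn r1_jn.
Qed.

Lemma kPE e p c : kP e p c <->
  [/\ kc n e p A (r0 c), kc n e.+1 p A (r1 c) &
      vl n B (kd (r0 c) + z *: sg (r1 c))%R].
Proof.
split=> [[/kcE[c0 c1]]|[c0 c1 d0]].
  by rewrite /= r0_kd.
by split; [apply/kcE|rewrite /= r0_kd].
Qed.

Lemma kJE e p a : kJ e p a <-> exists2 b : X n, kZ y n.+1 e p A B (jn a b) & True.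
Proof.
split=> [[c Zc /eqP]|[b Zab _]].
  by rewrite subr_eq0 => /eqP ->; exists (r1 c) => //; rewrite jn_r.
by exists (jn a b) => //; rewrite r0_jn /= subrr.
Qed.

(** The part in zA of a boundary modulo Q is produced by a suitable last component of the chain. *)
Lemma QB_lift e p a : QB e p a -> exists2 c, kB y n.+1 e p A B c & a = r0 c.
Proof.
move=> [b Ab /(pick_vl BA)[al Aal Bbe]].
exists (jn a (kd (sg al))); last by rewrite r0_jn.
apply/kBE; exists b, (sg al); rewrite r0_jn r1_jn subrr sgK; split=> //.
- by rewrite kcS; apply/kc_sg.
- by rewrite opprD addrA.
exact: smem0.
Qed.

Lemma kB_r0 e p c : kB y n.+1 e p A B c -> QB e p (r0 c).
Proof.
move=> /kBE[a [b [Aa Ab Bc0 Bc1]]]; exists a => //.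
have -> : (r0 c - kd a = (r0 c - (kd a + z *: sg b)) + z *: sg b)%R.
  by rewrite opprD addrA subrK.
apply: smemD; first by apply: kcSS Bc0; apply: saddr.
move/kc_sg: Ab; rewrite kcS => -[db Ab]; split; first exact: smemZ.
by move=> S; apply: saddl; rewrite ffunE; exists (sg b S).
Qed.

Lemma QB_J e p : QB e p <= kJ e p.
Proof.
move=> a /QB_lift[c Bc ->]; exists c; last by rewrite /= subrr.
exact: kB_le Bc.
Qed.

Lemma J_QZ e p : kJ e p <= kZ y n e p A Q.
Proof.
move=> a [c /kZE[c0 c1 d0 d1] /eqP]; rewrite subr_eq0 => /eqP ->; apply/kZP; split=> // S.
have [_ /vl_sg Ac1] := c1; rewrite -[kd (r0 c) S](addrK ((z *: sg (r1 c)) S)%R).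
apply: smemB; first by apply: saddr; have := d0 S; rewrite ffunE.
by apply: saddl; rewrite ffunE; exists (sg (r1 c) S); first exact: Ac1.
Qed.

Lemma vlK k : vl n A k -> vl n B (z *: sg k)%R -> vl n K k.
Proof.
move=> Ak Bk S; split; first exact: Ak.
have := Bk S; rewrite 2!ffunE scalerA mulrC -scalerA /=.
by move/(smemZ ((-1) ^+ #|S|)%R); rewrite scalerA -expr2 sqrr_sign scale1r.
Qed.

Lemma kI_ge e p : KB e.+1 p <= kI e p.
Proof.
move=> c Kc; split; first exact: kB_le Kc.
have [b Kb Bc] := Kc; apply/kBE; exists 0%R, b; rewrite r0_jn r1_jn linear0 !add0r.
split=> //; first exact: smem0.
  by apply: kcSS Kb; apply: scapl.
apply: smemN; move/kc_sg: Kb; rewrite kcS => -[db Kb].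
split; first exact: smemZ.
by move=> S; have [_ h] := Kb S; rewrite ffunE; exact: h.
Qed.

Lemma siso_r0 e p : siso (@r0 R V n) (kZ y n.+1 e p A B) (kG e p) (kJ e p) (QB e p).
Proof.
split; [exact: scapl|exact: QB_J| | |].
- by move=> c Zc; exists c => //; rewrite /= subrr.
- move=> a [c Zc /eqP]; rewrite subr_eq0 => /eqP ->; exists c => //.
  by rewrite subrr; apply: smem0.
by move=> c Zc; split=> [|[]].
Qed.

(** Exactness at H_p: a class that dies in H_p(Q) comes from H_(p-1)(K). *)
Lemma siso_jn0 e p :
  siso (fun k : X n => jn 0%R k) (kZ y n e.+1 p K B) (kI e p) (kG e p) (kB y n.+1 e p A B).
Proof.
split; first exact: scapl.
- move=> c Bc; split; first exact: kB_le Bc.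
  exact: kB_r0.
- move=> k [Kk Bdk]; split; last by change (QB e p (r0 (jn 0%R k))); rewrite r0_jn; apply: smem0.
  apply/kZE; rewrite r0_jn r1_jn linear0 add0r; split=> //; first exact: smem0.
    by apply: kcSS Kk; apply: scapl.
  move=> S; rewrite 2!ffunE scalerA mulrC -scalerA; apply: smemZ.
  by have [_ /(_ S)[]] := Kk.
- move=> c [/kZE[c0 c1 d0 d1] [a Aa /(pick_vl BA)[al Aal Bbe]]].
  (* Subtracting the boundary of (a, sg al) from c leaves a first component [be] with values in B
     and the last component k; since c is a cycle, zk has values in B, so k has values in K. *)
  set k := (r1 c - kd (sg al))%R; set be := (r0 c - kd a - z *: al)%R in Bbe.
  have Ak : kc n e.+1 p A k.
    by apply: smemB => //; apply: kc_kd; apply/kc_sg.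
  have zk : vl n B (z *: sg k)%R.
    have -> : (z *: sg k = (kd (r0 c) + z *: sg (r1 c)) - kd be)%R.
      rewrite /k /be !linearB /= !kdK kd_sg [sg (- _)%R]linearN /=.
      rewrite sgK scalerN !opprK addr0.
      by rewrite [kd (z *: al)%R]linearZ /= ?scalerN ?opprK addrA
        [(_ + _ - kd _)%R]addrAC subrr add0r.
    by apply: smemB => //; apply: vl_kd; case: Bbe.
  exists k; first split.
  - split; first by case: Ak.
    by apply: vlK => //; case: Ak.
  - by rewrite /= linearB /= kdK subr0.
  apply/kBE; exists a, (sg al); rewrite r0B r1B r0_jn r1_jn subr0 sgK; split=> //.
  - by rewrite kcS; apply/kc_sg.
  - by rewrite opprD addrA.
  by rewrite /k opprB addrCA subrr addr0 subrr; apply: smem0.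
by move=> k Kk; split=> [|[]].
Qed.

(** With [siso_P1] this is the connecting isomorphism: the cokernel of H_p -> H_p(Q) and the kernel
    of H_(p-2)(K) -> H_(p-1) are quotients of [kP] by the same submodule. *)
Lemma siso_P0 e p : siso (@r0 R V n) (kP e p) (kP e p :&: spre (@r0_linear R V n) (kJ e p))
  (kZ y n e p A Q) (kJ e p).
Proof.
split; [exact: scapl|exact: J_QZ| | |].
- move=> c /kPE[c0 c1 d0]; apply/kZP; split=> // S; have [_ /vl_sg Ac1] := c1.
  rewrite -[kd (r0 c) S](addrK ((z *: sg (r1 c)) S)%R).
  apply: smemB; first by apply: saddr; have := d0 S; rewrite ffunE.
  by apply: saddl; rewrite ffunE; exists (sg (r1 c) S); first exact: Ac1.
- move=> a [Aa Qa]; have [|b Ab Bb] := @pick_vl n e.+1 p A B z (kd a) BA.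
    by split=> //; case: (kc_kd y Aa).
  exists (jn a (- sg b)%R); last by rewrite r0_jn subrr; apply: smem0.
  apply/kPE; rewrite r0_jn r1_jn sgN sgK scalerN; split=> //.
    by apply: smemN; apply/kc_sg.
  by case: Bb.
by move=> c Pc; split=> [|[]].
Qed.

Lemma siso_P1 e p : siso (fun c : X n.+1 => kd (r1 c)) (kP e p.+1)
  (kP e p.+1 :&: spre (@r0_linear R V n) (kJ e p.+1)) (kI e p) (KB e.+1 p).
Proof.
split; [exact: scapl|exact: kI_ge| | |].
- move=> c /kPE[c0 c1 d0]; split; first split; first split.
  + by have := kc_kd y c1; rewrite kcS => -[].
  + apply: vlK; first by have := kc_kd y c1; rewrite kcS => -[].
    have : vl n B (z *: sg (kd (r1 c)))%R.
      have -> : (z *: sg (kd (r1 c)) = - kd (kd (r0 c) + z *: sg (r1 c)))%R.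
        by rewrite linearD /= kdK add0r linearZ /= kd_sg scalerN opprK.
      by apply: smemN; apply: vl_kd.
    exact.
  + by change (vl n B (kd (kd (r1 c)))); rewrite kdK; apply: smem0.
  apply/kBE; exists (r0 c), (r1 c); rewrite r0_jn r1_jn subrr sub0r; split=> //.
    apply: smemN; split=> //; have := kc_kd y c0; rewrite kcS => -[dc0 _].
    apply: smemD => //; apply: smemZ.
    by move/kc_sg: c1; rewrite kcS; case.
  exact: smem0.
- move=> k [Kk /kBE[a [b []]]]; rewrite r0_jn r1_jn sub0r => Aa Ab Bab Bk.
  exists (jn a b); last first.
    rewrite r1_jn; exists 0%R; first exact: smem0.
    by rewrite linear0 subr0.
  apply/kPE; rewrite r0_jn r1_jn; split=> //.
  by rewrite -[(_ + _)%R]opprK; apply: smemN; case: Bab.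
move=> c Pc; have /kPE[c0 c1 d0] := Pc; split.
  move=> [ka Kka Bka]; split=> //; apply/kJE; exists (r1 c - ka)%R => //.
  apply/kZE; rewrite r0_jn r1_jn; split=> //.
  - by apply: smemB => //; apply: kcSS Kka; apply: scapl.
  - rewrite sgB scalerBr addrA; apply: smemB => //.
    move=> S; rewrite 2!ffunE scalerA mulrC -scalerA; apply: smemZ.
    by have [_ /(_ S)[]] := Kka.
  by rewrite kdB; case: Bka.
move=> [_ /kJE[b /kZE[]]]; rewrite r0_jn r1_jn => _ Ab d0' Bb _.
have Aka : kc n e.+1 p.+1 A (r1 c - b)%R by apply: smemB.
exists (r1 c - b)%R.
  split; first by case: Aka.
  apply: vlK; first by case: Aka.
  have -> : (z *: sg (r1 c - b) =
      (kd (r0 c) + z *: sg (r1 c)) - (kd (r0 c) + z *: sg b))%R.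
    by rewrite sgB scalerBr opprD addrACA subrr add0r.
  exact: smemB.
rewrite kdB subKr; split=> //.
by have := kc_kd y Ab; rewrite kcS => -[].
Qed.

(** Length of the image of the connecting map out of H_(p - e)(Q). *)
Definition kw e p := len (kZ y n e p A Q) (kJ e p).

Lemma koszul_les e p : kfl n e A Q -> kfl n e.+1 K B ->
  flen (kZ y n.+1 e p A B) (kB y n.+1 e p A B) /\
  (hl n.+1 e p A B + kw e p + kw e p.+1 = hl n e p A Q + hl n e.+1 p K B)%N.
Proof.
move=> flQ flK.
have BG : kB y n.+1 e p A B <= kG e p by have [_ h _ _ _] := siso_jn0 e p.
have GZ : kG e p <= kZ y n.+1 e p A B by apply: scapl.
have IZ : kI e p <= kZ y n e.+1 p K B by apply: scapl.
have fJ : flen (kJ e p) (QB e p) := flen_down (flQ p) (@QB_J e p) (@J_QZ e p).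
have fZI : flen (kZ y n e.+1 p K B) (kI e p) := flen_up (flK p) (@kI_ge e p) IZ.
have [fZG eZG] : flen (kZ y n.+1 e p A B) (kG e p) /\
    len (kZ y n.+1 e p A B) (kG e p) = len (kJ e p) (QB e p).
  have [h1 h2 h3 h4 h5] := siso_r0 e p.
  split; first exact/(flen_map (@r0_linear _ _ _) h1 h2 h3 h4 h5).
  exact: (len_map (@r0_linear _ _ _) h1 h2 h3 h4 h5).
have [fGB eGB] : flen (kG e p) (kB y n.+1 e p A B) /\
    len (kG e p) (kB y n.+1 e p A B) = len (kZ y n e.+1 p K B) (kI e p).
  have [h1 h2 h3 h4 h5] := siso_jn0 e p.
  split; first exact/(flen_map jn0_linear h1 h2 h3 h4 h5).
  exact/esym/(len_map jn0_linear h1 h2 h3 h4 h5).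
have eI : len (kI e p) (KB e.+1 p) = kw e p.+1.
  have [h1 h2 h3 h4 h5] := siso_P1 e p; have [k1 k2 k3 k4 k5] := siso_P0 e p.+1.
  rewrite -(len_map kdr1_linear h1 h2 h3 h4 h5).
  exact: (len_map (@r0_linear _ _ _) k1 k2 k3 k4 k5).
split; first exact: flen_cat fGB.
rewrite /hl (len_cat fZG fGB) (len_split (flQ p) (@QB_J e p) (@J_QZ e p)).
rewrite (len_split (flK p) (@kI_ge e p) IZ) eZG eGB eI /kw; lia.
Qed.

Lemma kw0 : kw 0 0 = 0%N.
Proof.
rewrite /kw (_ : kJ 0 0 = kZ y n 0 0 A Q) ?len_refl //.
apply: sle_anti; first exact: J_QZ.
move=> a [Aa _]; apply/kJE; exists 0%R => //.
apply/kZE; rewrite r0_jn r1_jn !linear0 ?scaler0 ?addr0; split=> //; first exact: smem0.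
  suff -> : kd a = 0%R by apply: smem0.
  apply/ffunP => S; have [+ _] := kc_kd y Aa; move/(_ S); rewrite addn1 => ->//.
  by rewrite ffunE.
exact: smem0.
Qed.

Lemma kw_big e p : (n + e < p)%N -> kw e p = 0%N.
Proof.
move=> np; rewrite /kw; have := @J_QZ e p; rewrite kZ_big //.
by move/len_bot => [].
Qed.

End KoszulSequence.

Section KoszulMult.
Variables (R : comNzRingType) (V : lmodType R) (y : seq R).
Hypothesis nV : noeth V.
Implicit Types (A B : smod V).

Lemma hl0 n A B : B <= A -> kfl y n 0 A B -> kfl y n 1 A B.
Proof.
move=> BA fl [|p]; last by rewrite kZS kBS; apply: fl.
have := @kB_le _ _ y n 1 0 A B BA; rewrite kZ_small // => /len_bot[f _].
exact: f.
Qed.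

(** Each connecting term occurs in two consecutive degrees, so these terms telescope in the Euler
    characteristic. *)
Lemma sum_sign (w : nat -> int) m :
  (\sum_(p < m) (-1) ^+ p * (w p + w p.+1) = w 0%N - (-1) ^+ m * w m)%R.
Proof.
elim: m => [|m IH]; first by rewrite big_ord0 expr0; ring.
by rewrite big_ord_recr /= IH exprS; ring.
Qed.

Lemma koszul0 A B p : B <= A -> flen A B ->
  flen (kZ y 0 0 p A B) (kB y 0 0 p A B) /\
  hl y 0 0 p A B = (if p == 0 then len A B else 0)%N.
Proof.
move=> BA fAB; rewrite /hl; case: p => [|p] /=; last first.
  by have := @kB_le _ _ y 0 0 p.+1 A B BA; rewrite kZ_big // => /len_bot.
pose f (u : V) : {ffun {set 'I_0} -> V} := [ffun=> u].
have S0 (S : {set 'I_0}) : S = set0 by apply/setP => -[].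
have kd0 (c : {ffun {set 'I_0} -> V}) : kd y c = 0%R.
  by apply/ffunP => S; rewrite !ffunE big1 // => -[].
have lf : linear f by move=> a u v; apply/ffunP => S; rewrite !ffunE.
have h2 := @kB_le _ _ y 0 0 0 A B BA.
have h3 u : A u -> kZ y 0 0 0 A B (f u).
  move=> Au; apply/kZP; rewrite kd0; split; last exact: smem0.
  by split=> S; rewrite ffunE // (S0 S) cards0.
have h4 c : kZ y 0 0 0 A B c -> exists2 u, A u & kB y 0 0 0 A B (c - f u)%R.
  move=> [[_ Ac] _]; exists (c set0) => //.
  suff -> : (c - f (c set0) = 0)%R by apply: smem0.
  by apply/ffunP => S; rewrite !ffunE (S0 S) subrr.
have h5 u : A u -> kB y 0 0 0 A B (f u) <-> B u.
  move=> Au; split=> [[b _]|Bu].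
    by rewrite kd0 subr0 => -[_ /(_ set0)]; rewrite ffunE.
  exists 0%R; first exact: smem0.
  rewrite kd0 subr0; split=> S; rewrite ffunE // (S0 S) cards0 //.
by split; [apply/(flen_map lf BA h2 h3 h4 h5)|apply/esym/(len_map lf BA h2 h3 h4 h5)].
Qed.

(** The alternating sum over the long exact sequence reproduces the recursion of [emult], since the
    connecting terms vanish at both ends by [kw0] and [kw_big]. *)
Lemma koszul_length A B n : (n <= size y)%N -> msys (rev (take n y)) A B ->
  kfl y n 0 A B /\
  (\sum_(p < n.+1) (-1) ^+ p * (hl y n 0 p A B)%:Z)%R = emult (rev (take n y)) A B.
Proof.
elim: n A B => [|n IH] A B.
  rewrite take0 /msys isum_nil sadd0 => _ f; have BA := flen_ge f.
  split=> [p|]; first by have [] := koszul0 p BA f.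
  by rewrite big_ord1 expr0 mul1r; have [_ ->] := koszul0 0 BA f.
move=> ny; rewrite (take_nth 0%R) // rev_rcons => h; have BA := msys_ge h.
set z := y`_n; set K := A :&: (B :/ z); set Q := z *: A + B.
have QA : Q <= A by apply: sadd_le => //; apply: scal_sub.
have BK : B <= K by move=> u Bu; split; [apply: BA|apply: smemZ].
have [flQ eQ] := IH A Q (ltnW ny) (msys_cons1 h).
have [flK eK] := IH K B (ltnW ny) (msys_cons2 nV h).
have les p := @koszul_les _ _ y n A B BA 0 p flQ (hl0 BK flK).
split=> [p|]; first by have [] := les p.
rewrite /= -eQ -eK.
have hE p : (hl y n.+1 0 p A B)%:Z = ((hl y n 0 p A Q)%:Z + (hl y n 1 p K B)%:Z
     - (kw y n A B 0 p)%:Z - (kw y n A B 0 p.+1)%:Z)%R.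
  by have [_ e] := les p; rewrite -/z -/K -/Q in e; lia.
under eq_bigr => p _ do rewrite hE -addrA -opprD mulrBr mulrDr.
rewrite sumrB big_split /= (sum_sign (fun p => (kw y n A B 0 p)%:Z)) kw0 //.
rewrite kw_big ?addn0 ?ltnS // mulr0 !subr0.
(* Each sum over p < n + 2 has one term too many, H_(n+1)(Q) or H_(-1)(K), which is zero; the degree
   shift for K produces the minus sign. *)
congr (_ + _)%R; [rewrite big_ord_recr /=|rewrite big_ord_recl /=].
  have := @kB_le _ _ y n 0 n.+1 A Q QA; rewrite /hl kZ_big ?addn0 // => /len_bot[_ ->].
  by rewrite mulr0 addr0.
have -> : hl y n 1 0 K B = 0%N.
  by have := @kB_le _ _ y n 1 0 K B BK; rewrite /hl kZ_small // => /len_bot[_ ->].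
rewrite mulr0 add0r -sumrN; apply: eq_bigr => p _.
by rewrite /hl /bump /= add1n kZS kBS exprS mulN1r mulNr.
Qed.

End KoszulMult.

(** * Modules, quotients and submodules *)

Section FromDefs.
Variables (R : comNzRingType).
Implicit Types (V W : lmodType R).

Definition smod_of V (S : submodClosed V) : smod V.
Proof.
exists (fun u => u \in S); first exact: rpred0.
by move=> a u v Su Sv; rewrite rpredD ?rpredZ.
Defined.

Definition spred V (A : smod V) : {pred V} := fun u => `[< A u >].

Lemma spred_submod V (A : smod V) : submod_closed (spred A).
Proof.
split; first by apply/asboolP; apply: smem0.
by move=> a u v /asboolP Au /asboolP Av; apply/asboolP; apply: smemL.
Qed.

HB.instance Definition _ V (A : smod V) :=
  GRing.isSubmodClosed.Build R V (spred A) (spred_submod A).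

Lemma spredE V (A : smod V) u : u \in (spred A : submodClosed V) <-> A u.
Proof. by split=> /asboolP. Qed.

Lemma ch_chain V (A B : smod V) n : ch A B n -> exists C : nat -> smod V,
  C n = A /\ forall i, (i < n)%N -> C i <= C i.+1 /\ ~ C i.+1 <= C i.
Proof.
elim: n A => [|n IH] A; first by exists (fun=> A).
move=> [D [DA nAD /IH[C [Cn CP]]]].
exists (fun i => if (i <= n)%N then C i else A); split=> [|i]; first by rewrite ltnn.
rewrite ltnS => lin; have [->|ne] := eqVneq i n; first by rewrite leqnn ltnn Cn.
have lt_in : (i < n)%N by rewrite ltn_neqAle ne lin.
by rewrite lin lt_in; apply: CP.
Qed.

Lemma submod_chainE V n : submod_chain V n <-> ch (@stop R V) sbot n.
Proof.
split=> [[C CP]|/ch_chain[C [Cn CP]]].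
  have step i (lin : (i < n.+1)%N) : ch (smod_of (C (Ordinal lin))) sbot i.
    elim: i lin => [|i IH] lin; first exact: sle_bot.
    have lin' := ltnW lin; have [sub nsub] := CP (Ordinal lin') (Ordinal lin) (ltnSn i).
    exists (smod_of (C (Ordinal lin'))); split=> //.
  exact: ch_mono (step n (ltnSn n)).
have Cm i k : (i + k <= n)%N -> C i <= C (i + k)%N.
  elim: k => [|k IH]; first by rewrite addn0 => _ u.
  rewrite addnS => ik; by apply: sle_trans (IH (ltnW ik)) _; have [] := CP _ ik.
exists (fun i : 'I_n.+1 => spred (C i) : submodClosed V) => i j ij.
have jn : (j <= n)%N by rewrite -ltnS.
have Cij : C i <= C j by rewrite -(subnKC (ltnW ij)); apply: Cm; rewrite subnKC // ltnW.
split=> [u /spredE/Cij/spredE //|sub].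
case ej : (nat_of_ord j) => [|k] in ij jn Cij sub *; first by [].
have [_] := CP k jn; apply=> u Cu.
have /spredE : u \in (spred (C i) : submodClosed V).
  by apply: sub; apply/spredE; rewrite ?ej.
by have := Cm i (k - i)%N; rewrite subnKC //; apply; apply: ltnW.
Qed.

Lemma has_lengthE V l : has_length V l <-> has_len (@stop R V) sbot l.
Proof. by split=> h n; rewrite -h submod_chainE. Qed.

Lemma lengthE V : length V = len (@stop R V) sbot.
Proof. by congr nat_such; apply: funext => l; apply: propext; apply: has_lengthE. Qed.

Lemma finite_lengthE V : finite_length V <-> flen (@stop R V) sbot.
Proof. by split=> -[l /has_lengthE]; exists l. Qed.

Section Quot.
Variables (V : lmodType R) (S : submodClosed V).

Definition qpi (u : V) : quotmod S := \pi_(quotmod S) u.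

Lemma qpi_linear : linear qpi.
Proof. by move=> a u v; rewrite /qpi pi_quotmodD -pi_quotmod_scale. Qed.

Lemma qpiZ a u : qpi (a *: u) = (a *: qpi u)%R.
Proof. by rewrite /qpi -pi_quotmod_scale. Qed.

Lemma qpi_eq0 u : qpi u = 0%R <-> u \in S.
Proof.
have -> : (u \in S) = (u - 0 \in submod_pred S)%R by rewrite subr0.
rewrite Quotient.idealrBE; split=> [e|/eqP e]; last by rewrite /qpi e pi_zeror.
by apply/eqP; rewrite pi_zeror.
Qed.

Lemma siso_quot (A : smod V) (D : smod (quotmod S)) : smod_of S <= A ->
  (forall u, A u <-> D (qpi u)) -> siso qpi A (smod_of S) D sbot.
Proof.
move=> SA AD; split=> //; first exact: sle_bot.
- by move=> u /AD.
- move=> w Dw; exists (repr w); last by rewrite /qpi reprK /= subrr.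
  by apply/AD; rewrite /qpi reprK.
by move=> u _; apply: qpi_eq0.
Qed.

Lemma noeth_quot : noeth V -> noeth (quotmod S).
Proof.
move=> nV P [A0 PA0].
have [|_ [D PD ->] maxD] := nV (fun A => exists2 D, P D & A = spre qpi_linear D).
  by exists (spre qpi_linear A0), A0.
exists D => // D' PD' DD' w D'w; rewrite -[w]reprK.
have h : spre qpi_linear D' <= spre qpi_linear D.
  by apply: maxD; [exists D'|move=> u; apply: DD'].
by apply: h; rewrite /= /qpi reprK.
Qed.

Lemma sval_linear : linear (val : submod S -> V).
Proof. by move=> a u v; rewrite !linearP. Qed.

Lemma siso_sub (A A0 : smod (submod S)) (D D0 : smod V) : A0 <= A -> D0 <= D ->
  D <= smod_of S -> (forall u, A u <-> D (val u)) -> (forall u, A0 u <-> D0 (val u)) ->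
  siso val A A0 D D0.
Proof.
move=> AA DD DS AD A0D; split=> //; first by move=> u /AD.
  move=> w Dw; exists (Submod (DS w Dw)); first exact/AD.
  by rewrite subrr; apply: smem0.
by move=> u _; apply: iff_sym.
Qed.

Lemma noeth_sub : noeth V -> noeth (submod S).
Proof.
move=> nV P [A0 PA0].
have [|_ [D PD ->] maxD] := nV (fun A => exists2 D, P D & A = simg sval_linear sbot D).
  by exists (simg sval_linear sbot A0), A0.
exists D => // D' PD' DD' w D'w.
have h : simg sval_linear sbot D' <= simg sval_linear sbot D.
  by apply: maxD; [exists D'|move=> u [v Dv e]; exists v => //; apply: DD'].
have [|u Du /eqP] := h (val w); first by exists w => //=; rewrite subrr.
by rewrite subr_eq0 => /eqP/val_inj ->.
Qed.

End Quot.

Lemma isum_rev V y (A : smod V) : isum (rev y) A = isum y A.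
Proof. by rewrite /isum; apply: perm_big; rewrite perm_rev. Qed.

Lemma smod_of_smul V y : smod_of (smul V y) = isum y stop.
Proof.
apply: sle_anti; last first.
  apply: isum_le => a ya _ [u _ ->]; apply/asboolP.
  have iy : (index a y < size y)%N by rewrite index_mem.
  exists (fun i => if i == Ordinal iy then u else 0%R).
  rewrite (bigD1 (Ordinal iy)) //= eqxx nth_index // big1 ?addr0 // => i /negbTE ->.
  by rewrite scaler0.
move=> _ /asboolP[c ->]; elim/big_ind: _ => [|u v|i _]; [exact: smem0|exact: smemD|].
by apply: (@isum_ge _ _ y stop _ (mem_nth 0%R (ltn_ord i))); exists (c i).
Qed.

Section Koszul.
Variables (N : lmodType R) (y : seq R).

Lemma kdegE p c : c \in @kdeg R N y p <-> kc (size y) 0 p (@stop R N) c.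
Proof.
split=> [/forallP cp|[cp _]].
  by split=> // S Sp; apply/eqP; have /implyP := cp S; apply; rewrite addn0 in Sp.
by apply/forallP => S; apply/implyP => Sp; apply/eqP/cp; rewrite addn0.
Qed.

Lemma kc_bot n e p (c : {ffun {set 'I_n} -> N}) : kc n e p (@sbot R N) c <-> c = 0%R.
Proof.
split=> [[_ c0]|->]; last exact: smem0.
by apply/ffunP => S; rewrite ffunE; apply: c0.
Qed.

Lemma length_koszul_homology p :
  length (koszul_homology N y p) = hl y (size y) 0 p (@stop R N) sbot.
Proof.
have s1 : siso (@qpi _ (@kboundary _ N y p)) stop (smod_of (@kboundary _ N y p)) stop sbot.
  by apply: siso_quot.
have s2 : siso val (@stop R (submod (@kcycle _ N y p))) (smod_of (@kboundary _ N y p))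
    (kZ y (size y) 0 p (@stop R N) sbot) (kB y (size y) 0 p stop sbot).
  apply: siso_sub => //.
  - exact/kB_le/sle_bot.
  - move=> c [/kdegE cp dc]; apply/andP; split=> //; apply/eqP/ffunP => S.
    by rewrite [RHS]ffunE; apply: dc.
  - move=> z; split=> // _; have /andP[zp /eqP dz] := valP z; split; first exact/kdegE.
    by move=> S; change (kdiff (val z) S = 0%R); rewrite dz ffunE.
  - move=> z; split=> [/asboolP[b bp zb]|[b /kdegE bp /kc_bot/eqP]].
      exists b; first exact/kdegE.
      by apply/kc_bot; apply/eqP; rewrite subr_eq0; apply/eqP.
    by rewrite subr_eq0 => /eqP zb; apply/asboolP; exists b.
have l1 := @qpi_linear _ (@kboundary _ N y p).
have l2 := @sval_linear _ (@kcycle _ N y p).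
have [a1 a2 a3 a4 a5] := s1; have [b1 b2 b3 b4 b5] := s2.
rewrite lengthE /hl -(len_map l2 b1 b2 b3 b4 b5).
exact/esym/(len_map l1 a1 a2 a3 a4 a5).
Qed.

(** H_0 = N/yN: u is placed at the empty set, and av is the boundary of v placed at the singleton of
    the index of a. *)
Lemma koszul_hl0 : hl y (size y) 0 0 (@stop R N) sbot = len (@stop R N) (isum y stop).
Proof.
pose f (u : N) : {ffun {set 'I_(size y)} -> N} := [ffun S => if S == set0 then u else 0%R].
have lf : linear f.
  move=> a u v; apply/ffunP => S; rewrite !ffunE; case: ifP => // _.
  by rewrite scaler0 addr0.
have fc u : kc (size y) 0 0 (@stop R N) (f u).
  by split=> // S; rewrite addn0 ffunE cards_eq0 => /negbTE ->.
have kc1 c : kc (size y) 1 0 (@stop R N) c -> c = 0%R.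
  by move=> [c0 _]; apply/ffunP => S; rewrite ffunE c0 // addn1.
have fZ u : stop u -> kZ y (size y) 0 0 (@stop R N) sbot (f u).
  by move=> _; apply/kZP; split=> //; rewrite (kc1 _ (kc_kd y (fc u))); apply: smem0.
have ZE c : kZ y (size y) 0 0 (@stop R N) sbot c -> c = f (c set0).
  move=> /kZP[[c0 _] _]; apply/ffunP => S; rewrite ffunE; case: eqP => [->//|/eqP S0].
  by rewrite c0 // addn0 cards_eq0.
apply/esym/(len_map lf) => //.
- exact/kB_le/sle_bot.
- by move=> c /ZE ->; exists (c set0) => //; rewrite subrr; apply: smem0.
move=> u _; split=> [[b _ /kc_bot/eqP]|].
  rewrite subr_eq0 => /eqP/ffunP/(_ set0); rewrite !ffunE eqxx => ->.
  elim/big_ind: _ => [|v w|j _]; [exact: smem0|exact: smemD|].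
  rewrite mulrC -scalerA; apply: (@isum_ge _ _ y stop _ (mem_nth 0%R (ltn_ord j))).
  exact: (ex_intro2 _ _ _ I erefl).
suff : isum y (@stop R N) <= spre lf (kB y (size y) 0 0 stop sbot) by apply.
apply: isum_le => a ya _ [v _ ->].
have iy : (index a y < size y)%N by rewrite index_mem.
set i := Ordinal iy.
pose b : {ffun {set 'I_(size y)} -> N} := [ffun S => if S == [set i] then v else 0%R].
have bc : kc (size y) 0 1 (@stop R N) b.
  split=> // S; rewrite addn0 ffunE; case: (S =P [set i]) => [->|//].
  by rewrite cards1.
exists b => //; apply/kc_bot/eqP; rewrite subr_eq0; apply/eqP.
have dZ : kZ y (size y) 0 0 (@stop R N) sbot (kd y b).
  apply/kZP; rewrite kdK; split; last exact: smem0.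
  by have := kc_kd y bc; rewrite kcS.
rewrite (ZE _ dZ); congr (f _); rewrite ffunE (bigD1 i) ?inE //= big1 ?addr0.
  rewrite setU0 ffunE eqxx nth_index // (_ : [set k in set0 | _] = set0).
    by rewrite cards0 expr0 mul1r.
  by apply/setP => k; rewrite !inE.
move=> j /andP[_ ji]; rewrite ffunE setU0 (inj_eq set1_inj) (negbTE ji).
by rewrite scaler0.
Qed.

Hypothesis nN : noeth N.
Hypothesis msy : msys (rev y) (@stop R N) sbot.

Lemma serre_multE : serre_mult N y = emult (rev y) (@stop R N) sbot.
Proof.
have := @koszul_length _ N y nN stop sbot _ (leqnn (size y)).
rewrite take_size => /(_ msy)[_ <-]; rewrite /serre_mult /chi big_mkord.
by apply: eq_bigr => p _; rewrite subn0; rewrite length_koszul_homology.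
Qed.

(** chi_0 = l(H_0) - chi_1 with H_0 = N/yN. *)
Lemma chi1E :
  chi N y 1 = ((len (@stop R N) (isum y stop))%:Z - emult (rev y) (@stop R N) sbot)%R.
Proof.
rewrite -serre_multE /serre_mult /chi [X in (_ - X)%R]big_nat_recl // -koszul_hl0.
rewrite length_koszul_homology subnn expr0 mul1r opprD addrA subrr add0r.
rewrite big_add1 /= -sumrN; apply: eq_bigr => i _.
by rewrite subn0 subn1 exprS mulN1r mulNr opprK.
Qed.

End Koszul.
End FromDefs.

(** * Consequences of R being local and Noetherian *)

Section Local.
Variables (R : comNzRingType) (c : R).
Hypothesis nc : ~ exists b, b * c = 1.

Definition princ : {pred R} := fun r => `[< exists s, r = s * c >].

Lemma princ_ideal : idealr_closed princ.
Proof.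
split; first by apply/asboolP; exists 0; rewrite mul0r.
  by apply/asboolP => -[b e]; apply: nc; exists b.
move=> a _ _ /asboolP[s ->] /asboolP[t ->]; apply/asboolP.
by exists (a * s + t)%R; ring.
Qed.

HB.instance Definition _ := isIdealr.Build R princ princ_ideal.

Lemma local_nonunit (m : idealr R) : local m -> c \in m.
Proof.
move=> /(_ (princ : idealr R)); apply; apply/asboolP.
by exists 1; rewrite mul1r.
Qed.

End Local.

(** A nonunit 1 - ba would lie in m together with ba, so m would contain 1. *)
Lemma local_jacobson (R : comNzRingType) (m : idealr R) a : local m -> a \in m -> jacobson a.
Proof.
move=> localm am b; apply: contrapT => nb.
have := local_nonunit nb localm; rewrite rpredBr ?idealr1 //.
exact: idealMr.
Qed.

Section FinGen.
Variable R : comNzRingType.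

Lemma fin_gen_fg (V : lmodType R) (S : {pred V}) (A : smod V) :
  fin_gen S -> (forall u, A u <-> u \in S) -> fg A.
Proof.
move=> [g gP] AS; exists g; apply: sle_anti => [u /AS/gP[c ->]|].
  elim/big_ind: _ => [|v w|i _]; [exact: smem0|exact: smemD|].
  by apply/smemZ/gen_mem/mem_nth.
apply: gen_le => u ug; apply/AS/gP.
have iu : (index u g < size g)%N by rewrite index_mem.
exists (fun i => (i == Ordinal iu)%:R); rewrite (bigD1 (Ordinal iu)) //= eqxx scale1r.
by rewrite nth_index // big1 ?addr0 // => i /negbTE ->; rewrite scale0r.
Qed.

Variable V : lmodType R.
Hypothesis noethR : noetherian R.

(** Ideal of the coefficients of u in elements of A, an analogue of leading coefficients in
    Hilbert's basis theorem: for A <= Ru + G, generators of it and of A :&: G generate A. *)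
Definition coef_ideal (u : V) (G A : smod V) : smod R^o.
Proof.
exists (fun r : R^o => exists2 w, G w & A ((r : R) *: u + w)%R).
  by exists 0%R; rewrite ?scale0r ?addr0; apply: smem0.
move=> a r r' [w gw Aw] [w' gw' Aw']; exists (a *: w + w')%R; first exact: smemL.
by rewrite scalerDl -scalerA addrACA -scalerDr; apply: smemL.
Defined.

Lemma fg_gen (g : seq V) (A : smod V) : A <= gen g -> fg A.
Proof.
elim: g A => [|u g IH] A Ag.
  exists [::]; apply: sle_anti => //; rewrite /gen big_nil; exact: sle_bot.
pose I := coef_ideal u (gen g) A.
have [l lP] : fg I.
  have [g0 g0P] := noethR (spred I).
  by apply: (@fin_gen_fg _ (spred I)); [exists g0|move=> r; apply: iff_sym; apply: spredE].
have [h hP] : fg (A :&: gen g) by apply: IH; apply: scapr.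
have lI r : r \in l -> I r by move=> rl; rewrite lP; apply: gen_mem.
suff [h' h'A lh'] : exists2 h', gen h' <= A &
    forall r, gen l r -> exists2 w, gen g w & gen h' (r *: u + w)%R.
  exists (h' ++ h); rewrite gen_cat; apply: sle_anti; last first.
    by apply: sadd_le => //; rewrite -hP; apply: scapl.
  move=> v Av; have := Ag v Av; rewrite {1}/gen big_cons -/(gen g) => -[_ [r ->] gv].
  have [w gw h'w] : exists2 w, gen g w & gen h' (r *: u + w)%R.
    apply: lh'; rewrite -lP; exists (v - r *: u)%R => //.
    by rewrite addrC subrK.
  exists (r *: u + w)%R => //; rewrite -hP; split; last first.
    by rewrite opprD addrA; apply: smemB.
  by apply: smemB => //; apply: h'A.
elim: l lI {lP} => [|r l IHl] lI.
  exists [::]; first by rewrite /gen big_nil; apply: sle_bot.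
  rewrite {1}/gen big_nil => r ->; exists 0%R; first exact: smem0.
  by rewrite scale0r addr0; apply: smem0.
have [|h' h'A lh'] := IHl; first by move=> s sl; apply: lI; rewrite in_cons sl orbT.
have [w gw Aw] := lI r (mem_head _ _).
exists ((r *: u + w)%R :: h').
  rewrite /gen big_cons; apply: sadd_le => //; exact: cyc_le.
move=> s; rewrite {1}/gen big_cons => -[_ [a ->] /lh' [w' gw' h'w']].
exists (a *: w + w')%R; first exact: smemL.
rewrite /gen big_cons; exists (a *: (r *: u + w))%R; first by exists a.
have -> : (s *: u + (a *: w + w') - a *: (r *: u + w) = (s - a * r) *: u + w')%R.
  by rewrite scalerBl scalerDr scalerA opprD addrACA [(a *: w + w')%R]addrC addrK.
exact: h'w'.
Qed.

Lemma fin_gen_noeth : fin_gen (predT : {pred V}) -> noeth V.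
Proof.
move=> fgV; have [g gP] : fg (@stop R V) by apply: fin_gen_fg fgV _.
by apply: fg_noeth => A; apply: (@fg_gen g); rewrite -gP.
Qed.

End FinGen.

Section Kerby.
Variables (R : comNzRingType) (M : lmodType R).
Hypothesis nM : noeth M.
Variables (y : seq R) (a : R) (w : seq R).
Let B : smod M := isum y stop.

Lemma noeth_kerby : noeth (kerby (modmul M y) a).
Proof. by apply/noeth_sub/noeth_quot. Qed.

Let s1 : siso (@qpi _ _ (smul M y)) (B :/ a) B (smod_of (ann_by (modmul M y) a)) sbot.
Proof.
rewrite /B -smod_of_smul; apply: siso_quot; first exact: scol_le.
move=> u; split=> [yau|/eqP e]; first apply/eqP.
  by rewrite -qpiZ; apply/qpi_eq0.
by apply/qpi_eq0; rewrite qpiZ.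
Qed.

Let s2 : siso val (@stop R (kerby (modmul M y) a)) sbot
  (smod_of (ann_by (modmul M y) a)) sbot.
Proof.
apply: siso_sub; do ?exact: sle_bot; do ?exact: sle_refl.
  by move=> u; split=> // _; apply: valP.
by move=> u; split=> [->|e]; [exact: linear0|exact: val_inj].
Qed.

(** (0 : a) in M/yM is the subquotient (B : a)/B of M with B = yM. *)
Lemma emult_kerby : emult w (@stop R (kerby (modmul M y) a)) sbot = emult w (B :/ a) B.
Proof.
by rewrite (emult_map w (@sval_linear _ _ _) s2) -(emult_map w (@qpi_linear _ _ _) s1).
Qed.

Lemma msys_kerby : msys w (@stop R (kerby (modmul M y) a)) sbot <-> msys w (B :/ a) B.
Proof.
by rewrite (msys_map w (@sval_linear _ _ _) s2) -(msys_map w (@qpi_linear _ _ _) s1).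
Qed.

End Kerby.

(** * One and two elements *)

Section TwoVar.
Variables (R : comNzRingType) (V : lmodType R).
Hypothesis nV : noeth V.
Implicit Types (A B C D : smod V) (y z : R).
Local Notation top := (@stop R V).

Lemma scol_pow y B a : B :/ (y ^+ 2)%R <= B :/ y -> (0 < a)%N ->
  B :/ (y ^+ a)%R = B :/ y.
Proof.
move=> y2; case: a => // a _; elim: a => [|a IH]; first by rewrite expr1.
apply: sle_anti; last by rewrite exprS; apply: scolMS.
rewrite exprSr scolM IH -scolM -expr2; exact: y2.
Qed.

(** y^a induces an isomorphism of M/(yM + (B : y^a)) onto (y^a M + B)/(y^(a+1) M + B). *)
Lemma len_step y a B : flen top ((y ^+ a.+1)%R *: top + B) ->
  len top ((y ^+ a.+1)%R *: top + B) =
  (len top ((y ^+ a)%R *: top + B) + len top (y *: top + (B :/ (y ^+ a)%R)))%N.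
Proof.
move=> f; set P := _ + B in f *.
have PE : (y ^+ a)%R *: top + P = (y ^+ a)%R *: top + B.
  rewrite /P saddA [_ *: _ + _ *: _]sadd_idr // exprSr scalM.
  by apply: scalS; apply: scal_sub.
rewrite (@len_split _ _ top ((y ^+ a)%R *: top + B) P f) //; last first.
  by rewrite -PE; apply: saddr.
congr (_ + _)%N; rewrite -PE len_scal; congr (len _ _).
apply: smod_ext => u; split=> [[_ /scal_addP[v _ Bv]]|/scal_addP[v _ Bv]].
  by apply/scal_addP; exists v => //=; rewrite scalerBr scalerA -exprSr.
split=> //; apply/scal_addP; exists v => //.
by rewrite exprSr -scalerA -scalerBr.
Qed.

(** The increments l(M/(yM + (B : y^a))) are constant, so these submodules do not depend on a;
    Nakayama then compares the stable colon K with (B : y). *)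
Lemma affine_scol y B (al be : int) : jacobson y ->
  (forall a, (0 < a)%N -> flen top ((y ^+ a)%R *: top + B)) ->
  (forall a, (0 < a)%N -> (len top ((y ^+ a)%R *: top + B))%:Z = (al + be * a%:Z)%R) ->
  B :/ (y ^+ 2)%R <= B :/ y.
Proof.
move=> jy fl ln.
have lenN a : (0 < a)%N -> (len top (y *: top + (B :/ (y ^+ a)%R)))%:Z = be.
  move=> a0; have := len_step (fl a.+1 isT).
  by move/(congr1 Posz); rewrite PoszD !ln //; lia.
have subN a : y *: top + (B :/ y) <= y *: top + (B :/ (y ^+ a.+1)%R).
  by apply: saddS => //; rewrite exprS; apply: scolMS.
have flN : flen top (y *: top + (B :/ y)).
  have := fl 1%N isT; rewrite expr1 => /flen_up; apply=> //.
  by apply: saddS => //; apply: scol_le.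
have eN a : y *: top + (B :/ (y ^+ a.+1)%R) = y *: top + (B :/ y).
  apply: (eq_len flN) => //.
  by apply: succn_inj; have := lenN 1%N isT; have := lenN a.+1 isT; rewrite expr1; lia.
have [k kP] := noeth_scol B y nV.
set K := B :/ (y ^+ k.+2)%R.
have KE j : (k <= j)%N -> B :/ (y ^+ j)%R = K.
  by move=> kj; rewrite /K !kP //; lia.
have yK : B :/ y <= K by rewrite /K exprS; apply: scolMS.
suff KB : K <= B :/ y.
  by apply: sle_trans KB; rewrite /K -[k.+2]addn2 exprD mulrC; apply: scolMS.
have j1 : {in [:: y], forall a, jacobson a} by move=> a; rewrite inE => /eqP ->.
apply: (nakayama nV j1 yK); rewrite isum_cons isum_nil [_ + sbot]saddC sadd0.
(* Write u = yv + w with w in (B : y). Then yv is in K, and so is v because K is stable; hence K <=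
   yK + (B : y). *)
move=> u Ku; have : (y *: top + (B :/ (y ^+ k.+2)%R))%S u by apply: saddr.
rewrite eN => /scal_addP[v _ Bw]; apply/scal_addP; exists v => //.
have Kyv : K (y *: v)%R by rewrite -[(y *: v)%R](subKr u); apply: smemB => //; apply: yK.
have -> : K = B :/ (y ^+ k.+3)%R by rewrite KE // !leqW.
by rewrite exprSr scolM.
Qed.

Lemma desc_stable (f : nat -> smod V) W l : (forall n, f n.+1 <= f n) ->
  (forall n, flen W (f n)) -> (forall n, (len W (f n) <= l)%N) ->
  exists k, forall j, (k <= j)%N -> f j = f k.
Proof.
move=> fS fl fb.
have fm i j : (i <= j)%N -> f j <= f i.
  move/subnKC <-; elim: (j - i)%N => [|n IH]; first by rewrite addn0.
  by rewrite addnS; apply: sle_trans (fS _) _.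
have [||v /asboolP[k <-] maxk] := @ex_maxnP (fun v => `[< exists n, len W (f n) = v >]) l.
- by exists (len W (f 0%N)); apply/asboolP; exists 0%N.
- by move=> v /asboolP[n <-].
exists k => j kj; have fjk := fm _ _ kj.
have fk : f k <= W := flen_ge (fl k).
apply/esym/(len_eq0 (flen_down (fl j) fjk fk)).
have := len_split (fl j) fjk fk.
have : (len W (f j) <= len W (f k))%N by apply: maxk; apply/asboolP; exists j.
by lia.
Qed.

Lemma krull1 z B u : jacobson z ->
  (forall b, (0 < b)%N -> ((z ^+ b)%R *: top + B)%S u) -> B u.
Proof.
move=> jz h; apply: (@krull _ _ [:: z] B u nV) => [a|k /h].
  by rewrite inE => /eqP ->.
by rewrite /= isum_cons isum_nil [_ + sbot]saddC sadd0.
Qed.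

(** Fixing one exponent gives the affine case, and Krull passes to B. The heart is (B : y) <= (B :
    z), which rests on the absence of a term in b alone. *)
Lemma bilinear_scol y z B (al be ga : int) : jacobson y -> jacobson z ->
  (forall a b, (0 < a)%N -> (0 < b)%N ->
     flen top ((y ^+ a)%R *: top + ((z ^+ b)%R *: top + B))) ->
  (forall a b, (0 < a)%N -> (0 < b)%N ->
    (len top ((y ^+ a)%R *: top + ((z ^+ b)%R *: top + B)))%:Z =
    (al + be * a%:Z + ga * a%:Z * b%:Z)%R) ->
  B :/ (y * z)%R <= B :/ z.
Proof.
move=> jy jz fl ln.
have swap a b : (y ^+ a)%R *: top + ((z ^+ b)%R *: top + B) =
                (z ^+ b)%R *: top + ((y ^+ a)%R *: top + B).
  by rewrite !saddA [_ *: _ + _ *: _]saddC.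
have S1 b : (0 < b)%N -> ((z ^+ b)%R *: top + B) :/ (y ^+ 2)%R <=
                         ((z ^+ b)%R *: top + B) :/ y.
  move=> b0; apply: (@affine_scol _ _ al (be + ga * b%:Z)%R jy) => a a0; first exact: fl.
  by rewrite ln //; ring.
have S2 a : (0 < a)%N -> ((y ^+ a)%R *: top + B) :/ (z ^+ 2)%R <=
                         ((y ^+ a)%R *: top + B) :/ z.
  move=> a0; apply: (@affine_scol _ _ (al + be * a%:Z)%R (ga * a%:Z)%R jz) => b b0.
    by rewrite -swap; apply: fl.
  by rewrite -swap ln.
have By2 : B :/ (y ^+ 2)%R <= B :/ y.
  move=> u Bu; apply: (@krull1 z B (y *: u)%R jz) => b b0.
  exact: (S1 b b0 u (scolS (@saddr _ _ _ B) Bu)).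
have Bz2 : B :/ (z ^+ 2)%R <= B :/ z.
  move=> u Bu; apply: (@krull1 y B (z *: u)%R jy) => a a0.
  exact: (S2 a a0 u (scolS (@saddr _ _ _ B) Bu)).
set W := B :/ y; pose P b := y *: top + ((z ^+ b)%R *: top + B).
have flP b : (0 < b)%N -> flen top (P b) by move=> b0; have := fl 1%N b isT b0; rewrite expr1.
(* M/P b has length al + be + ga b, and the increment in a is be + ga b. So (yM + (Bb : y))/P b has
   length al, and it contains the image of W: a bound independent of b. *)
have WP b : (0 < b)%N -> flen W (W :&: P b) /\ ((len W (W :&: P b))%:Z <= al)%R.
  move=> b0; pose Bb := (z ^+ b)%R *: top + B.
  have PT : P b <= y *: top + (Bb :/ y) by apply: saddS => //; apply: scol_le.
  have WPT : W + P b <= y *: top + (Bb :/ y).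
    apply: sadd_le => //; apply: sle_trans (@saddr _ _ _ _).
    by apply: scolS; apply: saddr.
  have flW : flen (W + P b) (P b) by apply: flen_down (flP b b0) _ _ => //; apply: saddr.
  rewrite -flen_iso2 -len_iso2; split=> //.
  have := len_sub (flen_down (flP b b0) PT (@sle_top _ _ _)) (@sle_refl _ _ _) (@saddr _ _ _ _) WPT.
  have := len_split (flP b b0) PT (@sle_top _ _ _).
  have := len_step (fl 2%N b isT b0); rewrite expr1 -/Bb -/(P b).
  have := ln 1%N b isT b0; have := ln 2%N b isT b0; rewrite expr1 -/Bb -/(P b).
  by lia.
have [||| k kP] := @desc_stable (fun b => W :&: P b.+1) W `|al|%N.
- move=> n u [Wu Pu]; split=> //; move: u Pu {Wu}; apply: saddS => //; apply: saddS => //.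
  by rewrite exprSr scalM; apply: scalS; apply: scal_sub.
- by move=> n; have [] := WP n.+1 isT.
- by move=> n; have [_] := WP n.+1 isT; lia.
(* The stable value of W :&: P b lies in every yM + z^b M + B, and Krull modulo yM + B removes
   z^b. *)
have PkyB : W :&: P k.+1 <= y *: top + B.
  move=> u WPu; apply: (krull1 jz) => b b0.
  have : (W :&: P (maxn k b).+1)%S u.
    by have /(congr1 (fun S => smem S u)) /= -> := kP (maxn k b) (leq_maxl _ _).
  move=> [_ Pu]; rewrite saddA [_ *: _ + _ *: _]saddC -saddA.
  move: u Pu {WPu}; apply: saddS => //; apply: saddS => //.
  have -> : ((maxn k b).+1 = b + ((maxn k b).+1 - b))%N by lia.
  by rewrite exprD scalM; apply: scalS; apply: scal_sub.
have WB : W <= B :/ z.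
  rewrite -(@scol_pow z B k.+1 Bz2) // => w Ww.
  (* z^(k+1) w lies in W and in P, so it equals yv modulo B. Multiplying by y gives y^2 v in B, so
     yv and with it z^(k+1) w are in B. *)
  have Wz : W (z ^+ k.+1 *: w)%R by apply: smemZ.
  have /PkyB/scal_addP[v _ Bv] : (W :&: P k.+1)%S (z ^+ k.+1 *: w)%R.
    by split=> //; apply: saddr; apply: saddl; exists w.
  apply: (smemBr _ Bv); apply: By2 => /=.
  have : B (y *: (z ^+ k.+1 *: w) - y *: (z ^+ k.+1 *: w - y *: v))%R.
    by apply: smemB; [exact: Wz|exact: smemZ].
  by rewrite -scalerBr subKr scalerA -expr2.
move=> u /= Bu; apply: Bz2 => /=; rewrite expr2 -scalerA; apply: WB.
by rewrite /= scalerA.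
Qed.

(* Converse of [affine_scol]: an affine function is determined by its values at 1
   and 2. *)
Lemma scol_affine y B a : flen top (y *: top + B) -> B :/ (y ^+ 2)%R <= B :/ y ->
  (0 < a)%N -> (len top ((y ^+ a)%R *: top + B))%:Z =
  ((2 - a%:Z) * (len top (y *: top + B))%:Z
   + (a%:Z - 1) * (len top ((y ^+ 2)%R *: top + B))%:Z)%R.
Proof.
move=> f y2; have fl b : flen top ((y ^+ b)%R *: top + B) by apply: flen_pow1.
have step b : (0 < b)%N -> len top ((y ^+ b.+1)%R *: top + B) =
    (len top ((y ^+ b)%R *: top + B) + len top (y *: top + (B :/ y)))%N.
  by move=> b0; rewrite len_step // scol_pow.
have e2 := step 1%N isT; rewrite expr1 in e2.
case: a => // a _; elim: a => [|a IH]; first by rewrite expr1; ring.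
by rewrite step // PoszD IH e2 PoszD; lia.
Qed.

(* The difference is the constant coefficient of the affine function of a given by
   the length of M / (y^a, z^b, B). *)
Lemma scol_bounded y z B : flen top (y *: top + (z *: top + B)) ->
  (y *: top + B) :/ (z ^+ 2)%R <= (y *: top + B) :/ z -> B :/ y <= B :/ z ->
  exists C : int, forall b, (0 < b)%N ->
    (0 <= 2 * (len top (y *: top + ((z ^+ b)%R *: top + B)))%:Z
         - (len top ((y ^+ 2)%R *: top + ((z ^+ b)%R *: top + B)))%:Z <= C)%R.
Proof.
move=> f zcol ycol.
have BTop : B <= top by [].
(* (B : y)/B is killed by y and, as (B : y) <= (B : z), also by z. *)
have fyB : flen (B :/ y) B.
  have : msys [:: y; z] top B by rewrite /msys !isum_cons isum_nil -!saddA sadd0.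
  move/(@msys_sub _ _ _ _ _ (B :/ y) B nV); rewrite /msys sadd_idl.
    by apply=> //; apply: scol_le.
  by apply: isum_le => a; rewrite !inE => /orP[] /eqP ->; apply/scal_le.
(* The difference is the length of T/P. With U absorbing one power of z less than P, the two
   summands bound U/P and ((B : y) + U)/U. *)
exists (len top (y *: top + (z *: top + B)) + len (B :/ y) B)%N%:Z => -[//|b] _.
set Bb := (z ^+ b.+1)%R *: top + B; set P := y *: top + Bb.
have fzP : flen top (z *: top + (y *: top + B)).
  by move: f; rewrite !saddA [_ *: _ + _ *: _]saddC.
have fP : flen top P.
  have := @flen_pow1 _ _ z b.+1 top (y *: top + B) fzP.
  by rewrite /P /Bb !saddA [_ *: _ + _ *: _]saddC.
have fP2 : flen top ((y ^+ 2)%R *: top + Bb) by apply: flen_pow1.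
have PT : P <= y *: top + (Bb :/ y) by apply: saddS => //; apply: scol_le.
have := len_step fP2; rewrite expr1 -/P.
have := len_split fP PT (@sle_top _ _ _).
set T := y *: top + (Bb :/ y) in PT *.
pose U := (z ^+ b)%R *: top + P.
have UTop : (B :/ y) + U <= top by [].
have TU : T <= (B :/ y) + U.
  apply: sadd_le; first by do 2!(apply: sle_trans (@saddr _ _ _ _)); apply: saddl.
  (* yu = z^(b+1) v modulo B puts v in (yM + B) : z^(b+1) = (yM + B) : z. With zv = yw modulo B, the
     element u - z^b w lies in (B : y). *)
  move=> u Bu; have /scal_addP[v _ Bv] : Bb (y *: u)%R by [].
  have : ((y *: top + B) :/ (z ^+ b.+1)%R)%S v.
    suff : (y *: top + B)%S (z ^+ b.+1 *: v)%R by [].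
    rewrite -[(z ^+ b.+1 *: v)%R](subKr (y *: u)).
    by apply: smemB; [apply: saddl; exists u|apply: saddr].
  rewrite scol_pow // => /scal_addP[w _ Bw].
  exists (u - z ^+ b *: w)%R; last by apply: saddl; exists w => //; rewrite subKr.
  suff : B (y *: (u - z ^+ b *: w))%R by [].
  have -> : (y *: (u - z ^+ b *: w) =
      (y *: u - z ^+ b.+1 *: v) + z ^+ b *: (z *: v - y *: w))%R.
    rewrite !scalerBr addrA !scalerA -exprSr subrK.
    by rewrite [(y * _)%R]mulrC.
  by apply: smemD => //; apply: smemZ.
have PU : P <= U by apply: saddr.
have fUP : flen ((B :/ y) + U) P.
  by apply: flen_down fP _ _ => //; apply: sle_trans PU _; apply: saddr.
have := len_sub fUP (@sle_refl _ _ P) PT TU.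
have := len_split fUP PU (@saddr _ _ _ _).
have : (len U P <= len top (y *: top + (z *: top + B)))%N.
  rewrite len_scal; apply: len_sub => //.
  apply: sadd_le; last apply: sadd_le.
  - move=> _ [w _ ->]; split=> //; suff: P (z ^+ b *: (y *: w))%R by [].
    by apply: saddl; exists (z ^+ b *: w)%R => //; rewrite !scalerA mulrC.
  - move=> _ [w _ ->]; split=> //; suff: P (z ^+ b *: (z *: w))%R by [].
    apply: saddr; apply: saddl; exists w => //.
    by rewrite scalerA -exprSr.
  move=> w Bw; split=> //; suff: P (z ^+ b *: w)%R by [].
  by do 2!apply: saddr; apply: smemZ.
have : (len ((B :/ y) + U) U <= len (B :/ y) B)%N.
  rewrite len_iso2; apply: len_sub => //; do ?exact: scapl.
  by move=> w Bw; split; [apply: smemZ|do 3!apply: saddr].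
by lia.
Qed.

End TwoVar.

(** * Powers of a system of parameters *)

Definition upd (n : nat -> nat) k a := fun j => if j == k then a else n j.

Lemma updE n k a : upd n k a k = a. Proof. by rewrite /upd eqxx. Qed.

Lemma upd_gt0 n k a : (forall j, (0 < n j)%N) -> (0 < a)%N ->
  forall j, (0 < upd n k a j)%N.
Proof. by move=> n0 a0 j; rewrite /upd; case: ifP. Qed.

Lemma prod_upd1 k a l m : (\prod_(l <= t < m) (if t == k then a else 1))%N =
  (if (l <= k < m)%N then a else 1%N).
Proof.
by rewrite -big_mkcond big_nat1_eq.
Qed.

Section Powers.
Variables (R : comNzRingType) (V : lmodType R) (X : nat -> R) (d : nat).
Hypothesis nV : noeth V.
Hypothesis jX : forall k, (k < d)%N -> jacobson (X k).
Local Notation top := (@stop R V).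
Hypothesis msX : msys [seq X k | k <- iota 0 d] top sbot.
Implicit Types (n : nat -> nat) (P : pred nat).

Definition powsum n P : smod V := \big[@sadd R V/sbot]_(k < d | P k) ((X k ^+ n k)%R *: top).
Definition powlen n := len top (powsum n predT).

(** Indices start at 0, so n 0 is the exponent of x_1. Products start at k, which makes [pol] a
    Horner scheme, see [pol_recl]. *)
Definition pol k (c : nat -> int) n : int :=
  (\sum_(k <= i < d.+1) (\prod_(k <= j < i) n j)%N%:Z * c i)%R.

Definition nested_length := exists c, forall n, (forall j, (0 < n j)%N) ->
  (powlen n)%:Z = pol 0 c n.

(** The dd-condition pulled back to M: the indices k < i are the initial part of the d-sequence,
    those with l <= k are divided out. The reverse inclusions always hold. *)
Definition dd_powers := forall n, (forall j, (0 < n j)%N) ->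
  forall i j l, (i <= j)%N -> (j < l)%N -> (l <= d)%N ->
  powsum n (fun k => (k < i) || (l <= k))%N :/ (X i ^+ n i * X j ^+ n j)%R <=
  powsum n (fun k => (k < i) || (l <= k))%N :/ (X j ^+ n j)%R.

Lemma eq_powsum n n' P P' : (forall t, (t < d)%N -> P t = P' t) ->
  (forall t, (t < d)%N -> P t -> n t = n' t) -> powsum n P = powsum n' P'.
Proof.
move=> PP nn; apply: eq_big => [t|t Pt]; first exact: PP.
by rewrite nn.
Qed.

Lemma powsum_D1 n P k : (k < d)%N -> P k ->
  powsum n P = (X k ^+ n k)%R *: top + powsum n (fun t => P t && (t != k)).
Proof. by move=> kd Pk; rewrite /powsum (bigD1 (Ordinal kd)). Qed.

Lemma powsum_split n P Q :
  powsum n P = powsum n (fun t => P t && Q t) + powsum n (fun t => P t && ~~ Q t).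
Proof. exact: bigID. Qed.

Lemma powsum_isum n : powsum n predT = isum [seq X i ^+ n i | i <- iota 0 d]%R top.
Proof. by rewrite /powsum /isum big_map -[in RHS](subn0 d) -/(index_iota 0 d) big_mkord. Qed.

Lemma flen_powsum n : flen top (powsum n predT).
Proof.
have := msys_pow n msX; rewrite /msys -powsum_isum.
by rewrite [_ + sbot]saddC sadd0.
Qed.

Lemma powsum_upd n k a : (k < d)%N ->
  powsum (upd n k a) predT = (X k ^+ a)%R *: top + powsum n (fun t => t != k).
Proof.
move=> kd; rewrite (@powsum_D1 _ _ k) // updE; congr (_ + _); apply: eq_powsum => // t _ /=.
by rewrite /upd => /negbTE ->.
Qed.

Lemma powsum_upd2 n k k' a b : (k < d)%N -> (k' < d)%N -> k != k' ->
  powsum (upd (upd n k a) k' b) predT =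
  (X k ^+ a)%R *: top + ((X k' ^+ b)%R *: top + powsum n (fun t => (t != k) && (t != k'))).
Proof.
move=> kd kd' kk'; rewrite (@powsum_D1 _ _ k) // {1}/upd (negbTE kk') updE; congr (_ + _).
rewrite (@powsum_D1 _ _ k') ?updE 1?eq_sym //=; congr (_ + _).
by apply: eq_powsum => // t _ /= /andP[/negbTE tk /negbTE tk']; rewrite /upd tk tk'.
Qed.

(** For i <= j every monomial containing n_j contains n_i, so no term in b alone arises; for i = j
    the middle coefficient vanishes. *)
Lemma pol_upd (c : nat -> int) n i j : (i <= j)%N -> (j < d)%N ->
  exists al be ga : int, forall a b,
    pol 0 c (fun t => (if t == i then a else 1) * ((if t == j then b else 1) * n t))%N =
    (al + be * a%:Z + ga * a%:Z * b%:Z)%R.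
Proof.
move=> ij jd.
pose p m := ((\prod_(0 <= t < m) n t)%N%:Z * c m)%R.
exists (\sum_(0 <= m < d.+1) (m <= i)%N%:Z * p m)%R,
       (\sum_(0 <= m < d.+1) (i < m <= j)%N%:Z * p m)%R,
       (\sum_(0 <= m < d.+1) (j < m)%N%:Z * p m)%R => a b.
rewrite /pol !mulr_suml -!big_split /=; apply: eq_bigr => m _.
rewrite !big_split /= !prod_upd1 /= /p.
rewrite !PoszM; case: (ltnP i m) => im; case: (ltnP j m) => jm /=; try lia; ring.
Qed.

Lemma nested_length_dd_powers : nested_length -> dd_powers.
Proof.
move=> [c cP] n n0 i j l ij jl ld; have jd : (j < d)%N by lia.
have id : (i < d)%N by lia.
set B := powsum n _ => u Bu.
(* T selects the indices other than i and j that are missing from B. Adding k-th powers of these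
   elements to B makes the lengths finite, and Krull removes them. *)
pose T t := [&& (i <= t)%N, (t < l)%N, t != i & t != j].
apply: (@krull _ _ [seq X t | t <- [seq t <- iota 0 d | T t]] B (X j ^+ n j *: u)%R nV) => [a|k k0].
  case/mapP => t; rewrite mem_filter mem_iota => /andP[_ /andP[_ td]] ->.
  exact: jX.
pose n' t := if T t then k else n t.
have n'0 t : (0 < n' t)%N by rewrite /n'; case: ifP.
have n'i : n' i = n i by rewrite /n' /T eqxx !andbF.
have n'j : n' j = n j by rewrite /n' /T eqxx !andbF.
set B' := isum _ _ + B.
have B'E : B' = powsum n' (fun t => (t != i) && (t != j)).
  rewrite (powsum_split _ _ T) /B'; congr (_ + _).
    rewrite /isum !big_map big_filter -[in LHS](subn0 d) -/(index_iota 0 d) big_mkord.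
    rewrite /powsum; apply: eq_big => t; rewrite /n' /T; first by lia.
    by move=> ->.
  rewrite /B; apply: eq_powsum => t td; first by rewrite /T; lia.
  by rewrite /n' /T => h; case: ifP => //; lia.
suff sB : B' :/ (X i ^+ n i * X j ^+ n j)%R <= B' :/ (X j ^+ n j)%R.
  exact: (sB u (scolS (@saddr _ _ _ B) Bu)).
rewrite B'E; have [al [be [ga pE]]] := pol_upd c n' ij jd.
have jacp t : (t < d)%N -> jacobson (X t ^+ n t)%R by move=> td; apply: jacobsonX (jX td).
pose N a b t := ((if t == i then a else 1) * ((if t == j then b else 1) * n' t))%N.
have N0 a b : (0 < a)%N -> (0 < b)%N -> forall t, (0 < N a b t)%N.
  by move=> a0 b0 t; rewrite /N !muln_gt0 n'0; do 2!case: ifP => //; rewrite ?a0 ?b0.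
(* For i = j the second factor is set to 1, and the length is affine in a with slope be + ga. *)
have [eij|nij] := eqVneq i j.
  have GE a : powsum (N a 1%N) predT = ((X j ^+ n j) ^+ a)%R *: top +
      powsum n' (fun t => (t != j) && (t != j)).
    rewrite (@powsum_D1 _ _ j) // /N eij eqxx mul1n n'j mulnC exprM; congr (_ + _).
    apply: eq_powsum => t td; rewrite ?andbb // => /negbTE ->; lia.
  rewrite eij -expr2; apply: (@affine_scol _ _ nV _ _ (al : int) (be + ga)%R (jacp _ jd)) => a a0.
    by rewrite -GE; apply: flen_powsum.
  by rewrite -GE -/(powlen _) cP ?pE; [ring|apply: N0].
have GE a b : powsum (N a b) predT = ((X i ^+ n i) ^+ a)%R *: top +
    (((X j ^+ n j) ^+ b)%R *: top + powsum n' (fun t => (t != i) && (t != j))).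
  rewrite (@powsum_D1 _ _ i) // /N eqxx (negbTE nij) mul1n n'i mulnC exprM; congr (_ + _).
  have nji : (j == i) = false by rewrite eq_sym (negbTE nij).
  rewrite (@powsum_D1 _ _ j) //= ?nji // eqxx mul1n n'j mulnC exprM.
  by congr (_ + _); apply: eq_powsum => t td // /andP[/negbTE -> /negbTE ->]; lia.
apply: (@bilinear_scol _ _ nV _ _ _ al be ga (jacp _ id) (jacp _ jd)) => a b a0 b0.
  by rewrite -GE; apply: flen_powsum.
by rewrite -GE -/(powlen _) cP ?pE; [|apply: N0].
Qed.

Lemma eq_powlen n n' : (forall t, (t < d)%N -> n t = n' t) -> powlen n = powlen n'.
Proof. by move=> nn; rewrite /powlen (@eq_powsum n n' predT predT) // => t td _; apply: nn. Qed.

Lemma pol_recl k c n : (k < d)%N -> pol k c n = (c k + (n k)%:Z * pol k.+1 c n)%R.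
Proof.
move=> kd; rewrite /pol big_ltn ?leqW // big_geq // mul1r; congr (_ + _)%R.
rewrite mulr_sumr; apply: eq_big_nat => i /andP[ki _].
by rewrite big_ltn // PoszM mulrA.
Qed.

Lemma pol_d c n : pol d c n = c d.
Proof. by rewrite /pol big_nat1 big_geq // mul1r. Qed.

Lemma eq_pol k c n n' : (forall t, (k <= t < d)%N -> n t = n' t) -> pol k c n = pol k c n'.
Proof.
move=> nn; apply: eq_big_nat => i /andP[ki id].
congr (_ %:Z * _)%R; apply: eq_big_nat => t /andP[kt ti]; apply: nn; lia.
Qed.

Lemma pol_lin k (c1 c2 : nat -> int) (s1 s2 : int) n :
  pol k (fun i => s1 * c1 i + s2 * c2 i)%R n = (s1 * pol k c1 n + s2 * pol k c2 n)%R.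
Proof. by rewrite /pol !mulr_sumr -big_split; apply: eq_bigr => i _ /=; ring. Qed.

Lemma bounded_lin (a b C : int) :
  (forall t : nat, (0 < t)%N -> (0 <= a + t%:Z * b <= C)%R) -> b = 0%R.
Proof.
move=> h; have := h (`|a| + `|C| + 1)%N; have := h 1%N isT.
by case: (ltgtP b 0%R) => // b0; nia.
Qed.

Lemma dd_powers_nested_length : dd_powers -> nested_length.
Proof.
move=> dd.
have affE n k : (forall j, (0 < n j)%N) -> (k < d)%N ->
    (powlen n)%:Z = ((2 - (n k)%:Z) * (powlen (upd n k 1))%:Z
                  + ((n k)%:Z - 1) * (powlen (upd n k 2))%:Z)%R.
  move=> n0 kd; have n1 := upd_gt0 k n0 (isT : (0 < 1)%N).
  have -> : powlen n = powlen (upd n k (n k)).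
    by apply: eq_powlen => t _; rewrite /upd; case: eqP => [->|].
  rewrite /powlen !powsum_upd // expr1; apply: scol_affine => //.
    by have := flen_powsum (upd n k 1); rewrite powsum_upd // expr1.
  have := dd _ n1 k k k.+1 (leqnn _) (ltnSn _) kd; rewrite updE expr1 -expr2.
  suff -> : powsum (upd n k 1) (fun t => (t < k) || (k < t))%N = powsum n (fun t => t != k) by [].
  by apply: eq_powsum => t _; [lia|move=> tk; rewrite /upd ifF //; lia].
have bnd n k : (forall j, (0 < n j)%N) -> (k.+1 < d)%N -> exists C : int,
    forall b, (0 < b)%N -> (0 <= 2 * (powlen (upd (upd n k 1) k.+1 b))%:Z
      - (powlen (upd (upd n k 2) k.+1 b))%:Z <= C)%R.
  move=> n0 kd; have kd' := ltnW kd; have kk : k != k.+1 by lia.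
  have n1 := upd_gt0 k.+1 (upd_gt0 k n0 (isT : (0 < 1)%N)) (isT : (0 < 1)%N).
  have uk : upd (upd n k 1) k.+1 1 k = 1%N by rewrite /upd (negbTE kk) eqxx.
  have E b a : powlen (upd (upd n k a) k.+1 b) = len top ((X k ^+ a)%R *: top +
      ((X k.+1 ^+ b)%R *: top + powsum n (fun t => (t != k) && (t != k.+1)))).
    by rewrite /powlen powsum_upd2.
  have fl := flen_powsum (upd (upd n k 1) k.+1 1); rewrite powsum_upd2 // !expr1 in fl.
  have [||C CP] := scol_bounded nV fl; last first.
    by exists C => b b0; rewrite !E expr1; apply: CP.
  - have := dd _ n1 k k.+1 k.+2 (leqnSn _) (ltnSn _) kd.
    rewrite updE uk !expr1 => h; apply: sle_trans (@scolMS _ _ _ (X k.+1) _) _.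
    suff <- : powsum (upd (upd n k 1) k.+1 1) (fun t => (t < k) || (k.+1 < t))%N =
      powsum n (fun t => (t != k) && (t != k.+1)) by [].
    by apply: eq_powsum => t _; [lia|move=> tk; rewrite /upd !ifF //; lia].
  have := dd _ n1 k.+1 k.+1 k.+2 (leqnn _) (ltnSn _) kd.
  rewrite updE !expr1 -expr2.
  suff -> : powsum (upd (upd n k 1) k.+1 1) (fun t => (t < k.+1) || (k.+1 < t))%N =
     X k *: top + powsum n (fun t => (t != k) && (t != k.+1)) by [].
  rewrite (@powsum_D1 _ _ k) //=; last by lia.
  rewrite uk expr1; congr (_ + _).
  by apply: eq_powsum => t _; [lia|move=> tk; rewrite /upd !ifF //; lia].
(* Descending induction on k with the exponents before k frozen; the coefficients may depend on
   these. *)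
suff main k : (k <= d)%N -> forall n, (forall j, (0 < n j)%N) -> exists c,
    forall n', (forall j, (0 < n' j)%N) -> (forall j, (j < k)%N -> n' j = n j) ->
    (powlen n')%:Z = pol k c n'.
  by have [//|c cP] := main 0%N isT (fun=> 1%N); exists c => n n0; apply: cP.
move/subnKC; move: (d - k)%N => m; elim: m k => [|m IH] k km n n0.
  move: km; rewrite addn0 => kd; exists (fun=> (powlen n)%:Z) => n' n'0 nn.
  by rewrite kd pol_d (@eq_powlen n' n) // -kd.
have kd : (k < d)%N by lia.
have km' : (k.+1 + m = d)%N by lia.
have u1 n' : (forall j, (0 < n' j)%N) -> forall j, (0 < upd n' k 1 j)%N by move/upd_gt0; apply.
have u2 n' : (forall j, (0 < n' j)%N) -> forall j, (0 < upd n' k 2 j)%N by move/upd_gt0; apply.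
have [c1 c1P] := IH k.+1 km' _ (u1 _ n0); have [c2 c2P] := IH k.+1 km' _ (u2 _ n0).
have ag n' a : (forall j, (j < k)%N -> n' j = n j) ->
    forall j, (j < k.+1)%N -> upd n' k a j = upd n k a j.
  by move=> nn j jk; rewrite /upd; case: eqP => // /eqP jk'; apply: nn; lia.
have polu c n' a : pol k.+1 c (upd n' k a) = pol k.+1 c n'.
  by apply: eq_pol => t kt; rewrite /upd; case: eqP => //; lia.
(* An affine f satisfies f(0) = 2 f(1) - f(2), so e describes the constant coefficient in n_k. *)
pose e i : int := (2 * c1 i + (-1) * c2 i)%R.
have eP n' : (forall j, (0 < n' j)%N) -> (forall j, (j < k)%N -> n' j = n j) ->
    pol k.+1 e n' = (2 * (powlen (upd n' k 1))%:Z - (powlen (upd n' k 2))%:Z)%R.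
  move=> n'0 nn; rewrite /e pol_lin (c1P _ (u1 _ n'0) (ag _ _ nn)).
  by rewrite (c2P _ (u2 _ n'0) (ag _ _ nn)) !polu; ring.
(* This coefficient is nested, hence affine in n_(k+1), and bounded there; so its part divisible by
   n_(k+1) vanishes, and no monomial contains n_(k+1) without n_k. *)
have econst n' : (forall j, (0 < n' j)%N) -> (forall j, (j < k)%N -> n' j = n j) ->
    pol k.+1 e n' = e k.+1.
  move=> n'0 nn; have [ek|kd'] := eqVneq k.+1 d; first by rewrite ek pol_d.
  have {}kd' : (k.+1 < d)%N by lia.
  rewrite pol_recl //; suff -> : pol k.+2 e n' = 0%R by rewrite mulr0 addr0.
  have [C CP] := bnd n' k n'0 kd'.
  apply: (@bounded_lin (e k.+1) _ C) => t t0; have := CP t t0.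
  have ut := upd_gt0 k.+1 n'0 t0.
  have sw a : powlen (upd (upd n' k a) k.+1 t) = powlen (upd (upd n' k.+1 t) k a).
    by apply: eq_powlen => s _; rewrite /upd; do 2!case: eqP => //; lia.
  rewrite !sw -eP //; last by move=> j jk; rewrite /upd; case: eqP => [|_]; [lia|exact: nn].
  rewrite pol_recl // updE (@eq_pol k.+2 e _ n') // => s ks.
  by rewrite /upd; case: eqP => //; lia.
(* The slope f(2) - f(1) in n_k supplies the coefficients beyond k. *)
exists (fun i => if i == k then e k.+1 else ((-1) * c1 i + 1 * c2 i)%R) => n' n'0 nn.
rewrite pol_recl // eqxx (affE _ _ n'0 kd).
have -> : pol k.+1 (fun i => if i == k then e k.+1 else ((-1) * c1 i + 1 * c2 i)%R) n'
        = pol k.+1 (fun i => (-1) * c1 i + 1 * c2 i)%R n'.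
  by apply: eq_big_nat => i ki; case: eqP => //; lia.
rewrite -(econst n') // eP // pol_lin -(polu c1 n' 1%N) -(polu c2 n' 2).
rewrite -(c1P _ (u1 _ n'0) (ag _ _ nn)) -(c2P _ (u2 _ n'0) (ag _ _ nn)); ring.
Qed.

End Powers.

(** * Expansion of the length by multiplicities *)

Section Expansion.
Variables (R : comNzRingType) (V : lmodType R) (X : nat -> R) (d : nat).
Hypothesis nV : noeth V.
Local Notation top := (@stop R V).
Local Notation G := (@powsum R V X d).
Local Notation Lam := (@powlen R V X d).
Hypothesis msX : msys [seq X k | k <- iota 0 d] top sbot.
Implicit Types (n : nat -> nat).

Definition riota m := rev (iota 0 m).

Definition tailsum n m := G n (fun k => m <= k)%N.

(* e(x_1, ..., x_i; (0 : x_(i+1)^n_(i+1))) in M / (x_(i+2)^n_(i+2), ..., x_d^n_d)M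
   for i < d, and e(x_1, ..., x_d; M) for i = d. *)
Definition Ecoef n i : int :=
  if (i < d)%N then
    emult [seq X k | k <- riota i] (tailsum n i.+1 :/ (X i ^+ n i)%R) (tailsum n i.+1)
  else emult [seq X k | k <- riota d] top sbot.

Lemma riotaS m : riota m.+1 = m :: riota m.
Proof. by rewrite /riota -addn1 iotaD rev_cat. Qed.

Lemma prod_riota n m : (\prod_(j <- riota m) n j)%N = (\prod_(0 <= j < m) n j)%N.
Proof. by rewrite /index_iota subn0; apply: perm_big; rewrite perm_rev. Qed.

Lemma mem_riota m k : (k \in riota m) = (k < m)%N.
Proof. by rewrite mem_rev mem_iota. Qed.

Lemma msys_riota n m : (m <= d)%N -> msys [seq X k ^+ n k | k <- riota m]%R top (tailsum n m).
Proof.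
move=> md; rewrite /msys.
suff -> : isum [seq X k ^+ n k | k <- riota m]%R top + tailsum n m = G n predT.
  exact: flen_powsum.
rewrite (@powsum_split R V X d n predT (fun k => k < m)%N); congr (_ + _); last first.
  by apply: eq_powsum => t _ //=; rewrite -leqNgt.
rewrite /riota map_rev isum_rev /isum big_map -[in LHS](subn0 m) -/(index_iota 0 m).
by rewrite big_mkord (big_ord_widen_cond d predT (fun k => (X k ^+ n k)%R *: top)).
Qed.

Lemma tailsumS n m : (m < d)%N ->
  tailsum n m = (X m ^+ n m)%R *: top + tailsum n m.+1.
Proof.
move=> md; rewrite /tailsum (@powsum_D1 R V X d n _ m) //; congr (_ + _).
by apply: eq_powsum => t _ //; lia.
Qed.

Lemma msys_Ecoef n i : (i < d)%N ->
  msys [seq X k | k <- riota i] (tailsum n i.+1 :/ (X i ^+ n i)%R) (tailsum n i.+1).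
Proof.
(* Exponents below i are set to 1, since E_i involves x_1, ..., x_i and not their powers. *)
move=> id; pose n' k := if (k < i)%N then 1%N else n k.
have := @msys_riota n' i.+1 id; rewrite riotaS /= => /(msys_cons2 nV).
have -> : n' i = n i by rewrite /n' ltnn.
have -> : [seq X k ^+ n' k | k <- riota i]%R = [seq X k | k <- riota i].
  by apply/eq_in_map => k; rewrite mem_riota /n' => ->; rewrite expr1.
have -> : tailsum n' i.+1 = tailsum n i.+1.
  by apply: eq_powsum => t _ // it; rewrite /n' ltnNge ltnW.
suff -> : forall B : smod V, top :&: B = B by [].
by move=> B; apply: smod_ext => u; split=> [[]|].
Qed.

Lemma Ecoef_ge0 n i : (0 <= Ecoef n i)%R.
Proof.
rewrite /Ecoef; case: ltnP => id; apply: emult_ge0 => //; first exact: msys_Ecoef.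
move: msX; rewrite /riota map_rev /msys isum_rev //.
Qed.

Lemma powlen_pol n : (forall j, (0 < n j)%N) ->
  (Lam n)%:Z = pol d 0 (Ecoef n) n /\
  emult [seq X k ^+ n k | k <- riota d]%R top sbot =
    ((\prod_(0 <= j < d) n j)%N%:Z * Ecoef n d)%R.
Proof.
move=> n0; have Ed : emult [seq X k ^+ n k | k <- riota d]%R top sbot =
    ((\prod_(0 <= j < d) n j)%N%:Z * Ecoef n d)%R.
  rewrite emult_pow // /Ecoef ?ltnn; last first.
    by move: msX; rewrite /riota map_rev /msys isum_rev.
  by rewrite prod_riota.
split=> //; rewrite /pol big_nat_recr //= -Ed.
have tailGd : tailsum n d = sbot.
  by rewrite /tailsum /powsum big1 // => i /=; rewrite leqNgt ltn_ord.
have tailG0 : tailsum n 0 = G n predT by apply: eq_powsum.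
(* D m runs from the length at m = 0 to the multiplicity of all powers at m = d, and each step of
   the recursion splits off one E_i. *)
pose D m := emult [seq X k ^+ n k | k <- riota m]%R top (tailsum n m).
have -> : (Lam n)%:Z = D 0%N by rewrite /D tailG0.
have -> : emult [seq X k ^+ n k | k <- riota d]%R top sbot = D d by rewrite /D tailGd.
suff H m : (m <= d)%N -> D 0%N =
    (\sum_(0 <= i < m) (\prod_(0 <= j < i) n j)%N%:Z * Ecoef n i + D m)%R by exact: H.
elim: m => [|m IH] md; first by rewrite big_geq // add0r.
rewrite big_nat_recr //= IH 1?ltnW // -addrA; congr (_ + _)%R.
rewrite /D riotaS /= -tailsumS // addrC /Ecoef md.
have -> : top :&: (tailsum n m.+1 :/ (X m ^+ n m)%R) = tailsum n m.+1 :/ (X m ^+ n m)%R.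
  by apply: smod_ext => u; split=> [[]|].
rewrite [X in (_ - X)%R]emult_pow //; last exact: msys_Ecoef.
by rewrite prod_riota subrK.
Qed.

Lemma Ecoef_stable n k : (k < d)%N -> exists t0, forall t, (t0 <= t)%N ->
  Ecoef (upd n k t) k = Ecoef (upd n k t0) k.
Proof.
move=> kd; have [t0 tP] := noeth_scol (tailsum n k.+1) (X k) nV.
have tG t : tailsum (upd n k t) k.+1 = tailsum n k.+1.
  by apply: eq_powsum => s _ // ks; rewrite /upd ifF //; lia.
by exists t0 => t tt; rewrite /Ecoef kd !tG !updE tP.
Qed.

Lemma eq_Ecoef n n' i : (forall t, (i <= t < d)%N -> n t = n' t) -> Ecoef n i = Ecoef n' i.
Proof.
move=> nn; rewrite /Ecoef; case: ltnP => // id.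
have -> : tailsum n i.+1 = tailsum n' i.+1 by apply: eq_powsum => t td // it; apply: nn; lia.
by rewrite nn ?leqnn.
Qed.

Lemma nested_length_Ecoef n : nested_length V X d -> (forall j, (0 < n j)%N) ->
  forall i, (i <= d)%N -> Ecoef n i = Ecoef (fun=> 1%N) i.
Proof.
move=> [c cP]; suff Ec n' i : (forall j, (0 < n' j)%N) -> (i <= d)%N -> Ecoef n' i = c i.
  by move=> n0 i id; rewrite !Ec.
pose D n i := (1 * Ecoef n i + (-1) * c i)%R.
suff H k : (k <= d)%N -> forall n, (forall j, (0 < n j)%N) -> pol d k (D n) n = 0%R.
  move=> n0; rewrite leq_eqVlt => /orP[/eqP ->|id].
    by have := H d (leqnn _) _ n0; rewrite pol_d /D; lia.
  have := H i (ltnW id) _ n0; rewrite pol_recl // (H i.+1 id _ n0) /D; lia.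
elim: k => [_ {}n n0|k IH kd {}n n0].
  by rewrite /D pol_lin -cP // -(powlen_pol n0).1; ring.
have Hk t : (0 < t)%N -> (D (upd n k t) k + t%:Z * pol d k.+1 (D n) n = 0)%R.
  move=> t0; have := IH (ltnW kd) _ (upd_gt0 k n0 t0); rewrite pol_recl // updE.
  suff -> : pol d k.+1 (D (upd n k t)) (upd n k t) = pol d k.+1 (D n) n by [].
  rewrite (@eq_pol d k.+1 _ _ n); last by move=> s ks; rewrite /upd ifF //; lia.
  apply: eq_big_nat => l /andP[kl ld]; rewrite /D (@eq_Ecoef _ n) // => s sl.
  by rewrite /upd ifF //; lia.
(* In [Hk] only E_k depends on t, and it is constant for large t; two consecutive large values force
   the remaining tail to vanish. *)
have [t0 tP] := Ecoef_stable n kd.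
have := Hk t0.+1 isT; have := Hk t0.+2 isT.
rewrite /D !tP ?leqW //; nia.
Qed.

End Expansion.

(** * The bound p_1 and the theorem *)

Section Bound.
Variable d : nat.

(** On the diagonal f grows at most like t^(deg f), while the sum is at least t^i: its terms cannot
    cancel and s i >= 1. *)
Lemma bound_degree (f : {mpoly rat[d]}) (s : nat -> int) (i : nat) : (0 < s i)%R ->
  (i < d)%N -> (forall k, (0 <= s k)%R) ->
  (forall t : nat, (0 < t)%N ->
     ((\sum_(0 <= k < d) (t ^ k)%N%:Z * s k)%R%:~R <= f.@[fun=> t%:R])%R) ->
  (i < msize f)%N.
Proof.
move=> si id s0 fP; rewrite ltnNge; apply/negP => fi.
pose C := (\sum_(m <- msupp f) `|f@_m|)%R.
(* The factor t avoids the exponent i - 1, which would be truncated at i = 0. *)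
have fC (t : nat) : (0 < t)%N -> (t%:R * f.@[fun=> t%:R] <= C * t%:R ^+ i)%R.
  move=> t0; rewrite mevalE mulr_sumr /C mulr_suml; rewrite !big_seq; apply: ler_sum => m mf.
  have -> : (\prod_(j < d) t%:R ^+ m j = t%:R ^+ mdeg m :> rat)%R.
    by rewrite mdegE prodrXr.
  rewrite mulrCA -exprS; apply: (@le_trans _ _ (`|f@_m| * t%:R ^+ (mdeg m).+1)%R).
    by apply: ler_wpM2r; [apply: exprn_ge0; apply: ler0n|apply: ler_norm].
  apply: ler_wpM2l; first exact: normr_ge0.
  apply: ler_weXn2l; first by rewrite ler1n.
  exact: leq_trans (msize_mdeg_lt mf) fi.
have C0 : (0 <= C)%R by apply: sumr_ge0 => m _; apply: normr_ge0.
have Ct := archi_boundP C0; set t := Num.bound C in Ct.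
have t0 : (0 < t)%N by rewrite -(@ltr0n rat); apply: le_lt_trans Ct.
have sumt : ((t ^ i)%N%:Z <= \sum_(0 <= k < d) (t ^ k)%N%:Z * s k)%R.
  rewrite big_mkord (bigD1 (Ordinal id)) //= -[X in (X <= _)%R]addr0; apply: lerD.
    by rewrite -[X in (X <= _)%R]mulr1; apply: ler_wpM2l => //; lia.
  by apply: sumr_ge0 => k _; apply: mulr_ge0.
have := fC t t0; apply/negP; rewrite -ltNge.
apply: (@lt_le_trans _ _ (t%:R * t%:R ^+ i)%R).
  by rewrite ltr_pM2r // exprn_gt0 // ltr0n.
apply: ler_wpM2l; first exact: ler0n.
apply: le_trans (fP t t0); rewrite -natrX -[(t ^ i)%:R%R]/((t ^ i)%N%:Z%:~R)%R.
by rewrite ler_int.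
Qed.

End Bound.

Section Bridge.
Variables (R : comNzRingType) (M : lmodType R) (d : nat).
Variable x : d.-tuple R.
Let X k := x`_k.
Local Notation top := (@stop R M).

Definition ext (n : 'I_d -> nat) k : nat := oapp n 1%N (insub k).

Lemma ext_gt0 n : (forall j, (0 < n j)%N) -> forall k, (0 < ext n k)%N.
Proof. by move=> n0 k; rewrite /ext; case: insub => /=. Qed.

Lemma extE n (j : 'I_d) : ext n j = n j.
Proof. by rewrite /ext valK. Qed.

Lemma pw_ext n : pw x n = [seq X k ^+ ext n k | k <- iota 0 d]%R :> seq R.
Proof.
apply: (@eq_from_nth _ 0%R); first by rewrite size_tuple size_map size_iota.
move=> i; rewrite size_tuple => id; rewrite (nth_map 0%N) ?size_iota // nth_iota // add0n.
have -> : i = Ordinal id by [].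
by rewrite -tnth_nth tnth_mktuple extE (tnth_nth 0%R).
Qed.

Lemma take_pw n i : (i <= d)%N -> take i (pw x n) = [seq X k ^+ ext n k | k <- iota 0 i]%R.
Proof. by move=> id; rewrite pw_ext -map_take take_iota (minn_idPl id). Qed.

Lemma drop_pw n i : drop i (pw x n) = [seq X k ^+ ext n k | k <- iota i (d - i)]%R.
Proof. by rewrite pw_ext -map_drop drop_iota ?addn0 ?add0n. Qed.

Lemma isum_take n i : (i <= d)%N ->
  isum [seq X k ^+ n k | k <- iota 0 i]%R top = @powsum R M X d n (fun k => k < i)%N.
Proof.
move=> id; rewrite /isum big_map -[in LHS](subn0 i) -/(index_iota 0 i) big_mkord.
by rewrite (big_ord_widen_cond d predT (fun k => (X k ^+ n k)%R *: top)).
Qed.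

Lemma isum_drop n i : (i <= d)%N ->
  isum [seq X k ^+ n k | k <- iota i (d - i)]%R top = @powsum R M X d n (fun k => i <= k)%N.
Proof.
move=> id; rewrite /isum big_map -/(index_iota i d) /powsum.
rewrite -(big_mkord (fun k => i <= k)%N (fun k => (X k ^+ n k)%R *: top)).
rewrite (big_cat_nat (leq0n i) id) /= [X in _ = X + _]big1_seq ?sadd0.
  by rewrite [LHS]big_nat_cond [RHS]big_nat_cond; apply: eq_bigl => k; lia.
by move=> k; rewrite mem_index_iota; lia.
Qed.

End Bridge.

(** Moves the colons of [d_sequence], taken in a quotient of M, back to M. *)
Lemma qpi_isum (R : comNzRingType) (M : lmodType R) (S : submodClosed M) z :
  spre (@qpi_linear _ _ S) (isum z stop) = isum z stop + smod_of S.
Proof.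
apply: smod_ext => u; split.
  elim: z u => [|a z IH] u.
    by rewrite !isum_nil sadd0 => /qpi_eq0.
  rewrite !isum_cons -saddA => -[_ [w _ ->]].
  rewrite -[w]reprK -/(qpi S _) -qpiZ => h.
  have /IH hu : spre (@qpi_linear _ _ S) (isum z stop) (u - a *: repr w)%R.
    by rewrite /= -[(_ - _)%R]addrC -scaleN1r qpi_linear scaleN1r addrC.
  by exists (a *: repr w)%R => //; exists (repr w).
rewrite -/(smem (spre (@qpi_linear _ _ S) (isum z stop)) u); move: u.
apply: sadd_le => u.
  move=> zu; rewrite /=; elim: z u zu => [|a z IH] u; first rewrite !isum_nil => ->.
    by apply/qpi_eq0; apply: rpred0.
  rewrite !isum_cons => -[_ [w _ ->] /IH h]; exists (a *: qpi S w)%R; first by exists (qpi S w).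
  rewrite -qpiZ; move: h; rewrite -[(u - _)%R]addrC -scaleN1r qpi_linear.
  by rewrite scaleN1r addrC.
by move=> /qpi_eq0 /= ->; apply: smem0.
Qed.

Section Final.
Variables (R : comNzRingType) (M : lmodType R) (d : nat) (x : d.-tuple R).
Local Notation X := (nth 0%R x).
Local Notation top := (@stop R M).
Local Notation G := (@powsum R M X d).
Local Notation DD := (@dd_powers R M X d).
Local Notation E := (@Ecoef R M X d).
Local Notation one := (fun=> 1%N).
Hypothesis nM : noeth M.
Hypothesis msX : msys [seq X k | k <- iota 0 d] top sbot.

Lemma mem_colon (S : submodClosed M) z a u :
  qpi S u \in colon (smul (quotmod S) z) a <-> ((isum z top + smod_of S) :/ a) u.
Proof.
have -> : qpi S u \in colon (smul (quotmod S) z) a <->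
    smod_of (smul (quotmod S) z) (a *: qpi S u)%R by [].
by rewrite smod_of_smul -qpiZ -(qpi_isum S z).
Qed.

Lemma mem_colon_pw n i l a u : (i <= l)%N -> (l <= d)%N ->
  qpi (smul M (drop l (pw x n))) u \in
    colon (smul (modmul M (drop l (pw x n))) (take i (take l (pw x n)))) a <->
  (G (ext n) (fun k => (k < i) || (l <= k))%N :/ a) u.
Proof.
move=> il ld; rewrite mem_colon smod_of_smul take_takel // take_pw ?(leq_trans il) //.
rewrite drop_pw isum_take ?(leq_trans il) // isum_drop //.
suff -> : G (ext n) (fun k => k < i)%N + G (ext n) (fun k => l <= k)%N =
  G (ext n) (fun k => (k < i) || (l <= k))%N by [].
rewrite [RHS](@powsum_split R M X d _ _ (fun k => k < i)%N).
by congr (_ + _); apply: eq_powsum => //; lia.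
Qed.

Lemma nth_pw n l j : (j < l)%N -> (l <= d)%N -> (take l (pw x n))`_j = (X j ^+ ext n j)%R.
Proof.
move=> jl ld; rewrite take_pw // (nth_map 0%N) ?size_iota // nth_iota //.
Qed.

Lemma dd_sequence_powers : dd_sequence M x <-> DD.
Proof.
split=> [dd n n0 i j l ij jl ld|dd l /andP[l0 ld] n n0 i j ij].
  pose n' (k : 'I_d) := n k.
  have nE k : (k < d)%N -> ext n' k = n k by move=> kd; apply: (extE n' (Ordinal kd)).
  have GE : G n (fun k => (k < i) || (l <= k))%N = G (ext n') (fun k => (k < i) || (l <= k))%N.
    by apply: eq_powsum => // k kd _; rewrite nE.
  have ls : (0 < l <= d)%N by lia.
  have sz : (j < size (take l (pw x n')))%N by rewrite size_takel ?size_tuple.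
  have := dd l ls n' (fun k => n0 k) i j ij sz; rewrite !nth_pw ?(leq_ltn_trans ij) //.
  rewrite !nE ?(leq_trans jl) ?(leq_trans _ ld) ?(leq_ltn_trans ij) // => h u.
  rewrite GE => /(mem_colon_pw _ _ _ (leq_trans ij (ltnW jl)) ld).
  by rewrite -h => /mem_colon_pw; apply=> //; lia.
rewrite size_takel ?size_tuple // => jl v.
rewrite !nth_pw ?(leq_ltn_trans ij) // -[v]reprK -/(qpi _ (repr v)).
have il : (i <= l)%N by lia.
apply/idP/idP => /(mem_colon_pw _ _ _ il ld) h; apply/(mem_colon_pw _ _ _ il ld).
  by move: h; rewrite mulrC; apply: scolMS.
by move: h; apply: dd => //; apply: ext_gt0.
Qed.

Lemma pw1 : pw x one = x.
Proof. by apply: eq_from_tnth => i; rewrite tnth_mktuple expr1. Qed.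

Lemma ext1 : ext (one : 'I_d -> nat) = one.
Proof. by apply: funext => k; rewrite /ext; case: insub. Qed.

Lemma rev_pw n : rev (pw x n) = [seq X k ^+ ext n k | k <- riota d]%R.
Proof. by rewrite pw_ext -map_rev. Qed.

Lemma tailsum_d n : tailsum M X d n d = sbot.
Proof. by rewrite /tailsum /powsum big1 // => i /=; rewrite leqNgt ltn_ord. Qed.

(** chi_1 is the length minus e, and e is the term i = d of the expansion. *)
Lemma chi1_pol n : (forall j, (0 < n j)%N) ->
  chi M (pw x n) 1 =
  (\sum_(0 <= i < d) (\prod_(0 <= j < i) ext n j)%N%:Z * E (ext n) i)%R.
Proof.
move=> n0; have e0 := ext_gt0 n0; have [LE eE] := powlen_pol nM msX e0.
rewrite chi1E // rev_pw; last by rewrite -(tailsum_d (ext n)); apply: msys_riota.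
have -> : len top (isum (pw x n) top) = powlen M X d (ext n).
  by rewrite /powlen powsum_isum pw_ext.
by rewrite LE eE /pol big_nat_recr //= addrK.
Qed.

Lemma serre_mult_coef (i : 'I_d) :
  serre_mult (kerby (modmul M (drop i.+1 x)) (tnth x i)) (take i x) = E one i.
Proof.
have id := ltn_ord i.
have ti : take i x = [seq X k | k <- iota 0 i].
  by have := take_pw x one (ltnW id); rewrite pw1 ext1 => ->.
have di : isum (drop i.+1 x) top = tailsum M X d one i.+1.
  by have := drop_pw x one i.+1; rewrite pw1 ext1 => ->; rewrite isum_drop.
have ri : rev (take i x) = [seq X k | k <- riota i] by rewrite ti -map_rev.
have mE := msys_Ecoef nM msX one id; rewrite expr1 in mE.
rewrite serre_multE.
- by rewrite ri emult_kerby di /Ecoef id expr1 (tnth_nth 0%R).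
- exact: noeth_kerby.
by apply/msys_kerby; rewrite ri di (tnth_nth 0%R).
Qed.

Lemma prod_ext n (i : 'I_d) :
  (\prod_(j < d | (j < i)%N) n j = \prod_(0 <= j < i) ext n j)%N.
Proof.
rewrite big_mkord (big_ord_widen_cond d predT (ext n)) ?(ltnW (ltn_ord i)) //.
by apply: eq_big => j //= _; rewrite extE.
Qed.

(** [nat_such] avoids its default value once some bounding polynomial exists; in the nested case
    chi_1 is itself a polynomial. *)
Lemma p_sizeP : nested_length M X d -> bound_size M 1 x (p_size M 1 x).
Proof.
move=> gd.
have [s0 bs0] : exists s, bound_size M 1 x s.
  pose f : {mpoly rat[d]} := (\sum_(i < d) (E one i)%:~R *: \prod_(j < d | (j < i)%N) 'X_j)%R.
  exists (msize f), f; split=> // n n0; rewrite chi1_pol // big_mkord.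
  rewrite /f raddf_sum rmorph_sum /=; apply: ler_sum => i _.
  rewrite (nested_length_Ecoef nM msX gd) ?(ltnW (ltn_ord i)) //; last exact: ext_gt0.
  rewrite mevalZ intrM mulrC [X in (_ <= _ * X)%R]rmorph_prod /=.
  under [X in (_ <= _ * X)%R]eq_bigr => j _ do rewrite mevalXU.
  by rewrite -natr_prod -prod_ext.
suff [s [bs mins]] : exists s, bound_size M 1 x s /\ forall t, bound_size M 1 x t -> (s <= t)%N.
  by have [] := nat_suchP (ex_intro (fun s => bound_size M 1 x s /\
    forall t, bound_size M 1 x t -> (s <= t)%N) s (conj bs mins)).
have ex : exists s, `[< bound_size M 1 x s >] by exists s0; apply/asboolP.
have [s /asboolP bs mins] := ex_minnP ex.
by exists s; split=> // t bt; apply: mins; apply/asboolP.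
Qed.

(** On the diagonal a bounding polynomial of least degree dominates t^i E_i, because the other terms
    are nonnegative. *)
Lemma Ecoef_p_size (i : 'I_d) : nested_length M X d -> (p_size M 1 x <= i)%N -> E one i = 0%R.
Proof.
move=> gd pi; have [f [fs fP]] := p_sizeP gd.
have E0 k : (0 <= E one k)%R := Ecoef_ge0 nM msX one k.
apply/eqP; rewrite eq_le E0 andbT leNgt; apply/negP => Ei.
suff : (i < msize f)%N by rewrite fs ltnNge pi.
apply: (@bound_degree _ f (E one) i) => // t t0.
have := fP (fun=> t) (fun=> t0); rewrite chi1_pol //.
have -> : (\sum_(0 <= k < d) (\prod_(0 <= j < k) ext (fun _ : 'I_d => t) j)%N%:Z *
    E (ext (fun _ : 'I_d => t)) k = \sum_(0 <= k < d) (t ^ k)%N%:Z * E one k)%R.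
  apply: eq_big_nat => k /andP[_ kd].
  rewrite (nested_length_Ecoef nM msX gd) ?(ltnW kd) //; last exact: ext_gt0.
  have <- : (\prod_(0 <= j < k) t = t ^ k)%N by rewrite prod_nat_const_nat subn0.
  congr (_ %:Z * _)%R.
  apply: eq_big_nat => j /andP[_ jk].
  by rewrite -[j]/(nat_of_ord (Ordinal (ltn_trans jk kd))) extE.
by [].
Qed.

Hypothesis jX : forall k, (k < d)%N -> jacobson (X k).

Lemma dd_formula :
  dd_sequence M x <->
  forall n : 'I_d -> nat, (forall j, (0 < n j)%N) ->
    chi M (pw x n) 1 =
    (\sum_(i < d | (i < p_size M 1 x)%N)
       (\prod_(j < d | (j < i)%N) n j)%N%:Z *
       serre_mult (kerby (modmul M (drop i.+1 x)) (tnth x i)) (take i x))%R.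
Proof.
rewrite dd_sequence_powers; split=> [dd n n0|h].
  have gd : nested_length M X d by apply: dd_powers_nested_length.
  rewrite chi1_pol // big_mkord [RHS]big_mkcond; apply: eq_bigr => i _ /=.
  rewrite (nested_length_Ecoef nM msX gd) ?(ltnW (ltn_ord i)) //; last exact: ext_gt0.
  case: ltnP => [_|pi]; last by rewrite (Ecoef_p_size gd pi) mulr0.
  by rewrite serre_mult_coef prod_ext.
apply: (nested_length_dd_powers nM jX msX).
(* chi_1 omits the term n_1 ... n_d e(x; M) of the length, so it is restored at index d; indices
   past p_1(M) get 0. *)
exists (fun i => if (i < d)%N then (if (i < p_size M 1 x)%N then E one i else 0%R) else E one d).
move=> n n0; pose n' (k : 'I_d) := n k.
have n'0 k : (0 < n' k)%N by apply: n0.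
have nE k : (k < d)%N -> n k = ext n' k by move=> kd; apply/esym/(extE n' (Ordinal kd)).
have [LE _] := powlen_pol nM msX (ext_gt0 n'0).
rewrite (eq_powlen _ _ nE) LE [RHS](@eq_pol d 0 _ n (ext n')); last by move=> t td; apply: nE.
rewrite /pol !(big_nat_recr d) //= ltnn; congr (_ + _ * _)%R; last first.
  by apply: eq_Ecoef => t; lia.
rewrite -(chi1_pol n'0) (h _ n'0) [LHS]big_mkcond [RHS]big_mkord; apply: eq_bigr => i _ /=.
rewrite ltn_ord; case: ifP => _; last by rewrite mulr0.
by rewrite serre_mult_coef prod_ext.
Qed.

End Final.

Local Close Scope quotient_scope.
Local Close Scope smod_scope.

(* The sum runs over 0 <= i <= p_1(M), that is i < p_size M 1 x; the element
   x_{i+1} (here tnth x i) only makes sense for i < d, and p_1(M) < d. *)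
Theorem theorem1p2 (R : comNzRingType) (m : idealr R)
    (noethR : noetherian R) (localR : local m)
    (M : lmodType R) (fgM : fin_gen (predT : {pred M}))
    (d : nat) (dimM : has_dim M d) (x : d.-tuple R) (sopx : sop m M x) :
  dd_sequence M x <->
  forall n : 'I_d -> nat, (forall j, (0 < n j)%N) ->
    chi M (pw x n) 1 =
    \sum_(i < d | (i < p_size M 1 x)%N)
       (\prod_(j < d | (j < i)%N) n j)%N%:Z *
       serre_mult (kerby (modmul M (drop i.+1 x)) (tnth x i)) (take i x).
Proof.
have nM := fin_gen_noeth noethR fgM.
have [_ xm /finite_lengthE fl] := sopx.
have [h1 h2 h3 h4 h5] := @siso_quot _ _ (smul M x) stop stop (@sle_top _ _ _) (fun=> iff_refl _).
apply: dd_formula => //; last first.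
  by move=> k kd; apply: (local_jacobson localR); apply: xm; apply: mem_nth; rewrite size_tuple.
rewrite /msys [(_ + sbot)%S]saddC sadd0.
have -> : [seq nth 0 x k | k <- iota 0 d] = x.
  by rewrite -[in RHS](mkseq_nth 0 x) size_tuple.
rewrite -smod_of_smul; apply/(flen_map (@qpi_linear _ _ _) h1 h2 h3 h4 h5).
exact: fl.
Qed.
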